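(* Let $p$ be a prime, $D=\{0,1,\dots,p-1\}$ identified with $\mathbb Z_p=\mathsf{GF}(p)$, and let $\Gamma$ be a constraint language over $D$ in which each relation is the solution set of a system of linear equations modulo $p$. Then for fixed $d$ and $p$, $\textsc{IMP}_d(\Gamma)$ can be solved in polynomial time.
   Context: For an instance $\mathcal P=(X,D,C)$ of $\textsc{CSP}(\Gamma)$ (constraints $R(x_{i_1},\dots,x_{i_k})$ with $R\in\Gamma$; solutions are maps $X\to D$ satisfying them), $\mathtt{I}(\mathcal P)\subseteq\mathbb{R}[X]$ is the ideal generated by domain polynomials $\prod_{a\in D}(x-a)$ and constraint-interpolating polynomials; it equals the set of real polynomials vanishing on all solutions. $\textsc{IMP}_d(\Gamma)$: given $(f_0,\mathcal P)$ with $f_0\in\mathbb{R}[X]$, $\deg f_0\le d$, decide whether $f_0\in\mathtt{I}(\mathcal P)$. *)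

(* Defs.v *)
From mathcomp Require Import all_boot all_order all_algebra reals.
From mathcomp Require Import mpoly.

Set Implicit Arguments.
Unset Strict Implicit.
Unset Printing Implicit Defensive.

Import Order.TTheory GRing.Theory Num.Theory.
Local Open Scope ring_scope.

(* Deterministic multi-tape Turing machines.  The tapes are two-way infinite; *)
(* [None] is the blank cell, and the tape alphabet may extend the input       *)
(* alphabet [A] with work symbols.                                            *)

Inductive move := MoveLeft | Stay | MoveRight.

(* The left part is listed from the head outwards, and so is the right part;  *)
(* all cells beyond the two lists are blank.                                  *)
Record tape (S : Type) := Tape
  { tape_left : seq (option S); tape_head : option S;
    tape_right : seq (option S) }.

Definition blank_tape (S : Type) : tape S := Tape [::] None [::].

Definition tape_of_word (S : Type) (w : seq S) : tape S :=
  if w is a :: w' then Tape [::] (Some a) (map Some w') else blank_tape S.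

Definition tape_write (S : Type) (c : option S) (t : tape S) : tape S :=
  Tape (tape_left t) c (tape_right t).

Definition tape_move (S : Type) (mv : move) (t : tape S) : tape S :=
  let: Tape l h r := t in
  match mv with
  | MoveLeft => Tape (behead l) (head None l) (h :: r)
  | Stay => t
  | MoveRight => Tape (h :: l) (head None r) (behead r)
  end.

Record turing_machine (A : finType) := TuringMachine
  { tm_tapes : nat;                      (* there are tm_tapes.+1 tapes *)
    tm_work : finType;
    tm_state : finType;
    tm_start : tm_state;
    tm_final : tm_state -> option bool;  (* Some b: halt with answer b *)
    tm_trans : tm_state -> {ffun 'I_tm_tapes.+1 -> option (A + tm_work)} ->
      tm_state * {ffun 'I_tm_tapes.+1 -> option (A + tm_work) * move} }.

Record tm_config (A : finType) (M : turing_machine A) := TMConfig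
  { cfg_state : tm_state M;
    cfg_tapes : {ffun 'I_(tm_tapes M).+1 -> tape (A + tm_work M)} }.

Definition tm_init (A : finType) (M : turing_machine A) (w : seq A) :
    tm_config M :=
  TMConfig (tm_start M)
    [ffun i => if i == ord0 then tape_of_word [seq inl a | a <- w]
               else blank_tape _].

Definition tm_step (A : finType) (M : turing_machine A) (c : tm_config M) :
    tm_config M :=
  if tm_final (cfg_state c) is Some _ then c else
  let: (q, act) :=
    tm_trans (cfg_state c) [ffun i => tape_head (cfg_tapes c i)] in
  TMConfig q
    [ffun i => tape_move (act i).2 (tape_write (act i).1 (cfg_tapes c i))].

Definition tm_answers (A : finType) (M : turing_machine A) (w : seq A)
    (t : nat) (b : bool) : Prop :=
  tm_final (cfg_state (iter t (@tm_step A M) (tm_init M w))) = Some b.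

(* Decision problem with instances [I], encoded by [enc], and yes-instances   *)
(* [yes].  As usual for problems with a promise on the input, nothing is      *)
(* required of the machine on words that do not encode an instance.           *)
Definition poly_time_solvable (A : finType) (I : Type) (enc : I -> seq A)
    (yes : I -> Prop) : Prop :=
  exists (M : turing_machine A) (q : {poly nat}), forall x : I,
    exists b : bool,
      tm_answers M (enc x) q.[size (enc x)] b /\ (b = true <-> yes x).

(* Constraint satisfaction over the domain 'F_p = {0, ..., p - 1}. *)

Definition constraint_language (p : nat) :=
  forall k : nat, {set k.-tuple 'F_p} -> Prop.

Definition linear_relation (p k : nat) (S : {set k.-tuple 'F_p}) : Prop :=
  exists (m : nat) (A : 'M['F_p]_(m, k)) (b : 'cV['F_p]_m),
    forall t : k.-tuple 'F_p,
      t \in S <-> A *m (\col_(j < k) tnth t j) = b.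

(* A variable may occur several times in a scope. *)
Record csp_constraint (p n : nat) := CSPConstraint
  { c_arity : nat;
    c_rel : {set c_arity.-tuple 'F_p};
    c_scope : c_arity.-tuple 'I_n }.

Record csp_instance (p : nat) (G : constraint_language p) := CSPInstance
  { csp_nvars : nat;
    csp_constraints : seq (csp_constraint p csp_nvars);
    csp_in_language : forall i : 'I_(size csp_constraints),
      let c := tnth (in_tuple csp_constraints) i in G (c_arity c) (c_rel c) }.

(* The ideal I(P) of R[X]. *)

Definition generated_ideal (A : comNzRingType) (gen : A -> Prop) (f : A) :
    Prop :=
  exists (r : nat) (h g : 'I_r -> A),
    (forall i, gen (g i)) /\ f = \sum_(i < r) h i * g i.

Definition domain_val (R : realType) (p : nat) (a : 'F_p) : R :=
  (nat_of_ord a)%:R.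

Definition domain_poly (R : realType) (p n : nat) (i : 'I_n) : {mpoly R[n]} :=
  \prod_(a : 'F_p) ('X_i - (domain_val R a)%:MP).

(* Lagrange interpolation over the grid: on an assignment with values in the  *)
(* domain it is 0 if the constraint holds and 1 otherwise.                    *)
Definition constraint_poly (R : realType) (p n : nat)
    (c : csp_constraint p n) : {mpoly R[n]} :=
  \sum_(t in ~: c_rel c) \prod_(j < c_arity c)
    \prod_(a : 'F_p | a != tnth t j)
      ((domain_val R (tnth t j) - domain_val R a)^-1 *:
         ('X_(tnth (c_scope c) j) - (domain_val R a)%:MP)).

Definition csp_generator (R : realType) (p : nat) (G : constraint_language p)
    (P : csp_instance G) (g : {mpoly R[csp_nvars P]}) : Prop :=
  (exists i : 'I_(csp_nvars P), g = domain_poly R p i) \/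
  (exists i : 'I_(size (csp_constraints P)),
     g = constraint_poly R (tnth (in_tuple (csp_constraints P)) i)).

Definition csp_ideal (R : realType) (p : nat) (G : constraint_language p)
    (P : csp_instance G) (f : {mpoly R[csp_nvars P]}) : Prop :=
  generated_ideal (@csp_generator R p G P) f.

(* Instances of IMP_d(G).                                                     *)
(* A Turing machine needs a finite description of the real coefficients of    *)
(* f_0: they are given by their rational coordinates on some finite family of *)
(* reals that is linearly independent over the rationals.  Every real         *)
(* polynomial has such a presentation, and [:: 1] is a suitable family when   *)
(* the coefficients are rational.                                             *)

Definition rat_free (R : realType) (m : nat) (u : m.-tuple R) : Prop :=
  forall a : 'I_m -> rat,
    \sum_(j < m) ratr (a j) * tnth u j = 0 -> forall j, a j = 0.

Definition poly_of_coords (R : realType) (n m : nat) (u : m.-tuple R)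
    (f : m.-tuple {mpoly rat[n]}) : {mpoly R[n]} :=
  \sum_(j < m) tnth u j *: map_mpoly (ratr : rat -> R) (tnth f j).

(* [msize f] is the degree of [f] plus one, and 0 for [f = 0]. *)
Record imp_instance (R : realType) (p d : nat) (G : constraint_language p) :=
  IMPInstance
  { imp_csp : csp_instance G;
    imp_dim : nat;
    imp_basis : imp_dim.-tuple R;
    imp_coords : imp_dim.-tuple {mpoly rat[csp_nvars imp_csp]};
    imp_basis_free : rat_free imp_basis;
    imp_degree : (msize (poly_of_coords imp_basis imp_coords) <= d.+1)%N }.

Definition imp_poly (R : realType) (p d : nat) (G : constraint_language p)
    (x : imp_instance R d G) : {mpoly R[csp_nvars (imp_csp x)]} :=
  poly_of_coords (imp_basis x) (imp_coords x).

Definition imp_yes (R : realType) (p d : nat) (G : constraint_language p)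
    (x : imp_instance R d G) : Prop :=
  csp_ideal (imp_poly x).

(* Encoding of the instances as words over two bits [inl _] and the two       *)
(* brackets [inr true] (opening) and [inr false] (closing).                   *)

Definition letter : finType := (bool + bool)%type.

Definition enc_node (s : seq (seq letter)) : seq letter :=
  inr true :: rcons (flatten s) (inr false).

Definition enc_list (T : Type) (e : T -> seq letter) (s : seq T) :
    seq letter :=
  enc_node (map e s).

(* Binary digits, least significant first. *)
Definition nat_bits (k : nat) : bitseq :=
  [seq odd (k %/ 2 ^ i) | i <- iota 0 (trunc_log 2 k).+1].

Definition enc_bits (s : bitseq) : seq letter :=
  enc_list (fun b : bool => [:: inl b]) s.

Definition enc_nat (k : nat) : seq letter := enc_bits (nat_bits k).

(* The first bit is the sign. *)
Definition enc_int (z : int) : seq letter :=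
  enc_bits ((z < 0) :: nat_bits `|z|%N).

Definition enc_rat (a : rat) : seq letter :=
  enc_node [:: enc_int (numq a); enc_int (denq a)].

Definition enc_tuple (p k : nat) (t : k.-tuple 'F_p) : seq letter :=
  enc_list (fun a : 'F_p => enc_nat a) t.

(* A relation is given by the list of its tuples. *)
Definition enc_constraint (p n : nat) (c : csp_constraint p n) : seq letter :=
  enc_node [:: enc_list (@enc_tuple p (c_arity c)) (enum (c_rel c));
               enc_list (fun i : 'I_n => enc_nat i) (c_scope c)].

Definition enc_mpoly (n : nat) (f : {mpoly rat[n]}) : seq letter :=
  enc_list (fun m : 'X_{1..n} =>
              enc_node [:: enc_rat f@_m; enc_list enc_nat (tval m)])
           (msupp f).

(* The variables, the constraints, and f_0 by its rational coordinates. *)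
Definition enc_imp (R : realType) (p d : nat) (G : constraint_language p)
    (x : imp_instance R d G) : seq letter :=
  let n := csp_nvars (imp_csp x) in
  enc_node [:: enc_list (fun i : 'I_n => enc_nat i) (enum 'I_n);
               enc_list (@enc_constraint p n) (csp_constraints (imp_csp x));
               enc_list (@enc_mpoly n) (imp_coords x)].

Definition imp_poly_time (R : realType) (p d : nat)
    (G : constraint_language p) : Prop :=
  poly_time_solvable (@enc_imp R p d G) (@imp_yes R p d G).

(* Main.v *)
(* The polynomial f_0 belongs to the ideal if and only if it vanishes on the  *)
(* set V of solutions (Lagrange interpolation), hence if and only if each of  *)
(* its rational coordinates f does. Since the sum of f(x)^2 over V is a       *)
(* linear combination of the sums of f(x) x^b, for the monomials x^b of f, f  *)
(* vanishes on V if and only if the average over V of f x^b is zero for each  *)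
(* of these monomials. By linearity this is an equality between the averages  *)
(* of monomials x^a x^b in at most 2d variables. Now V is affine, so that all *)
(* the nonempty fibres of a variable on V have the same number of points; the *)
(* average is thus computed by fixing the values of these variables one after *)
(* the other, in at most p^(2d) ways, and testing each time by Gaussian       *)
(* elimination whether the resulting linear system has a solution.            *)
(* Polynomial time is obtained once and for all for a class of functions on   *)
(* binary trees: a machine whose tapes are used as stacks replaces the code   *)
(* of the argument by the code of the value and leaves the rest of the stacks *)
(* unchanged. The class is closed under composition, pairing, case            *)
(* distinctions, and iteration over a list when the sizes of the intermediate *)
(* values are polynomially bounded.                                           *)

From HB Require Import structures.
Require Import Defs.
From mathcomp Require Import all_boot all_order all_algebra reals.
From mathcomp Require Import mpoly zify ring.
From mathcomp Require boolp.

Set Implicit Arguments.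
Unset Strict Implicit.
Unset Printing Implicit Defensive.
Import Order.TTheory GRing.Theory Num.Theory.

(** * Stack programs compiled to Turing machines *)

(** Correctness is a chain of equivalences. By [csp_idealP], membership in the ideal is vanishing on
    the solutions: the Lagrange polynomials of the grid points sum to 1, and modulo the ideal each
    of them turns a polynomial into its value at that point. By [imp_poly_eq0], linear independence
    over the rationals splits vanishing of the real polynomial into vanishing of its rational
    coordinates, which by [imp_coords_degree] have degree at most [d] as well. By
    [orthogonal_vanish], a rational polynomial vanishes on the solutions once it is orthogonal there
    to each of its own monomials. By [weightP], these inner products reduce to averages of products
    of at most [2d] variable powers, which recursion over the values of the variables computes from
    feasibility tests alone, because all inhabited fibres of a variable have the same cardinality
    ([card_fibres]). By [feasP], feasibility is decided by linear algebra on generators of the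
    homogenized solution space; relations are listed tuple by tuple, so a constraint is imposed
    through the span of its homogenized tuples rather than through equations.

    For the running time, [exec_run] shows that stack programs are simulated by Turing machines with
    the stated step counts, [FP_foldl] gives iteration with controlled growth, and [FP_poly_time]
    turns a member of the class [FP] into a polynomial-time machine. As [p] and [d] are fixed,
    arithmetic in the field is a finite table ([FP_finite]) and the recursion in [weight] has
    constant depth and branching. The number of generators grows only additively with each
    constraint ([size_elim], [size_extend]), so feasibility is polynomial ([FP_gens]). *)

Definition sym : finType := (letter + option bool)%type.
Definition node_sym : sym := inr (Some true).
Definition leaf_sym : sym := inr (Some false).
(** A delimiter that occurs in no code of a tree, so that it can end a scan of a stack. *)
Definition mark_sym : sym := inr None.

Inductive reg := RA | RB | RC | RD.

Definition r2o (r : reg) : 'I_4 :=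
  match r with
  | RA => @Ordinal 4 0 isT
  | RB => @Ordinal 4 1 isT
  | RC => @Ordinal 4 2 isT
  | RD => @Ordinal 4 3 isT
  end.
Definition o2r (i : 'I_4) : reg := nth RA [:: RA; RB; RC; RD] i.

Lemma r2oK : cancel r2o o2r. Proof. by case. Qed.
HB.instance Definition _ := Equality.copy reg (can_type r2oK).

Record state := St { sA : seq sym; sB : seq sym; sC : seq sym; sD : seq sym }.

Definition get (s : state) (r : reg) : seq sym :=
  match r with RA => sA s | RB => sB s | RC => sC s | RD => sD s end.

Definition put (s : state) (r : reg) (w : seq sym) : state :=
  match r with
  | RA => St w (sB s) (sC s) (sD s)
  | RB => St (sA s) w (sC s) (sD s)
  | RC => St (sA s) (sB s) w (sD s)
  | RD => St (sA s) (sB s) (sC s) w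
  end.

Lemma get_put s r w r' :
  get (put s r w) r' = if r' == r then w else get s r'.
Proof. by case: r r' => [] []. Qed.

(* [Push r i g] pushes on the stack [r] the symbol computed by [g] from the   *)
(* top of another stack [i].                                                  *)
Inductive cmd :=
| Skip
| Push (r i : reg) (g : option sym -> sym)
| Pop (r : reg)
| Seq (c1 c2 : cmd)
| If (r : reg) (P : option sym -> bool) (c1 c2 : cmd)
| While (r : reg) (P : option sym -> bool) (c : cmd).

(* [exec c s t s']: from [s], the command [c] terminates in [s'] within [t]   *)
(* steps of the machine compiled below.                                       *)
Inductive exec : cmd -> state -> nat -> state -> Prop :=
| ESkip s : exec Skip s 0 s
| EPush r i g s : i != r ->
    exec (Push r i g) s 2 (put s r (g (ohead (get s i)) :: get s r))
| EPop r s : exec (Pop r) s 1 (put s r (behead (get s r)))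
| ESeq c1 c2 s t1 s1 t2 s2 : exec c1 s t1 s1 -> exec c2 s1 t2 s2 ->
    exec (Seq c1 c2) s (t1 + t2) s2
| EIfT r (P : option sym -> bool) c1 c2 s t s' : P (ohead (get s r)) -> exec c1 s t s' ->
    exec (If r P c1 c2) s t.+1 s'
| EIfF r (P : option sym -> bool) c1 c2 s t s' : ~~ P (ohead (get s r)) -> exec c2 s t s' ->
    exec (If r P c1 c2) s t.+2 s'
| EWhileF r (P : option sym -> bool) c s : ~~ P (ohead (get s r)) -> exec (While r P c) s 1 s
| EWhileT r (P : option sym -> bool) c s t1 s1 t2 s2 : P (ohead (get s r)) -> exec c s t1 s1 ->
    exec (While r P c) s1 t2 s2 -> exec (While r P c) s (t1 + t2).+2 s2
| EWeak c s t t' s' : t <= t' -> exec c s t s' -> exec c s t' s'.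

Definition tops := reg -> option sym.

Inductive instr :=
| IAct (f : tops -> reg -> option sym * move)
| IJmp (r : reg) (P : option sym -> bool) (tgt : nat).

Definition idle (v : tops) (r : reg) : option sym * move := (v r, Stay).

(** A machine step writes before it moves, so a push needs two steps: move to the free cell on the
    left, then write there. *)
Definition act_grow (r : reg) (v : tops) (r' : reg) : option sym * move :=
  if r' == r then (v r', MoveLeft) else idle v r'.
Definition act_write (r i : reg) (g : option sym -> sym) (v : tops)
    (r' : reg) : option sym * move :=
  if r' == r then (Some (g (v i)), Stay) else idle v r'.
Definition act_pop (r : reg) (v : tops) (r' : reg) : option sym * move :=
  if r' == r then (None, MoveRight) else idle v r'.

Fixpoint clen (c : cmd) : nat :=
  match c with
  | Skip => 0
  | Push _ _ _ => 2
  | Pop _ => 1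
  | Seq c1 c2 => clen c1 + clen c2
  | If _ _ c1 c2 => (clen c2 + (clen c1).+1).+1
  | While _ _ c => (clen c).+2
  end.

(** Jump targets are absolute, hence the argument [off], the position at which the code will lie.
    The else-branch comes first, so that the then-branch ends by falling through. *)
Fixpoint compile (c : cmd) (off : nat) : seq instr :=
  match c with
  | Skip => [::]
  | Push r i g => [:: IAct (act_grow r); IAct (act_write r i g)]
  | Pop r => [:: IAct (act_pop r)]
  | Seq c1 c2 => compile c1 off ++ compile c2 (off + clen c1)
  | If r P c1 c2 =>
      IJmp r P (off + clen c2).+2 :: compile c2 off.+1 ++
      IJmp r predT (off + clen (If r P c1 c2)) :: compile c1 (off + clen c2).+2
  | While r P c =>
      IJmp r (predC P) (off + clen c).+2 :: compile c off.+1 ++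
      [:: IJmp r predT off]
  end.

Lemma size_compile c off : size (compile c off) = clen c.
Proof.
elim: c off => //= [c1 IH1 c2 IH2 | r P c1 IH1 c2 IH2 | r P c IH] off.
- by rewrite size_cat IH1 IH2.
- by rewrite size_cat /= IH1 IH2.
- by rewrite size_cat /= IH addn1.
Qed.

(* The left part of a tape is irrelevant: it is overwritten before it is      *)
(* read.                                                                      *)
Definition stack_of (t : tape sym) (w : seq sym) : Prop :=
  exists m, tape_head t :: tape_right t = map Some w ++ nseq m None.

Lemma stack_of_head t w : stack_of t w -> tape_head t = ohead w.
Proof. by case=> m; case: w => [|a w] /=; case: m => [|m] //= []. Qed.

Lemma stack_of_idle t w : stack_of t w ->
  stack_of (tape_move Stay (tape_write (ohead w) t)) w.
Proof.
move=> H; have Eh := stack_of_head H; case: H => m H; exists m.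
by rewrite -H /= -Eh.
Qed.

Lemma stack_of_pop t w : stack_of t w ->
  stack_of (tape_move MoveRight (tape_write None t)) (behead w).
Proof.
case: t => l h r [m /= H].
suff [m' Er] : exists m', r = map Some (behead w) ++ nseq m' None.
  (* With no cell listed on the right, the move creates one blank cell, hence the 1. *)
  exists (if r is [::] then 1 else m').
  rewrite /= Er; case: (behead w) => [|a w'] //=.
  by case: m' {Er} => //=.
case: w H => [|a w] /=; last by case=> _ ->; exists m.
by case: m => [|m] // [_ ->]; exists m.
Qed.

Lemma stack_of_push t w a : stack_of t w ->
  stack_of (tape_move Stay (tape_write (Some a)
    (tape_move MoveLeft (tape_write (ohead w) t)))) (a :: w).
Proof.
move=> H; have Eh := stack_of_head H; case: H => m.
by case: t Eh => l h r /= -> H; exists m; rewrite /= H.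
Qed.

Section Machine.
Variable code : seq instr.
Let n := size code.

Definition mstate : finType := (bool + 'I_n.+1)%type.

(** Running off the end of the code means halting. The answer is read off the top of [RA]: the code
    of [true] begins with [node_sym], that of [false] with [leaf_sym]. *)
Definition mtrans (q : mstate) (v : tops) :
    mstate * (reg -> option sym * move) :=
  match q with
  | inl b => (inl b, idle v)
  | inr pc =>
    match drop pc code with
    | [::] => (inl (v RA == Some node_sym), idle v)
    | IAct f :: _ => (inr (inord pc.+1), f v)
    | IJmp r P tgt :: _ =>
        (inr (inord (if P (v r) then tgt else pc.+1)), idle v)
    end
  end.

Definition machine : turing_machine letter :=
  @TuringMachine letter 3 (option bool) mstate (inr (inord 0))
    (fun q => if q is inl b then Some b else None)
    (fun q v => let: (q', act) := mtrans q (fun r => v (r2o r)) in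
       (q', [ffun i => act (o2r i)])).

Definition at_pc (cfg : tm_config machine) (pc : nat) (s : state) : Prop :=
  cfg_state cfg = inr (inord pc) :> mstate /\
  forall r, stack_of (cfg_tapes cfg (r2o r)) (get s r).

Lemma step_at cfg pc s : pc <= n -> at_pc cfg pc s ->
  let qa := mtrans (inr (inord pc)) (fun r => ohead (get s r)) in
  cfg_state (tm_step cfg) = qa.1 :> mstate /\
  forall r, cfg_tapes (tm_step cfg) (r2o r) =
    tape_move (qa.2 r).2 (tape_write (qa.2 r).1 (cfg_tapes cfg (r2o r))).
Proof.
move=> lepc [Es Ht].
have Ev : (fun r => ([ffun i => tape_head (cfg_tapes cfg i)] :
    {ffun 'I_4 -> option sym}) (r2o r)) = fun r => ohead (get s r).
  by apply: boolp.funext => r; rewrite ffunE (stack_of_head (Ht r)).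
rewrite /tm_step Es; cbn [tm_final tm_trans machine]; rewrite Ev.
by case: (mtrans _ _) => q act; split=> // r; rewrite /= !ffunE r2oK.
Qed.

Lemma step_jmp cfg pc s r P tgt l :
  pc <= n -> drop pc code = IJmp r P tgt :: l -> at_pc cfg pc s ->
  at_pc (tm_step cfg) (if P (ohead (get s r)) then tgt else pc.+1) s.
Proof.
move=> lepc Ed Hcfg; have [Es1 Et1] := step_at lepc Hcfg.
move: Es1 Et1; rewrite /= inordK // Ed /= => Es1 Et1.
by split=> // r'; rewrite Et1; apply/stack_of_idle/(proj2 Hcfg).
Qed.

(** Simulation by induction on the execution rather than on the command, since a loop runs the same
    code again. The surrounding [pre] and [post] let a subcommand be located inside the whole
    program. *)
Lemma exec_run c s t s' : exec c s t s' ->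
  forall off cfg pre post, code = pre ++ compile c off ++ post ->
    size pre = off -> at_pc cfg off s ->
  exists2 t', t' <= t &
    at_pc (iter t' (@tm_step _ machine) cfg) (off + clen c) s'.
Proof.
elim=> {c s t s'}
  [ s | r i g s ir | r s | c1 c2 s t1 s1 t2 s2 _ IH1 _ IH2
  | r P c1 c2 s t s' Pr _ IH | r P c1 c2 s t s' Pr _ IH | r P c s Pr
  | r P c s t1 s1 t2 s2 Pr _ IH1 _ IH2 | c s t t' s' le_t _ IH ]
  off cfg pre post Ec Epre Hcfg.
- by exists 0; rewrite // addn0.
- have En : off.+2 <= n by rewrite /n Ec !size_cat /= Epre; lia.
  have Ed1 : drop off code =
      [:: IAct (act_grow r), IAct (act_write r i g) & post].
    by rewrite Ec -Epre drop_size_cat.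
  have Ed2 : drop off.+1 code = IAct (act_write r i g) :: post.
    by rewrite -add1n -drop_drop Ed1.
  exists 2; rewrite //= addn2.
  have lep : off <= n by lia.
  have [] := step_at lep Hcfg; rewrite /= inordK // Ed1 /=.
  set cfg1 := tm_step cfg => Es1 Et1.
  rewrite /at_pc /tm_step Es1 /= inordK; last lia.
  rewrite Ed2 /=; split=> // r'; rewrite get_put !ffunE r2oK /act_write.
  have [-> | nr] := eqVneq r' r.
    (* As [i] differs from [r], the top of [i] is still under its head when the second step reads
       it. *)
    rewrite !ffunE /= !Et1 /act_grow eqxx (negPf ir).
    rewrite -(stack_of_head (stack_of_idle (proj2 Hcfg i))).
    exact: (stack_of_push _ (proj2 Hcfg r)).
  rewrite /idle ffunE Et1 /act_grow (negPf nr).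
  have H := stack_of_idle (proj2 Hcfg r').
  by rewrite (stack_of_head H); apply: stack_of_idle.
- have En : off.+1 <= n by rewrite /n Ec !size_cat /= Epre; lia.
  have Ed : drop off code = IAct (act_pop r) :: post.
    by rewrite Ec -Epre drop_size_cat.
  exists 1; rewrite //= addn1.
  have lep : off <= n by lia.
  have [] := step_at lep Hcfg; rewrite /= inordK // Ed /= => Es1 Et1.
  split=> // r'; rewrite get_put Et1 /act_pop.
  by have [-> | nr] := eqVneq r' r; [apply: stack_of_pop | apply: stack_of_idle];
    apply: (proj2 Hcfg).
- have [|t1' l1 H1] := IH1 off cfg pre (compile c2 (off + clen c1) ++ post) _ Epre Hcfg.
    by rewrite Ec /= -!catA.
  have [||t2' l2 H2] := IH2 _ _ (pre ++ compile c1 off) post _ _ H1.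
  + by rewrite Ec /= !catA.
  + by rewrite size_cat size_compile Epre.
  exists (t2' + t1'); first lia.
  by rewrite iterD /= addnA.
- have En : off <= n by rewrite /n Ec !size_cat /= Epre; lia.
  have Ed := Ec; move/(congr1 (drop off)): Ed.
  rewrite -Epre drop_size_cat // Epre /= => Ed.
  have H0 := step_jmp En Ed Hcfg; rewrite Pr in H0.
  have [||t1 l1 H1] := IH _ _ (pre ++ IJmp r P (off + clen c2).+2 :: compile c2 off.+1 ++
      [:: IJmp r predT (off + clen (If r P c1 c2))]) post _ _ H0.
  + by rewrite Ec /= -?catA /= -?catA.
  + by rewrite !size_cat /= !size_cat size_compile Epre /=; lia.
  exists t1.+1 => //; rewrite iterSr.
  by move: H1; congr at_pc; rewrite /=; lia.
- have En : off <= n by rewrite /n Ec !size_cat /= Epre; lia.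
  have Ed := Ec; move/(congr1 (drop off)): Ed.
  rewrite -Epre drop_size_cat // Epre /= => Ed.
  have H0 := step_jmp En Ed Hcfg; rewrite (negPf Pr) in H0.
  have [||t1 l1 H1] := IH _ _ (pre ++ [:: IJmp r P (off + clen c2).+2])
    (IJmp r predT (off + clen (If r P c1 c2)) :: compile c1 (off + clen c2).+2 ++ post)
    _ _ H0.
  + by rewrite Ec /= -?catA /= -?catA.
  + by rewrite !size_cat /= Epre addn1.
  have En' : off.+1 + clen c2 <= n.
    by rewrite /n Ec /= !size_cat /= !size_cat size_compile Epre; lia.
  have Ed' : drop (off.+1 + clen c2) code =
      IJmp r predT (off + clen (If r P c1 c2)) ::
      compile c1 (off + clen c2).+2 ++ post.
    have -> : code = (pre ++ IJmp r P (off + clen c2).+2 :: compile c2 off.+1) ++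
        IJmp r predT (off + clen (If r P c1 c2)) ::
        compile c1 (off + clen c2).+2 ++ post by rewrite Ec /= -?catA /= -?catA.
    by rewrite drop_size_cat // size_cat /= size_compile; lia.
  have H2 := step_jmp En' Ed' H1.
  by exists t1.+2 => //; rewrite iterS iterSr.
- have En : off <= n by rewrite /n Ec !size_cat /= Epre; lia.
  have Ed := Ec; move/(congr1 (drop off)): Ed.
  rewrite -Epre drop_size_cat // Epre /= => Ed.
  have H0 := step_jmp En Ed Hcfg; rewrite /= Pr in H0.
  by exists 1 => //=; move: H0; congr at_pc; lia.
- have En : off <= n by rewrite /n Ec !size_cat /= Epre; lia.
  have Ed := Ec; move/(congr1 (drop off)): Ed.
  rewrite -Epre drop_size_cat // Epre /= => Ed.
  have H0 := step_jmp En Ed Hcfg; rewrite /= Pr in H0.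
  have [||t1' l1 H1] := IH1 _ _ (pre ++ [:: IJmp r (predC P) (off + clen c).+2])
    (IJmp r predT off :: post) _ _ H0.
  + by rewrite Ec /= -?catA /= -?catA.
  + by rewrite !size_cat /= Epre addn1.
  have En' : off.+1 + clen c <= n.
    by rewrite /n Ec /= !size_cat /= !size_cat size_compile Epre /=; lia.
  have Ed' : drop (off.+1 + clen c) code = IJmp r predT off :: post.
    have -> : code = (pre ++ IJmp r (predC P) (off + clen c).+2 :: compile c off.+1) ++
        IJmp r predT off :: post by rewrite Ec /= -?catA /= -?catA.
    by rewrite drop_size_cat // size_cat /= size_compile; lia.
  have H2 := step_jmp En' Ed' H1.
  have [t2' l2 H3] := IH2 _ _ _ _ Ec Epre H2.
  exists (t2' + t1'.+2); first lia.
  by rewrite iterD iterS iterSr.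
- by have [t'' le_t' H] := IH _ _ _ _ Ec Epre Hcfg; exists t'' => //; lia.
Qed.

End Machine.

(** A halted configuration is fixed by [tm_step], so an upper bound on the running time suffices to
    see the answer; the extra step is the one that halts. *)
Lemma exec_answers c w t s' : exec c (St [seq inl a | a <- w] [::] [::] [::]) t s' ->
  tm_answers (machine (compile c 0)) w t.+1 (ohead (sA s') == Some node_sym).
Proof.
move=> H.
have [|||t1 le1 H1] := exec_run (code := compile c 0) H
  (cfg := tm_init (machine (compile c 0)) w) (off := 0) (pre := [::]) (post := [::]).
- by rewrite cats0.
- by [].
- split=> // r; rewrite /tm_init /= ffunE.
  case: r => /=; try by exists 1.
  case: w {H} => [|a w] /=; first by exists 1.
  by exists 0; rewrite cats0 /= -!map_comp.
rewrite /tm_answers -(subnK (le1 : t1 < t.+1)) iterD iterS.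
have [] := step_at _ H1; first by rewrite size_compile.
rewrite /= inordK ?size_compile // -{1}(size_compile c 0) drop_size /= => Es _.
move: (tm_step _) Es => cfg Es.
suff -> : cfg_state (iter (t.+1 - t1.+1) (@tm_step _ (machine (compile c 0))) cfg)
  = inl (ohead (sA s') == Some node_sym) :> mstate (compile c 0) by [].
by elim: (t.+1 - t1.+1) => [|m IH] //=; rewrite {1}/tm_step IH.
Qed.

(** * Functions on trees computable in polynomial time *)

Inductive tree := L | N (a b : tree).

Fixpoint tree_eqb (t u : tree) : bool :=
  match t, u with
  | L, L => true
  | N a b, N a' b' => tree_eqb a a' && tree_eqb b b'
  | _, _ => false
  end.

Lemma tree_eqP : Equality.axiom tree_eqb.
Proof.
elim=> [|a IHa b IHb] [|a' b'] /=; try by constructor.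
by apply: (iffP andP) => [[/IHa -> /IHb ->] | [<- <-]] //; split;
  [apply/IHa | apply/IHb].
Qed.
HB.instance Definition _ := hasDecEq.Build tree tree_eqP.

(* The prefix code is self-delimiting, so that several trees can be stored on *)
(* one stack.                                                                 *)
Fixpoint code (t : tree) : seq sym :=
  if t is N a b then node_sym :: code a ++ code b else [:: leaf_sym].

Definition codes (ts : seq tree) : seq sym := flatten (map code ts).

Definition is_node (o : option sym) : bool := o == Some node_sym.
Definition not_mark (o : option sym) : bool := o != Some mark_sym.
Definition copy_top (o : option sym) : sym := odflt mark_sym o.

Definition other (r : reg) : reg := if r is RA then RB else RA.
Definition pushc (r : reg) (a : sym) : cmd := Push r (other r) (fun _ => a).

Lemma exec_pushc r a s : exec (pushc r a) s 2 (put s r (a :: get s r)).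
Proof. by apply: EPush; case: r. Qed.

Lemma exec_eq c s t s' t' s'' :
  exec c s t s' -> t <= t' -> s' = s'' -> exec c s t' s''.
Proof. by move=> H le_t <-; apply: EWeak H. Qed.

(** The registers in an arbitrary order, so that each transfer program is analysed once for all
    choices of stacks. *)
Definition mk (i j k l : reg) (a b c d : seq sym) : state :=
  put (put (put (put (St [::] [::] [::] [::]) i a) j b) k c) l d.

(** * Moving and copying codes of trees between stacks *)

Section Transfer.
Variables i j k l : reg.
Hypothesis ijkl : uniq [:: i; j; k; l].

Lemma get_mk a b c d :
  [/\ get (mk i j k l a b c d) i = a, get (mk i j k l a b c d) j = b,
      get (mk i j k l a b c d) k = c & get (mk i j k l a b c d) l = d].
Proof. by move: ijkl; case: i; case: j; case: k; case: l. Qed.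

Lemma put_mk a b c d w :
  [/\ put (mk i j k l a b c d) i w = mk i j k l w b c d,
      put (mk i j k l a b c d) j w = mk i j k l a w c d,
      put (mk i j k l a b c d) k w = mk i j k l a b w d &
      put (mk i j k l a b c d) l w = mk i j k l a b c w].
Proof. by move: ijkl; case: i; case: j; case: k; case: l. Qed.

Let get_i a b c d : get (mk i j k l a b c d) i = a.
Proof. by have [] := get_mk a b c d. Qed.
Let get_j a b c d : get (mk i j k l a b c d) j = b.
Proof. by have [] := get_mk a b c d. Qed.
Let get_k a b c d : get (mk i j k l a b c d) k = c.
Proof. by have [] := get_mk a b c d. Qed.
Let get_l a b c d : get (mk i j k l a b c d) l = d.
Proof. by have [] := get_mk a b c d. Qed.
Let put_i a b c d w : put (mk i j k l a b c d) i w = mk i j k l w b c d.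
Proof. by have [] := put_mk a b c d w. Qed.
Let put_j a b c d w : put (mk i j k l a b c d) j w = mk i j k l a w c d.
Proof. by have [] := put_mk a b c d w. Qed.
Let put_k a b c d w : put (mk i j k l a b c d) k w = mk i j k l a b w d.
Proof. by have [] := put_mk a b c d w. Qed.
Let put_l a b c d w : put (mk i j k l a b c d) l w = mk i j k l a b c w.
Proof. by have [] := put_mk a b c d w. Qed.
Let getE := (get_i, get_j, get_k, get_l).
Let putE := (put_i, put_j, put_k, put_l).

(* The stack [l] counts in unary the trees that remain to be read.            *)
Definition take_rev : cmd :=
  While l is_node
    (Seq (If i is_node (pushc l node_sym) (Pop l))
         (Seq (Push k i copy_top) (Pop i))).

(** The statement is about a list of trees because reading a [node_sym] replaces one pending tree by
    two; a leaf completes one. The induction is on the number of symbols left. *)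
Lemma exec_take_rev ts r b c d :
  exec take_rev
    (mk i j k l (codes ts ++ r) b c (nseq (size ts) node_sym ++ mark_sym :: d))
    (10 * size (codes ts) + 1)
    (mk i j k l r b (rev (codes ts) ++ c) (mark_sym :: d)).
Proof.
have ik : i != k by apply: contraTneq ijkl => ->; rewrite /= !inE eqxx !orbT.
have [m] := ubnP (size (codes ts)); elim: m => // m IHm in ts r b c *.
case: ts => [|[|x y] ts] lem.
- by apply: EWhileF; rewrite getE.
- apply: exec_eq (EWhileT _ _ (IHm ts r b (leaf_sym :: c) _)) _ _.
  + by rewrite getE.
  + apply: exec_eq (ESeq (EIfF _ _ (EPop _ _))
      (ESeq (EPush _ _ _) (EPop _ _))) (leqnn _) _; rewrite ?getE //.
    by rewrite /= !(getE, putE).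
  + by move: lem; rewrite /codes /=; lia.
  + by move: lem; rewrite /codes /=; lia.
  + by rewrite /codes /= rev_cons cat_rcons.
- have Ec : codes (N x y :: ts) = node_sym :: codes [:: x, y & ts].
    by rewrite /codes /= catA.
  rewrite Ec in lem *.
  apply: exec_eq (EWhileT _ _ (IHm [:: x, y & ts] r b (node_sym :: c) _)) _ _.
  + by rewrite getE.
  + apply: exec_eq (ESeq (EIfT _ _ (exec_pushc _ _ _))
      (ESeq (EPush _ _ _) (EPop _ _))) (leqnn _) _; rewrite ?getE //.
    by rewrite !(getE, putE).
  + by move: lem => /=; lia.
  + by rewrite /=; lia.
  + by rewrite rev_cons cat_rcons.
Qed.

Lemma code_no_mark t : all (fun a => a != mark_sym) (code t).
Proof. by elim: t => //= a IHa b IHb; rewrite all_cat IHa. Qed.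

Definition extract : cmd :=
  Seq (pushc k mark_sym) (Seq (pushc l mark_sym) (Seq (pushc l node_sym)
    (Seq take_rev (Pop l)))).

Lemma exec_extract t r b c d :
  exec extract (mk i j k l (code t ++ r) b c d) (10 * size (code t) + 8)
    (mk i j k l r b (rev (code t) ++ mark_sym :: c) d).
Proof.
have pk a' b' c' d' x : exec (pushc k x) (mk i j k l a' b' c' d') 2
    (mk i j k l a' b' (x :: c') d').
  by have := exec_pushc k x (mk i j k l a' b' c' d'); rewrite getE putE.
have pl a' b' c' d' x : exec (pushc l x) (mk i j k l a' b' c' d') 2
    (mk i j k l a' b' c' (x :: d')).
  by have := exec_pushc l x (mk i j k l a' b' c' d'); rewrite getE putE.
have := exec_take_rev [:: t] r b (mark_sym :: c) d.
rewrite {1 2 3}/codes /= cats0 => H.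
apply: exec_eq (ESeq (pk _ _ _ _ _) (ESeq (pl _ _ _ _ _)
  (ESeq (pl _ _ _ _ _) (ESeq H (EPop _ _))))) _ _.
- by lia.
- by rewrite !(getE, putE).
Qed.

(** [extract] leaves the code reversed above a mark; unstacking it down to the mark onto both [i]
    and [j] reverses it back. *)
Definition copy_tree : cmd :=
  Seq extract (Seq (While k not_mark
    (Seq (Push i k copy_top) (Seq (Push j k copy_top) (Pop k)))) (Pop k)).

Lemma exec_copy t r b c d :
  exec copy_tree (mk i j k l (code t ++ r) b c d) (20 * size (code t) + 20)
    (mk i j k l (code t ++ r) (code t ++ b) c d).
Proof.
have ik : i != k by apply: contraTneq ijkl => ->; rewrite /= !inE eqxx !orbT.
have jk : j != k.
  by have /= /and4P[_ + _ _] := ijkl; rewrite !inE negb_or => /andP[].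
have H w : all (fun a => a != mark_sym) w -> forall r b,
  exec (While k not_mark
    (Seq (Push i k copy_top) (Seq (Push j k copy_top) (Pop k))))
    (mk i j k l r b (w ++ mark_sym :: c) d) (7 * size w + 1)
    (mk i j k l (rev w ++ r) (rev w ++ b) (mark_sym :: c) d).
  elim: w => [|a w IH] /= => [_|/andP[am /IH {}IH]] r' b'.
    by apply: EWhileF; rewrite getE.
  apply: exec_eq (EWhileT _ _ (IH (a :: r') (a :: b'))) _ _.
  - by rewrite getE.
  - apply: exec_eq (ESeq (EPush _ _ _) (ESeq (EPush _ _ _) (EPop _ _)))
      (leqnn _) _; rewrite ?getE 1?eq_sym //.
    by rewrite !(getE, putE).
  - by rewrite /=; lia.
  - by rewrite !rev_cons !cat_rcons.
apply: exec_eq (ESeq (exec_extract _ _ _ _ _) (ESeq (H _ _ _ _) (EPop _ _)))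
  _ _.
- by rewrite all_rev code_no_mark.
- by rewrite size_rev; move: (size _) => n; lia.
- by rewrite !(getE, putE) revK.
Qed.

Definition drop_tree : cmd :=
  Seq extract (Seq (While k not_mark (Pop k)) (Pop k)).

Lemma exec_drop t r b c d :
  exec drop_tree (mk i j k l (code t ++ r) b c d) (20 * size (code t) + 20)
    (mk i j k l r b c d).
Proof.
have H w : all (fun a => a != mark_sym) w ->
  exec (While k not_mark (Pop k))
    (mk i j k l r b (w ++ mark_sym :: c) d) (3 * size w + 1)
    (mk i j k l r b (mark_sym :: c) d).
  elim: w => [|a w IH] /= => [_|/andP[am /IH {}IH]].
    by apply: EWhileF; rewrite getE.
  apply: exec_eq (EWhileT _ _ IH) _ _ => //.
  - by rewrite getE.
  - by apply: exec_eq (EPop _ _) (leqnn _) _; rewrite !(getE, putE).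
  - by rewrite /=; lia.
apply: exec_eq (ESeq (exec_extract _ _ _ _ _) (ESeq (H _ _) (EPop _ _)))
  _ _.
- by rewrite all_rev code_no_mark.
- by rewrite size_rev; move: (size _) => n; lia.
- by rewrite !(getE, putE).
Qed.

Definition move_tree : cmd := Seq copy_tree drop_tree.

Lemma exec_move t r b c d :
  exec move_tree (mk i j k l (code t ++ r) b c d) (40 * size (code t) + 40)
    (mk i j k l r (code t ++ b) c d).
Proof.
by apply: exec_eq (ESeq (exec_copy _ _ _ _ _) (exec_drop _ _ _ _ _)) _ _ => //;
  lia.
Qed.

End Transfer.

Definition mvAB := move_tree RA RB RC RD.
Definition mvBA := move_tree RB RA RC RD.
Definition mvAC := move_tree RA RC RB RD.
Definition mvCA := move_tree RC RA RB RD.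
Definition dropA := drop_tree RA RC RD.
Definition dupA := Seq (copy_tree RA RB RC RD) mvBA.
Definition swapA := Seq mvAB (Seq mvAC (Seq mvBA mvCA)).

Lemma exec_mvAB t a b c d :
  exec mvAB (St (code t ++ a) b c d) (40 * size (code t) + 40)
    (St a (code t ++ b) c d).
Proof. exact: (exec_move (i := RA) (j := RB) (k := RC) (l := RD)). Qed.
Lemma exec_mvBA t a b c d :
  exec mvBA (St a (code t ++ b) c d) (40 * size (code t) + 40)
    (St (code t ++ a) b c d).
Proof. exact: (exec_move (i := RB) (j := RA) (k := RC) (l := RD)). Qed.
Lemma exec_mvAC t a b c d :
  exec mvAC (St (code t ++ a) b c d) (40 * size (code t) + 40)
    (St a b (code t ++ c) d).
Proof. exact: (exec_move (i := RA) (j := RC) (k := RB) (l := RD)). Qed.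
Lemma exec_mvCA t a b c d :
  exec mvCA (St a b (code t ++ c) d) (40 * size (code t) + 40)
    (St (code t ++ a) b c d).
Proof. exact: (exec_move (i := RC) (j := RA) (k := RB) (l := RD)). Qed.
Lemma exec_dropA t a b c d :
  exec dropA (St (code t ++ a) b c d) (40 * size (code t) + 40)
    (St a b c d).
Proof.
apply: exec_eq (exec_drop (i := RA) (j := RB) (k := RC) (l := RD) _ _ _ _ _ _)
  _ _ => //; lia.
Qed.
Lemma exec_dupA t a b c d :
  exec dupA (St (code t ++ a) b c d) (60 * size (code t) + 60)
    (St (code t ++ code t ++ a) b c d).
Proof.
apply: exec_eq (ESeq (exec_copy (i := RA) (j := RB) (k := RC) (l := RD) _ _ _ _ _ _)
  (exec_mvBA _ _ _ _ _)) _ _ => //; lia.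
Qed.
Lemma exec_swapA t u a b c d :
  exec swapA (St (code t ++ code u ++ a) b c d)
    (80 * (size (code t) + size (code u)) + 160)
    (St (code u ++ code t ++ a) b c d).
Proof.
apply: exec_eq (ESeq (exec_mvAB _ _ _ _ _) (ESeq (exec_mvAC _ _ _ _ _)
  (ESeq (exec_mvBA _ _ _ _ _) (exec_mvCA _ _ _ _ _)))) _ _ => //; lia.
Qed.

(** * Polynomial bounds and the class [FP] *)

Definition polyb (q : nat -> nat) : Prop :=
  exists P : {poly nat}, forall n, q n = P.[n]%R.

Lemma polyb_const k : polyb (fun _ => k).
Proof. by exists (k%:P)%R => n; rewrite hornerC. Qed.
Lemma polyb_id : polyb (fun n => n).
Proof. by exists ('X)%R => n; rewrite hornerX. Qed.
Lemma polyb_add q1 q2 : polyb q1 -> polyb q2 -> polyb (fun n => q1 n + q2 n).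
Proof. by move=> [P EP] [Q EQ]; exists (P + Q)%R => n; rewrite hornerD EP EQ. Qed.
Lemma polyb_mul q1 q2 : polyb q1 -> polyb q2 -> polyb (fun n => q1 n * q2 n).
Proof. by move=> [P EP] [Q EQ]; exists (P * Q)%R => n; rewrite hornerM EP EQ. Qed.
Lemma polyb_comp q1 q2 : polyb q1 -> polyb q2 -> polyb (fun n => q1 (q2 n)).
Proof.
by move=> [P EP] [Q EQ]; exists (P \Po Q)%R => n; rewrite horner_comp EP EQ.
Qed.
(** The coefficients are natural numbers, so these polynomials are monotone; bounds may therefore be
    substituted into one another. *)
Lemma polyb_mono q m n : polyb q -> m <= n -> q m <= q n.
Proof.
move=> [P EP] lemn; rewrite !EP; move: P {EP}; elim/poly_ind => [|P c IH].
  by rewrite !horner0.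
by rewrite !hornerMXaddC; apply: leq_add => //; apply: leq_mul.
Qed.
Hint Resolve polyb_const polyb_id polyb_add polyb_mul polyb_comp : polyb.

Class encodable (A : Type) := enc : A -> tree.

Definition sz A {eA : encodable A} (x : A) : nat := size (code (enc x)).

(* Different implicit types of [size] and [sz] are different atoms for [lia]. *)
Ltac size_lia :=
  repeat match goal with
  | |- context [@size ?T ?w] => move: (@size T w) => ?
  | |- context [@sz ?T ?e ?w] => move: (@sz T e w) => ?
  end; lia.

#[export] Instance enc_tree : encodable tree := fun t => t.
#[export] Instance enc_unit : encodable unit := fun _ => L.
#[export] Instance enc_bool : encodable bool := fun b => if b then N L L else L.
(** Pairs, nonempty lists and positive unary numbers are all nodes [N], so that the same tree
    operations act as projections, list operations and unary arithmetic. *)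
#[export] Instance enc_prod A B (eA : encodable A) (eB : encodable B) :
  encodable (A * B) := fun x => N (enc x.1) (enc x.2).
#[export] Instance enc_seq A (eA : encodable A) : encodable (seq A) :=
  foldr (fun x t => N (enc x) t) L.
#[export] Instance enc_unary : encodable nat := fun n => iter n (N L) L.

Lemma code_N a b r : code (N a b) ++ r = node_sym :: code a ++ code b ++ r.
Proof. by rewrite /= catA. Qed.

Lemma sz_pair A B {eA : encodable A} {eB : encodable B} (x : A * B) :
  sz x = (sz x.1 + sz x.2).+1.
Proof. by rewrite /sz /= size_cat. Qed.

Lemma sz_cons A {eA : encodable A} (x : A) l :
  sz (x :: l) = (sz x + sz l).+1.
Proof. by rewrite /sz /= size_cat. Qed.

Lemma sz_cat A {eA : encodable A} (l1 l2 : seq A) :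
  (sz (l1 ++ l2)).+1 = sz l1 + sz l2.
Proof.
elim: l1 => [|x l1 IH] //=; rewrite !sz_cons; move: IH; lia.
Qed.

Lemma size_le_sz A {eA : encodable A} (l : seq A) : size l < sz l.
Proof. by elim: l => //= x l IH; rewrite sz_cons; move: IH; lia. Qed.

Lemma mem_le_sz (A : eqType) {eA : encodable A} (x : A) l :
  x \in l -> sz x < sz l.
Proof.
elim: l => //= y l IH; rewrite inE sz_cons => /predU1P[<-|/IH]; lia.
Qed.

(* The class of functions computable in polynomial time: the argument on top  *)
(* of the first stack is replaced by the value, everything else is preserved. *)
Definition FP A B {eA : encodable A} {eB : encodable B} (f : A -> B) : Prop :=
  exists c q, polyb q /\ forall x : A, sz (f x) <= q (sz x) /\
    forall r b' c' d',
      exec c (St (code (enc x) ++ r) b' c' d') (q (sz x))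
             (St (code (enc (f x)) ++ r) b' c' d').

Lemma FP_ext A B {eA : encodable A} {eB : encodable B} (f g : A -> B) :
  f =1 g -> FP f -> FP g.
Proof.
move=> fg [c [q [pq H]]]; exists c, q; split=> // x; rewrite -fg; exact: H.
Qed.

Lemma FP_recode A B {eA : encodable A} {eB : encodable B} (f : A -> B) :
  (forall x, enc (f x) = enc x) -> FP f.
Proof.
move=> Ef; exists Skip, (fun n => n); split; first exact: polyb_id.
move=> x; rewrite /sz Ef; split=> // r b' c' d'.
by apply: EWeak (ESkip _).
Qed.

Lemma FP_id A {eA : encodable A} : FP (fun x : A => x).
Proof. exact: FP_recode. Qed.

Lemma FP_comp A B C {eA : encodable A} {eB : encodable B} {eC : encodable C}
    (g : B -> C) (f : A -> B) :
  FP g -> FP f -> FP (fun x => g (f x)).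
Proof.
move=> [cg [qg [pg Hg]]] [cf [qf [pf Hf]]].
exists (Seq cf cg), (fun n => qf n + qg (qf n)); split.
  by auto with polyb.
move=> x; have [sf ef] := Hf x; have [sg eg] := Hg (f x).
have le : qg (sz (f x)) <= qg (qf (sz x)) by apply: polyb_mono.
split=> [|r b' c' d']; first by lia.
by apply: exec_eq (ESeq (ef _ _ _ _) (eg _ _ _ _)) _ _ => //; lia.
Qed.

Lemma FP_const A B {eA : encodable A} {eB : encodable B} (y : B) :
  FP (fun _ : A => y).
Proof.
pose pushw := foldr (fun a c => Seq c (pushc RA a)) Skip.
have Hw w r b' c' d' :
    exec (pushw w) (St r b' c' d') (2 * size w) (St (w ++ r) b' c' d').
  elim: w => [|a w IH] /=; first exact: ESkip.
  by apply: exec_eq (ESeq IH (exec_pushc _ _ _)) _ _ => //; size_lia.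
exists (Seq dropA (pushw (code (enc y)))), (fun n => 40 * n + 40 + 2 * sz y).
split; first by auto with polyb.
move=> x; split=> [|r b' c' d']; first by lia.
by apply: exec_eq (ESeq (exec_dropA _ _ _ _ _) (Hw _ _ _ _ _)) _ _.
Qed.

Lemma FP_pair A B C {eA : encodable A} {eB : encodable B} {eC : encodable C}
    (f : A -> B) (g : A -> C) :
  FP f -> FP g -> FP (fun x => (f x, g x)).
Proof.
move=> [cf [qf [pf Hf]]] [cg [qg [pg Hg]]].
exists (Seq dupA (Seq cg (Seq swapA (Seq cf (pushc RA node_sym))))),
  (fun n => 60 * n + 60 + (qg n + (80 * (qg n + n) + 160 + (qf n + 2)))).
split; first by auto 10 with polyb.
move=> x; have [sf ef] := Hf x; have [sg eg] := Hg x.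
split=> [|r b' c' d']; first by rewrite sz_pair /=; lia.
apply: exec_eq (ESeq (exec_dupA _ _ _ _ _) (ESeq (eg _ _ _ _) (ESeq
  (exec_swapA _ _ _ _ _ _) (ESeq (ef _ _ _ _) (exec_pushc _ _ _))))) _ _.
  by move: sg; rewrite /sz; size_lia.
by rewrite /= catA.
Qed.

Lemma exec_popA a w b c d : exec (Pop RA) (St (a :: w) b c d) 1 (St w b c d).
Proof. exact: EPop. Qed.

Lemma exec_popB a w b c d : exec (Pop RB) (St b (a :: w) c d) 1 (St b w c d).
Proof. exact: EPop. Qed.

Lemma exec_pushA a w b c d :
  exec (pushc RA a) (St w b c d) 2 (St (a :: w) b c d).
Proof. exact: exec_pushc. Qed.

Lemma FP_isnode : FP (fun t : tree => t != L).
Proof.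
exists (If RA is_node (Seq dropA (Seq (pushc RA leaf_sym) (Seq (pushc RA leaf_sym)
  (pushc RA node_sym)))) Skip), (fun n => 40 * n + 50).
split; first by auto with polyb.
case=> [|a b]; (split=> [|r b' c' d']; first by rewrite /sz /=; size_lia).
  by apply: exec_eq (EIfF _ _ (ESkip _)) _ _ => //; lia.
apply: exec_eq (EIfT _ _ (ESeq (exec_dropA (N a b) _ _ _ _) (ESeq (exec_pushc _ _ _)
  (ESeq (exec_pushc _ _ _) (exec_pushc _ _ _))))) _ _ => //.
by rewrite /sz; size_lia.
Qed.

Definition tleft (t : tree) : tree := if t is N a _ then a else L.
Definition tright (t : tree) : tree := if t is N _ b then b else L.

Lemma FP_tleft : FP tleft.
Proof.
exists (If RA is_node (Seq (Pop RA) (Seq swapA dropA)) Skip),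
  (fun n => 200 * n + 250).
split; first by auto with polyb.
case=> [|a b]; (split=> [|r b' c' d'];
  first by rewrite /sz /enc /enc_tree /= ?size_cat; size_lia).
  by apply: exec_eq (EIfF _ _ (ESkip _)) _ _ => //; lia.
apply: exec_eq (EIfT _ _ (ESeq (EPop _ _) (ESeq _ (exec_dropA _ _ _ _ _)))) _ _
  => //; first by rewrite /enc /enc_tree /= -catA; apply: exec_swapA.
by rewrite /sz /enc /enc_tree /= size_cat; size_lia.
Qed.

Lemma FP_tright : FP tright.
Proof.
exists (If RA is_node (Seq (Pop RA) dropA) Skip),
  (fun n => 200 * n + 250).
split; first by auto with polyb.
case=> [|a b]; (split=> [|r b' c' d'];
  first by rewrite /sz /enc /enc_tree /= ?size_cat; size_lia).
  by apply: exec_eq (EIfF _ _ (ESkip _)) _ _ => //; lia.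
apply: exec_eq (EIfT _ _ (ESeq (EPop _ _) _)) _ _
  => //; first by rewrite /enc /enc_tree /= -catA; apply: exec_dropA.
by rewrite /sz /enc /enc_tree /= size_cat; size_lia.
Qed.

Lemma FP_if A B {eA : encodable A} {eB : encodable B} (b : A -> bool)
    (f g : A -> B) :
  FP b -> FP f -> FP g -> FP (fun x => if b x then f x else g x).
Proof.
move=> [cb [qb [pb Hb]]] [cf [qf [pf Hf]]] [cg [qg [pg Hg]]].
exists (Seq dupA (Seq cb (If RA is_node
    (Seq (Pop RA) (Seq (Pop RA) (Seq (Pop RA) cf))) (Seq (Pop RA) cg)))),
  (fun n => 60 * n + 60 + (qb n + (qf n + qg n + 10))).
split; first by auto 10 with polyb.
move=> x; have [sb eb] := Hb x; have [sf ef] := Hf x; have [sg eg] := Hg x.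
split=> [|r b' c' d']; first by case: (b x); lia.
case Eb: (b x) eb => eb.
  have e3 := ESeq (exec_popA node_sym _ _ _ _) (ESeq (exec_popA leaf_sym _ _ _ _)
    (ESeq (exec_popA leaf_sym _ _ _ _) (ef r b' c' d'))).
  apply: exec_eq (ESeq (exec_dupA _ _ _ _ _) (ESeq (eb (code (enc x) ++ r) _ _ _)
    (EIfT _ _ e3))) _ _ => //.
  by rewrite /sz; size_lia.
have e1 := ESeq (exec_popA leaf_sym _ _ _ _) (eg r b' c' d').
apply: exec_eq (ESeq (exec_dupA _ _ _ _ _) (ESeq (eb (code (enc x) ++ r) _ _ _)
    (EIfF _ _ e1))) _ _ => //.
by rewrite /sz; size_lia.
Qed.

(** The list is kept on [RB], the state above the argument [x] on [RA]. Each round assembles the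
    code of [(e, (s, x))] while keeping a copy of [x] for the next round. The bound is required for
    the state after every prefix of the list. *)
Lemma FP_foldl_pair A E S {eA : encodable A} {eE : encodable E}
    {eS : encodable S} (l : A -> seq E) (z : A -> S) (h : E * (S * A) -> S) :
  FP l -> FP z -> FP h ->
  (exists2 q, polyb q & forall x l1 l2, l x = l1 ++ l2 ->
    sz (foldl (fun s e => h (e, (s, x))) (z x) l1) <= q (sz x)) ->
  FP (fun x => foldl (fun s e => h (e, (s, x))) (z x) (l x)).
Proof.
move=> Fl Fz [ch [qh [ph Hh]]] [qs ps Hs].
have [c0 [q0 [p0 H0]]] := FP_pair Fl (FP_pair Fz FP_id).
pose body := Seq (Pop RB) (Seq mvBA (Seq mvAC (Seq mvAC (Seq dupA (Seq mvCA
  (Seq (pushc RA node_sym) (Seq mvCA (Seq (pushc RA node_sym) ch)))))))).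
(* [M] bounds the sizes of the argument, of the list and of every state; [T] bounds the cost of one
   round. *)
pose M n := n + q0 n + qs n + 5.
pose T n := 400 * M n + 400 + qh (3 * M n).
exists (Seq c0 (Seq (Pop RA) (Seq mvAB (Seq (Pop RA) (Seq (While RB is_node body)
  (Seq (Pop RB) (Seq swapA dropA))))))),
  (fun n => q0 n + (40 * q0 n + 40 + (q0 n * T n + 400 * M n + 400))).
split; first by rewrite /T /M; auto 20 with polyb.
move=> x; have [/= s0 e0] := H0 x.
rewrite !sz_pair /= in s0.
have sS l1 l2 : l x = l1 ++ l2 ->
    sz (foldl (fun s e => h (e, (s, x))) (z x) l1) <= qs (sz x) by apply: Hs.
split=> [|r b' c' d'].
  by have := sS (l x) [::] (esym (cats0 _)); rewrite /M; lia.
have step s e w : exec body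
    (St (code (enc s) ++ code (enc x) ++ r) (node_sym :: code (enc e) ++ w) c' d')
    (200 * (sz e + sz s + sz x) + 300 + qh (sz (e, (s, x))))
    (St (code (enc (h (e, (s, x)))) ++ code (enc x) ++ r) w c' d').
  have [_ eh] := Hh (e, (s, x)).
  move: (eh (code (@enc _ eA x) ++ r) w c' d').
  have -> : code (enc (e, (s, x))) ++ code (enc x) ++ r = node_sym ::
      code (enc e) ++ node_sym :: code (enc s) ++ code (enc x) ++ code (enc x) ++ r.
    by rewrite -(code_N (enc s)) -code_N.
  move=> {}eh.
  apply: exec_eq (ESeq (exec_popB _ _ _ _ _) (ESeq (exec_mvBA _ _ _ _ _)
    (ESeq (exec_mvAC _ _ _ _ _) (ESeq (exec_mvAC _ _ _ _ _)
    (ESeq (exec_dupA _ _ _ _ _) (ESeq (exec_mvCA _ _ _ _ _)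
    (ESeq (exec_pushA _ _ _ _ _) (ESeq (exec_mvCA _ _ _ _ _)
    (ESeq (exec_pushA _ _ _ _ _) eh))))))))) _ _ => //.
  by rewrite -/(sz e) -/(sz s) -/(sz x); lia.
have loop l1 l2 : l x = l1 ++ l2 ->
  exec (While RB is_node body)
    (St (code (enc (foldl (fun s e => h (e, (s, x))) (z x) l1)) ++
       code (enc x) ++ r) (code (enc l2) ++ b') c' d')
    (size l2 * T (sz x) + 1)
    (St (code (enc (foldl (fun s e => h (e, (s, x))) (z x) (l1 ++ l2))) ++
       code (enc x) ++ r) (leaf_sym :: b') c' d').
  elim: l2 l1 => [|e l2 IH] l1 El; first by rewrite cats0; apply: EWhileF.
  have El' := El; rewrite -cat_rcons in El'.
  have lee : sz e + sz l2 <= sz (l x).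
    by have := @sz_cat _ eE l1 (e :: l2); rewrite -El sz_cons; lia.
  have := IH _ El'; rewrite foldl_rcons cat_rcons /= => {}IH.
  have := step (foldl (fun s e => h (e, (s, x))) (z x) l1) e
    (code (@enc _ (enc_seq eE) l2) ++ b') => Hstep.
  rewrite -catA.
  apply: exec_eq (EWhileT _ Hstep IH) _ _ => //.
  set s := foldl _ _ _.
  have ls : sz s <= qs (sz x) by apply: sS El.
  have le_h : qh (sz (e, (s, x))) <= qh (3 * M (sz x)).
    by apply: polyb_mono => //; rewrite !sz_pair /= /M; lia.
  have hT : 200 * (sz e + sz s + sz x) + 303 + qh (sz (e, (s, x))) <= T (sz x).
    by move: le_h; rewrite /T /M; lia.
  by rewrite /= mulSn; lia.
have H1 := e0 r b' c' d'; rewrite /= -!catA /= -!catA in H1.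
have H2 := loop [::] (l x) erefl.
apply: exec_eq (ESeq H1 (ESeq (exec_popA _ _ _ _ _) (ESeq (exec_mvAB _ _ _ _ _)
  (ESeq (exec_popA _ _ _ _ _) (ESeq H2 (ESeq (exec_popB _ _ _ _ _)
  (ESeq (exec_swapA _ _ _ _ _ _) (exec_dropA _ _ _ _ _)))))))) _ _ => //.
have sF := sS (l x) [::] (esym (cats0 _)); move: sF.
rewrite [[::] ++ _]/=; set s := foldl _ _ _ => sF.
have hT : size (l x) * T (sz x) <= q0 (sz x) * T (sz x).
  by apply: leq_mul => //; have := @size_le_sz _ eE (l x); lia.
by rewrite -/(sz s) -/(sz x) -/(sz (l x)) /M; lia.
Qed.

Lemma FP_comp2 A B C D {eA : encodable A} {eB : encodable B}
    {eC : encodable C} {eD : encodable D} (g : B -> C -> D) (f1 : A -> B)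
    (f2 : A -> C) :
  FP (fun t : B * C => g t.1 t.2) -> FP f1 -> FP f2 ->
  FP (fun x => g (f1 x) (f2 x)).
Proof.
move=> Fg F1 F2.
exact: (FP_comp (g := fun t : B * C => g t.1 t.2) Fg (FP_pair F1 F2)).
Qed.

(** Only codes matter, and a tree is its own code: projections and list operations are thus obtained
    from [tleft], [tright] and [FP_pair]. *)
Lemma FP_enc A B {eA : encodable A} {eB : encodable B} (f : A -> B) :
  FP f <-> FP (fun x => enc (f x)).
Proof. by []. Qed.

Lemma FP_fst A B C {eA : encodable A} {eB : encodable B} {eC : encodable C}
    (f : A -> B * C) : FP f -> FP (fun x => (f x).1).
Proof.
by move=> /FP_enc Ff; apply/FP_enc; apply: FP_ext (FP_comp FP_tleft Ff).
Qed.

Lemma FP_snd A B C {eA : encodable A} {eB : encodable B} {eC : encodable C}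
    (f : A -> B * C) : FP f -> FP (fun x => (f x).2).
Proof.
by move=> /FP_enc Ff; apply/FP_enc; apply: FP_ext (FP_comp FP_tright Ff).
Qed.

Lemma FP_neg A {eA : encodable A} (b : A -> bool) :
  FP b -> FP (fun x => ~~ b x).
Proof.
move=> Fb; apply: FP_ext (FP_if Fb (FP_const false) (FP_const true)) => x.
by case: (b x).
Qed.

Lemma FP_and A {eA : encodable A} (b c : A -> bool) :
  FP b -> FP c -> FP (fun x => b x && c x).
Proof. by move=> Fb Fc; apply: (FP_if Fb Fc (FP_const false)). Qed.

Lemma FP_or A {eA : encodable A} (b c : A -> bool) :
  FP b -> FP c -> FP (fun x => b x || c x).
Proof. by move=> Fb Fc; apply: (FP_if Fb (FP_const true) Fc). Qed.

Lemma FP_nilp A B {eA : encodable A} {eB : encodable B} (l : A -> seq B) :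
  FP l -> FP (fun x => nilp (l x)).
Proof.
move=> /FP_enc Fl; apply: FP_ext (FP_neg (FP_comp FP_isnode Fl)) => x.
by case: (l x).
Qed.

Lemma FP_behead A B {eA : encodable A} {eB : encodable B} (l : A -> seq B) :
  FP l -> FP (fun x => behead (l x)).
Proof.
move=> /FP_enc Fl; apply/FP_enc; apply: FP_ext (FP_comp FP_tright Fl) => x.
by case: (l x).
Qed.

Lemma FP_head A B {eA : encodable A} {eB : encodable B} (d : A -> B)
    (l : A -> seq B) :
  FP d -> FP l -> FP (fun x => head (d x) (l x)).
Proof.
move=> /FP_enc Fd Fl; apply/FP_enc.
apply: FP_ext (FP_if (FP_nilp Fl) Fd (FP_comp FP_tleft (proj1 (FP_enc _) Fl))).
by move=> x; case: (l x).
Qed.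

Lemma FP_cons A B {eA : encodable A} {eB : encodable B} (f : A -> B)
    (l : A -> seq B) :
  FP f -> FP l -> FP (fun x => f x :: l x).
Proof. by move=> Ff Fl; apply/FP_enc; have /FP_enc := FP_pair Ff Fl. Qed.

Lemma FP_eqc A {eA : encodable A} (t : tree) : FP (fun x : A => enc x == t).
Proof.
have H : FP (fun u : tree => u == t).
  elim: t => [|a IHa b IHb].
    by apply: FP_ext (FP_neg FP_isnode) => u; rewrite negbK.
  apply: FP_ext (FP_and FP_isnode (FP_and (FP_comp IHa FP_tleft)
    (FP_comp IHb FP_tright))).
  by case.
exact: (FP_comp H (proj1 (FP_enc _) FP_id)).
Qed.

Lemma FP_lookup (A : eqType) B {eA : encodable A} {eB : encodable B}
    (s : seq A) (f : A -> B) (d : B) :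
  injective (enc : A -> tree) -> FP (fun x => if x \in s then f x else d).
Proof.
move=> enc_inj; elim: s => [|a s IH]; first exact: FP_const.
apply: FP_ext (FP_if (FP_eqc (enc a)) (FP_const (f a)) IH) => x.
rewrite inE; have [->|nxa] := eqVneq x a; first by rewrite eqxx.
by case: eqP => // /enc_inj /eqP; rewrite (negPf nxa).
Qed.

(** A function on a finite type is a table, read by comparing the argument with each constant in
    turn. This covers the arithmetic of 'F_p. *)
Lemma FP_finite (A : finType) B {eA : encodable A} {eB : encodable B}
    (f : A -> B) : injective (enc : A -> tree) -> FP f.
Proof.
move=> enc_inj; case: (pickP (@predT A)) => [a _|no]; last first.
  by exists Skip, id; split=> [|x]; [exact: polyb_id | have := no x].
apply: FP_ext (FP_lookup (enum A) f (f a) enc_inj) => x.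
by rewrite mem_enum.
Qed.

Lemma FP_size_bound A B {eA : encodable A} {eB : encodable B} (f : A -> B) :
  FP f -> exists2 q, polyb q & forall x, sz (f x) <= q (sz x).
Proof. by move=> [c [q [pq H]]]; exists q => // x; have [] := H x. Qed.

(* The invariant and the measure control the sizes of the intermediate        *)
(* values: a step increases the measure by a polynomial in the input only.    *)
Lemma FP_foldl A E S {eA : encodable A} {eE : encodable E}
    {eS : encodable S} (l : A -> seq E) (z : A -> S) (h : A -> S -> E -> S)
    (inv : A -> S -> Prop) (mu : A -> S -> nat) (q1 q2 q3 : nat -> nat) :
  polyb q1 -> polyb q2 -> polyb q3 ->
  (forall x, inv x (z x) /\ mu x (z x) <= q1 (sz x)) ->
  (forall x s e, inv x s -> sz e <= sz (l x) ->
     inv x (h x s e) /\ mu x (h x s e) <= mu x s + q2 (sz x + sz e)) ->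
  (forall x s, inv x s -> sz s <= q3 (mu x s + sz x)) ->
  FP l -> FP z -> FP (fun t : E * (S * A) => h t.2.2 t.2.1 t.1) ->
  FP (fun x => foldl (h x) (z x) (l x)).
Proof.
move=> p1 p2 p3 Hz Hh Hs Fl Fz Fh.
have [ql pl Hl] := FP_size_bound Fl.
apply: (FP_foldl_pair Fl Fz Fh).
exists (fun n => q3 (q1 n + ql n * q2 (n + ql n) + n)).
  by auto 10 with polyb.
move=> x l1 l2 El /=.
have H : forall l2, sz (l1 ++ l2) <= sz (l x) -> forall s, inv x s ->
    inv x (foldl (h x) s l1) /\
    mu x (foldl (h x) s l1) <= mu x s + size l1 * q2 (sz x + ql (sz x)).
  elim: {El} l1 => [|e l1 IH] l3 le3 s Is /=; first by rewrite addn0.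
  rewrite cat_cons sz_cons in le3.
  have [|I1 M1] := Hh x s e Is; first by lia.
  have [|I2 M2] := IH l3 _ _ I1; first by lia.
  split=> //; have : q2 (sz x + sz e) <= q2 (sz x + ql (sz x)).
    by apply: polyb_mono => //; have := Hl x; lia.
  by rewrite mulSn; lia.
have [I0 M0] := Hz x.
have [|I1 M1] := H l2 _ _ I0; first by rewrite El.
apply: (leq_trans (Hs _ _ I1)); apply: polyb_mono => //.
rewrite leq_add2r; apply: (leq_trans M1); apply: leq_add => //.
apply: leq_mul => //.
have := @size_le_sz _ eE (l x); rewrite El size_cat -El.
by have := Hl x; lia.
Qed.

Lemma FP_foldl_add A E S {eA : encodable A} {eE : encodable E}
    {eS : encodable S} (l : A -> seq E) (z : A -> S) (h : A -> S -> E -> S)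
    (q : nat -> nat) :
  polyb q -> (forall x s e, sz (h x s e) <= sz s + q (sz x + sz e)) ->
  FP l -> FP z -> FP (fun t : E * (S * A) => h t.2.2 t.2.1 t.1) ->
  FP (fun x => foldl (h x) (z x) (l x)).
Proof.
move=> pq Hh Fl Fz Fh; have [qz pz Hz] := FP_size_bound Fz.
apply: (FP_foldl (inv := fun _ _ => True) (mu := fun _ s => sz s) pz pq
  polyb_id _ _ _ Fl Fz Fh) => //.
by move=> x s _; rewrite leq_addr.
Qed.

(** * Operations on lists *)

Lemma FP_rev A B {eA : encodable A} {eB : encodable B} (l : A -> seq B) :
  FP l -> FP (fun x => rev (l x)).
Proof.
move=> Fl.
have E x : foldl (fun s e => e :: s) [::] (l x) = rev (l x).
  rewrite -[in LHS](revK (l x)) foldl_rev.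
  by elim: (rev _) => //= e s ->.
apply: FP_ext E _.
apply: (FP_foldl_add (h := fun _ s e => e :: s) (q := fun n => n.+1)) => //.
- by have := polyb_add (polyb_const 1) polyb_id.
- by move=> x s e; rewrite sz_cons; lia.
- exact: FP_const.
- by apply: FP_cons; [exact: FP_fst FP_id | exact: FP_fst (FP_snd FP_id)].
Qed.

Lemma FP_map A E F {eA : encodable A} {eE : encodable E} {eF : encodable F}
    (f : A -> E -> F) (l : A -> seq E) :
  FP (fun t : E * A => f t.2 t.1) -> FP l -> FP (fun x => map (f x) (l x)).
Proof.
move=> Ff Fl; have [qf pf Hf] := FP_size_bound Ff.
have E1 x : rev (foldl (fun s e => f x e :: s) [::] (l x)) = map (f x) (l x).
  rewrite -[in LHS](revK (l x)) foldl_rev -[RHS]revK -map_rev; congr rev.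
apply: FP_ext E1 _; apply: FP_rev.
apply: (FP_foldl_add (h := fun x s e => f x e :: s)
  (q := fun n => (qf n.+1).+1)) => //.
- have := polyb_add (polyb_const 1) (polyb_comp pf
    (polyb_add (polyb_const 1) polyb_id)); exact.
- move=> x s e; rewrite sz_cons.
  have := Hf (e, x); rewrite sz_pair /= [sz e + _]addnC; lia.
- exact: FP_const.
- apply: FP_cons; last exact: FP_fst (FP_snd FP_id).
  by apply: (FP_comp2 (g := fun e x => f x e)) => //;
    [exact: FP_fst FP_id | exact: FP_snd (FP_snd FP_id)].
Qed.

Lemma FP_cat A B {eA : encodable A} {eB : encodable B} (l1 l2 : A -> seq B) :
  FP l1 -> FP l2 -> FP (fun x => l1 x ++ l2 x).
Proof.
move=> F1 F2.
have E x : foldl (fun s e => e :: s) (l2 x) (rev (l1 x)) = l1 x ++ l2 x.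
  by rewrite foldl_rev; elim: (l1 x) => //= e s ->.
apply: FP_ext E _.
apply: (FP_foldl_add (h := fun _ s e => e :: s) (q := fun n => n.+1)) => //.
- by have := polyb_add (polyb_const 1) polyb_id.
- by move=> x s e; rewrite sz_cons; lia.
- exact: FP_rev.
- by apply: FP_cons; [exact: FP_fst FP_id | exact: FP_fst (FP_snd FP_id)].
Qed.

Lemma FP_flatten A B {eA : encodable A} {eB : encodable B}
    (l : A -> seq (seq B)) :
  FP l -> FP (fun x => flatten (l x)).
Proof.
move=> Fl.
have E x : foldl (fun s e => s ++ e) [::] (l x) = flatten (l x).
  by elim/last_ind: (l x) => //= s e IH; rewrite foldl_rcons flatten_rcons IH.
apply: FP_ext E _.
apply: (FP_foldl_add (h := fun _ s e => s ++ e) (q := id)) => //.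
- exact: polyb_id.
- by move=> x s e; have := @sz_cat _ eB s e; lia.
- exact: FP_const.
- by apply: FP_cat; [exact: FP_fst (FP_snd FP_id) | exact: FP_fst FP_id].
Qed.

Lemma FP_filter A E {eA : encodable A} {eE : encodable E}
    (p : A -> E -> bool) (l : A -> seq E) :
  FP (fun t : E * A => p t.2 t.1) -> FP l ->
  FP (fun x => filter (p x) (l x)).
Proof.
move=> Fp Fl.
have E1 x : flatten [seq if p x e then [:: e] else [::] | e <- l x] =
    filter (p x) (l x).
  by elim: (l x) => //= e s ->; case: (p x e).
apply: FP_ext E1 _; apply: FP_flatten; apply: FP_map => //.
by apply: FP_if => //; [apply: FP_cons; [exact: FP_fst FP_id|] | ];
  apply: FP_const.
Qed.

Lemma FP_has A E {eA : encodable A} {eE : encodable E}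
    (p : A -> E -> bool) (l : A -> seq E) :
  FP (fun t : E * A => p t.2 t.1) -> FP l -> FP (fun x => has (p x) (l x)).
Proof.
move=> Fp Fl; apply: FP_ext (FP_neg (FP_nilp (FP_filter Fp Fl))) => x.
by rewrite /nilp size_filter has_count -lt0n.
Qed.

Lemma FP_all A E {eA : encodable A} {eE : encodable E}
    (p : A -> E -> bool) (l : A -> seq E) :
  FP (fun t : E * A => p t.2 t.1) -> FP l -> FP (fun x => all (p x) (l x)).
Proof.
move=> Fp Fl.
apply: FP_ext (FP_neg (FP_has (p := fun x e => ~~ p x e) (FP_neg Fp) Fl)) => x.
by rewrite -[RHS]negbK -has_predC.
Qed.

Lemma FP_zip A B C {eA : encodable A} {eB : encodable B} {eC : encodable C}
    (l1 : A -> seq B) (l2 : A -> seq C) (d : C) :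
  FP l1 -> FP l2 -> FP (fun x => zip (l1 x) (l2 x)).
Proof.
move=> F1 F2.
pose h (s : seq C * seq (B * C)) (e : B) :=
  if nilp s.1 then s else (behead s.1, (e, head d s.1) :: s.2).
have E x : rev (foldl h (l2 x, [::]) (l1 x)).2 = zip (l1 x) (l2 x).
  have H acc : rev (foldl h (l2 x, acc) (l1 x)).2 =
      rev acc ++ zip (l1 x) (l2 x).
    elim: (l1 x) (l2 x) acc => [|b s1 IH] [|c s2] acc; rewrite /= ?cats0 //.
      by elim: s1 {IH} => //.
    by rewrite IH /= rev_cons cat_rcons.
  exact: (H [::]).
apply: FP_ext E _; apply: FP_rev; apply: FP_snd.
apply: (FP_foldl_add (h := fun _ => h) (q := fun n => n + 5)) => //.
- by have := polyb_add polyb_id (polyb_const 5).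
- move=> x [[|c r] acc] e; rewrite /h /= !sz_pair /=; first by lia.
  by rewrite !sz_cons sz_pair /=; lia.
- by apply: FP_pair => //; apply: FP_const.
- have Fs : FP (fun t : B * (seq C * seq (B * C) * A) => t.2.1).
    exact: FP_fst (FP_snd FP_id).
  apply: FP_if => //; first exact: FP_nilp (FP_fst Fs).
  apply: FP_pair; first exact: FP_behead (FP_fst Fs).
  apply: FP_cons; last exact: FP_snd Fs.
  apply: FP_pair; first exact: FP_fst FP_id.
  by apply: FP_head; [exact: FP_const | exact: FP_fst Fs].
Qed.

Lemma bool_enc_inj : injective (enc : bool -> tree).
Proof. by case; case. Qed.

Lemma prod_enc_inj A B {eA : encodable A} {eB : encodable B} :
  injective (enc : A -> tree) -> injective (enc : B -> tree) ->
  injective (enc : A * B -> tree).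
Proof. by move=> iA iB [a b] [a' b'] [/iA -> /iB ->]. Qed.

Lemma seq_enc_inj A {eA : encodable A} :
  injective (enc : A -> tree) -> injective (enc : seq A -> tree).
Proof. by move=> iA; elim=> [|a s IH] [|b t] //= [/iA -> /IH ->]. Qed.

Ltac fp := repeat first [ assumption | exact: (FP_fst FP_id) | exact: (FP_snd FP_id) | lazymatch goal with
  | |- @FP _ _ _ _ (fun x => x) => exact: FP_id
  | |- @FP _ _ _ _ (fun _ => ?c) => exact: (FP_const c)
  | |- @FP _ _ _ _ (fun x => fst (@?f x)) => apply: (FP_fst (f := f))
  | |- @FP _ _ _ _ (fun x => snd (@?f x)) => apply: (FP_snd (f := f))
  | |- @FP _ _ _ _ (fun x => (@?f x, @?g x)) => apply: (FP_pair (f := f) (g := g))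
  | |- @FP _ _ _ _ (fun x => @?f x :: @?g x) => apply: (FP_cons (f := f) (l := g))
  | |- @FP _ _ _ _ (fun x => behead (@?f x)) => apply: (FP_behead (l := f))
  | |- @FP _ _ _ _ (fun x => nilp (@?f x)) => apply: (FP_nilp (l := f))
  | |- @FP _ _ _ _ (fun x => head (@?f x) (@?g x)) =>
      apply: (FP_head (d := f) (l := g))
  | |- @FP _ _ _ _ (fun x => ~~ (@?f x)) => apply: (FP_neg (b := f))
  | |- @FP _ _ _ _ (fun x => @?f x && @?g x) => apply: (FP_and (b := f) (c := g))
  | |- @FP _ _ _ _ (fun x => @?f x || @?g x) => apply: (FP_or (b := f) (c := g))
  | |- @FP _ _ _ _ (fun x => rev (@?f x)) => apply: (FP_rev (l := f))
  | |- @FP _ _ _ _ (fun x => @?f x ++ @?g x) => apply: (FP_cat (l1 := f) (l2 := g))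
  | |- @FP _ _ _ _ (fun x => flatten (@?f x)) => apply: (FP_flatten (l := f))
  | H : FP ?f |- @FP _ _ _ _ (fun x => ?f (@?g x)) => apply: (FP_comp (f := g) H)
  end ].

Lemma unary_enc_inj : injective (enc : nat -> tree).
Proof. by elim=> [|m IH] [|n] //= [/IH ->]. Qed.

#[export] Instance enc_Fp p : encodable 'F_p := fun a => enc (nat_of_ord a).

Lemma Fp_enc_inj p : injective (enc : 'F_p -> tree).
Proof. by move=> a b /unary_enc_inj /val_inj. Qed.

Lemma sz_unary (n : nat) : sz n = 2 * n + 1.
Proof. by elim: n => // n IH; have -> : sz n.+1 = (sz n).+2 by []; lia. Qed.

Lemma sz_Fp p (a : 'F_p) : sz a <= 2 * (Zp_trunc (pdiv p)).+2.
Proof.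
have -> : @sz _ (enc_Fp (p := p)) a = 2 * nat_of_ord a + 1 := sz_unary a.
by have := ltn_ord a; lia.
Qed.

Lemma bits_enc_inj : injective (enc : seq bool -> tree).
Proof. exact/seq_enc_inj/bool_enc_inj. Qed.

Lemma FP_eq_const (A : Type) (B : eqType) {eA : encodable A}
    {eB : encodable B} (f : A -> B) (b : B) :
  injective (enc : B -> tree) -> FP f -> FP (fun x => f x == b).
Proof.
move=> enc_inj Ff; apply: (FP_comp (g := fun y => y == b)) Ff.
apply: FP_ext (FP_lookup [:: b] (fun _ => true) false enc_inj) => y.
by rewrite inE; case: eqP.
Qed.

Lemma FP_size A B {eA : encodable A} {eB : encodable B} (l : A -> seq B) :
  FP l -> FP (fun x => size (l x)).
Proof.
move=> Fl; apply/FP_enc.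
have /FP_enc : FP (fun x => [seq tt | _ <- l x]).
  exact: (FP_map (f := fun _ _ => tt) (FP_const tt) Fl).
by apply: FP_ext => x; elim: (l x) => // b s IH; exact: (congr1 (N L) IH).
Qed.

Lemma FP_nseq A {eA : encodable A} (n : A -> nat) :
  FP n -> FP (fun x => nseq (n x) tt).
Proof.
move=> /FP_enc Fn; apply/FP_enc; apply: FP_ext Fn => x.
by elim: (n x) => // m IH; exact: (congr1 (N L) IH).
Qed.

Lemma FP_addn A {eA : encodable A} (m n : A -> nat) :
  FP m -> FP n -> FP (fun x => m x + n x).
Proof.
move=> Fm Fn; apply: FP_ext (FP_size (FP_cat (FP_nseq Fm) (FP_nseq Fn))) => x.
by rewrite size_cat !size_nseq.
Qed.

Lemma FP_muln A {eA : encodable A} (m n : A -> nat) :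
  FP m -> FP n -> FP (fun x => m x * n x).
Proof.
move=> Fm Fn.
have Fs : FP (fun x => flatten [seq nseq (n x) tt | _ <- nseq (m x) tt]).
  apply: FP_flatten; apply: (FP_map (f := fun x _ => nseq (n x) tt)).
    by apply: FP_nseq; apply: (FP_comp Fn); apply: FP_snd FP_id.
  exact: FP_nseq.
apply: FP_ext (FP_size Fs) => x.
by elim: (m x) => //= k; rewrite size_cat size_nseq => ->; rewrite mulSn.
Qed.

(** * Binary arithmetic in polynomial time *)

(* Least significant digit first. *)
Fixpoint bval (s : seq bool) : nat := if s is b :: s' then b + 2 * bval s' else 0.

(** A full adder; the state holds the digits of the second summand still to be read, the carry, and
    the output in reverse order. *)
Definition add_step (st : seq bool * (bool * seq bool)) (e : bool) :=
  let b := head false st.1 in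
  let c := st.2.1 in
  (behead st.1, ((e && b) || ((e || b) && c), (e (+) b (+) c) :: st.2.2)).

Definition badd (s t : seq bool) : seq bool :=
  let st := foldl add_step (t, (false, [::])) s in
  let st' := foldl (fun st _ => add_step st false) st st.1 in
  rev (st'.2.1 :: st'.2.2).

Definition bmul (s t : seq bool) : seq bool :=
  foldl (fun acc e => badd (false :: acc) (if e then t else [::])) [::] (rev s).

Definition bscale (w : nat) (s : seq bool) : seq bool :=
  foldl (fun acc _ => badd acc s) [::] (nseq w tt).

Definition beqv_step (st : seq bool * bool) (e : bool) :=
  (behead st.1, st.2 && (head false st.1 == e)).

Definition beqv (s t : seq bool) : bool :=
  let st := foldl beqv_step (t, true) s in st.2 && all negb st.1.

Lemma sz_bits (s : seq bool) : sz s <= 4 * size s + 1.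
Proof.
by elim: s => //= b s IH; rewrite sz_cons; case: b; rewrite /sz /= in IH *; lia.
Qed.

Lemma FP_add_step A {eA : encodable A} (st : A -> seq bool * (bool * seq bool))
    (e : A -> bool) :
  FP st -> FP e -> FP (fun x => add_step (st x) (e x)).
Proof.
move=> Fst Fe.
have Fb : FP (fun x => head false (st x).1) by fp.
pose maj := fun t : bool * (bool * bool) =>
  (t.1 && t.2.1) || ((t.1 || t.2.1) && t.2.2).
pose xor := fun t : bool * (bool * bool) => t.1 (+) t.2.1 (+) t.2.2.
have inj3 : injective (enc : bool * (bool * bool) -> tree).
  by do ?apply: prod_enc_inj; apply: bool_enc_inj.
have Fp3 : FP (fun x => (e x, (head false (st x).1, (st x).2.1))) by fp.
rewrite /add_step; apply: FP_pair; first by fp.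
apply: FP_pair; first exact: (FP_comp (FP_finite maj inj3) Fp3).
apply: FP_cons; first exact: (FP_comp (FP_finite xor inj3) Fp3).
by fp.
Qed.

Lemma size_badd s t : size (badd s t) = (maxn (size s) (size t)).+1.
Proof.
rewrite /badd size_rev /=.
have H1 st : let st' := foldl add_step st s in
    size st'.2.2 = size st.2.2 + size s /\ size st'.1 = size st.1 - size s.
  elim: s st => [|e s IH] st /=; first by rewrite addn0 subn0.
  by have [-> ->] := IH (add_step st e); rewrite /= size_behead; lia.
have H2 (l : seq bool) st : size (foldl (fun st _ => add_step st false) st l).2.2
    = size st.2.2 + size l.
  elim: l st => [|e l IH] st /=; first by rewrite addn0.
  by rewrite IH /=; lia.
by have [/= E1 E2] := H1 (t, (false, [::])); rewrite H2 E1 E2; lia.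
Qed.

Lemma FP_badd A {eA : encodable A} (s t : A -> seq bool) :
  FP s -> FP t -> FP (fun x => badd (s x) (t x)).
Proof.
move=> Fs Ft.
have sz_step st e : sz (add_step st e) <= sz st + 20.
  case: st => [[|b u] [c v]] /=; rewrite /add_step /= !sz_pair /= sz_cons.
    by case: e; case: c; rewrite /sz /=; lia.
  by rewrite sz_cons; case: e; case: b; case: c; rewrite /sz /=; lia.
pose st1 x := foldl add_step (t x, (false, [::])) (s x).
have F1 : FP st1.
  apply: (FP_foldl_add (h := fun _ => add_step) (q := fun=> 20)) => //.
  - exact: polyb_const.
  - by fp.
  - by apply: FP_add_step; fp.
pose st2 x := foldl (fun st (_ : bool) => add_step st false) (st1 x) (st1 x).1.
have F2 : FP st2.
  apply: (FP_foldl_add (h := fun _ st (_ : bool) => add_step st false)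
    (q := fun=> 20)) => //.
  - exact: polyb_const.
  - by fp.
  - by apply: FP_add_step; fp.
by rewrite /badd -/(st1 _); fp.
Qed.

Lemma size_bmul s t : size (bmul s t) <= size t + 2 * size s + 1.
Proof.
rewrite /bmul -(size_rev s).
elim/last_ind: (rev s) => //= u e IH.
by rewrite foldl_rcons size_badd size_rcons /=; case: e => /=; lia.
Qed.

(** One round of doubling and adding raises the larger of the lengths of the accumulator and of [t]
    by at most 2; this maximum is the measure. *)
Lemma FP_bmul A {eA : encodable A} (s t : A -> seq bool) :
  FP s -> FP t -> FP (fun x => bmul (s x) (t x)).
Proof.
move=> Fs Ft; have [qt pt Ht] := FP_size_bound Ft.
apply: (FP_foldl (inv := fun _ _ => True)
  (mu := fun x acc => maxn (size acc) (size (t x)))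
  (h := fun x acc e => badd (false :: acc) (if e then t x else [::]))
  (q1 := qt) (q2 := fun=> 2) (q3 := fun n => 4 * n + 1)) => //.
- exact: polyb_const.
- by auto with polyb.
- move=> x; split=> //=; have := @size_le_sz _ enc_bool (t x); have := Ht x; lia.
- by move=> x acc e _ _; split=> //; rewrite size_badd /=; case: e => /=; lia.
- by move=> x acc _; have := sz_bits acc; lia.
- by fp.
- by fp.
- by apply: FP_badd; first fp; apply: FP_if; fp.
Qed.

Lemma size_bscale w s : size (bscale w s) <= size s + w.
Proof.
rewrite /bscale; elim: w => // w IH.
by rewrite -addn1 nseqD foldl_cat /= size_badd; lia.
Qed.

Lemma FP_bscale A {eA : encodable A} (w : A -> nat) (s : A -> seq bool) :
  FP w -> FP s -> FP (fun x => bscale (w x) (s x)).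
Proof.
move=> Fw Fs; have [qs ps Hs] := FP_size_bound Fs.
apply: (FP_foldl (inv := fun _ _ => True)
  (mu := fun x acc => maxn (size acc) (size (s x)))
  (h := fun x acc _ => badd acc (s x))
  (q1 := qs) (q2 := fun=> 1) (q3 := fun n => 4 * n + 1)) => //.
- exact: polyb_const.
- by auto with polyb.
- move=> x; split=> //=; have := @size_le_sz _ enc_bool (s x); have := Hs x; lia.
- by move=> x acc e _ _; split=> //; rewrite size_badd /=; lia.
- by move=> x acc _; have := sz_bits acc; lia.
- exact: FP_nseq.
- by fp.
- by apply: FP_badd; fp.
Qed.

Lemma FP_beqb A {eA : encodable A} (b c : A -> bool) :
  FP b -> FP c -> FP (fun x => b x == c x).
Proof.
move=> Fb Fc; apply: (FP_comp (g := fun t : bool * bool => t.1 == t.2)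
  (f := fun x => (b x, c x))); last by fp.
exact: (FP_finite _ (prod_enc_inj bool_enc_inj bool_enc_inj)).
Qed.

Lemma FP_beqv A {eA : encodable A} (s t : A -> seq bool) :
  FP s -> FP t -> FP (fun x => beqv (s x) (t x)).
Proof.
move=> Fs Ft; rewrite /beqv.
pose st x := foldl beqv_step (t x, true) (s x).
have F1 : FP st.
  apply: (FP_foldl_add (h := fun _ => beqv_step) (q := fun=> 20)) => //.
  - exact: polyb_const.
  - move=> _ [[|b u] c] e; rewrite /beqv_step /= !sz_pair /= ?sz_cons.
      by case: c; case: e; rewrite /sz /=; lia.
    by case: c; case: e; case: b; rewrite /sz /=; lia.
  - by fp.
  - by rewrite /beqv_step; fp; apply: FP_beqb; fp.
have FA : FP (fun x => all negb (st x).1).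
  by apply: (FP_all (p := fun _ => negb)); fp.
by apply: FP_and => //; fp.
Qed.

(** Literal equality of bit strings, used for names, whereas [beqv] compares values and ignores
    final zeros. *)
Definition keq_step (st : seq bool * bool) (e : bool) :=
  (behead st.1, st.2 && (~~ nilp st.1 && (head false st.1 == e))).

Lemma foldl_keq s t ok :
  (foldl keq_step (t, ok) s).2 && nilp (foldl keq_step (t, ok) s).1 =
    ok && (s == t).
Proof.
elim: s t ok => [|e s IH] [|b t] ok //=; rewrite IH /= ?andbF //.
by rewrite eqseq_cons andbA [e == b]eq_sym.
Qed.

Lemma FP_eq_bits A {eA : encodable A} (s t : A -> seq bool) :
  FP s -> FP t -> FP (fun x => s x == t x).
Proof.
move=> Fs Ft; apply: FP_ext (fun x => foldl_keq (s x) (t x) true) _ => /=.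
pose st x := foldl keq_step (t x, true) (s x).
have F1 : FP st.
  apply: (FP_foldl_add (h := fun _ => keq_step) (q := fun=> 20)) => //.
  - exact: polyb_const.
  - move=> _ [[|b u] c] e; rewrite /keq_step /= !sz_pair /= ?sz_cons.
      by case: c; case: e; rewrite /sz /=; lia.
    by case: c; case: e; case: b; rewrite /sz /=; lia.
  - by fp.
  - by rewrite /keq_step; fp; apply: FP_beqb; fp.
by apply: FP_and; fp.
Qed.

(** * The algorithm *)

Section LinearAlgebra.
Variable p : nat.
Implicit Types (L : seq (seq 'F_p)) (v w : seq 'F_p).
Local Open Scope ring_scope.

(* Variables are named by their binary codes. *)
Definition lookup (k : seq bool) (l : seq (seq bool * 'F_p)) : 'F_p :=
  foldl (fun acc kv => if kv.1 == k then kv.2 else acc) 0 l.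

Definition elim_vec (u v : seq 'F_p) : seq 'F_p :=
  behead [seq ab.1 - head 0 v / head 0 u * ab.2 | ab <- zip v u].

(** One step of Gaussian elimination: it yields generators of the vectors of the span whose first
    coordinate is 0, with that coordinate removed. The pivot stays in the list as a zero vector. *)
Definition elim L : seq (seq 'F_p) :=
  let P := [seq v <- L | head 0 v != 0] in
  if nilp P then [seq behead v | v <- L]
  else [seq elim_vec (head [::] P) v | v <- L].

(* A constraint: the tuples of the relation, and the scope. *)
Definition constr := (seq (seq 'F_p) * seq (seq bool))%type.

(* The solution set is represented by generators of its homogenization; the   *)
(* homogenizing coordinate comes first.                                       *)
Definition extend (vars : seq (seq bool)) (c : constr) L : seq (seq 'F_p) :=
  [seq (head 0 w :: [seq lookup k (zip vars (behead w)) | k <- c.2]) ++ w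
     | w <- L] ++
  [seq (1 :: t) ++ 0 :: [seq 0 | _ <- vars] | t <- c.1].

(** Eliminating the homogenizing coordinate and the scope coordinates put in front by [extend] keeps
    the vectors whose scope part is cancelled by a combination of the homogenized tuples. *)
Definition add_constr (vars : seq (seq bool)) L (c : constr) :
    seq (seq 'F_p) :=
  elim (foldl (fun L _ => elim L) (extend vars c L) c.2).

Definition all_gens (vars : seq (seq bool)) : seq (seq 'F_p) :=
  (1 :: [seq 0 | _ <- vars]) ::
  [seq 0 :: [seq if k == k' then 1 else 0 | k' <- vars] | k <- vars].

Definition gens (vars : seq (seq bool)) (cs : seq constr) : seq (seq 'F_p) :=
  foldl (add_constr vars) (all_gens vars) cs.

Definition feas (vars : seq (seq bool)) (cs : seq constr) : bool :=
  has (fun w => head 0 w != 0) (gens vars cs).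

(* [pow_digit] and [fact_div] vanish outside a finite table, so that they are *)
(* computed by a case distinction.                                            *)
Definition pow_digit (d : nat) (a : 'F_p) (m : seq bool) : nat :=
  if m \in [seq nat_bits i | i <- iota 0 d.+1] then (a ^ bval m)%N else 0%N.

Definition fact_div (n : nat) : nat :=
  if n \in iota 0 p.+1 then (p`! %/ n)%N else 0%N.

Definition fix_var (k : seq bool) (a : 'F_p) : constr := ([:: [:: a]], [:: k]).

(* [weight d e vars cs T] is [p!^e] times the average, over the solutions of  *)
(* [cs], of the product of the [x_k ^ m] for [(k, m)] in [T], provided that   *)
(* [T] has at most [e] elements. The factor [p!] clears the denominator [K],  *)
(* which is the number of values taken by the first variable of [T].          *)
Fixpoint weight (d e : nat) (vars : seq (seq bool)) (cs : seq constr)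
    (T : seq (seq bool * seq bool)) : nat :=
  if e is e'.+1 then
    if nilp T then (p`! * weight d e' vars cs [::])%N
    else
      let km := head ([::], [::]) T in
      (fact_div (size [seq a <- enum 'F_p | feas vars (fix_var km.1 a :: cs)]) *
       sumn [seq if feas vars (fix_var km.1 a :: cs)
                 then pow_digit d a km.2 *
                      weight d e' vars (fix_var km.1 a :: cs) (behead T)
                 else 0 | a <- enum 'F_p])%N
  else 1%N.

Lemma FP_Fp_fun2 A {eA : encodable A} (g : 'F_p -> 'F_p -> 'F_p)
    (a b : A -> 'F_p) : FP a -> FP b -> FP (fun x => g (a x) (b x)).
Proof.
move=> Fa Fb; apply: (FP_comp2 (g := g)) Fa Fb.
by apply: FP_finite; apply: prod_enc_inj; apply: Fp_enc_inj.
Qed.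

Lemma FP_neq0 A {eA : encodable A} (a : A -> 'F_p) :
  FP a -> FP (fun x => a x != 0).
Proof. by move=> Fa; apply/FP_neg/FP_eq_const => //; apply: Fp_enc_inj. Qed.

Lemma FP_elim A {eA : encodable A} (f : A -> seq (seq 'F_p)) :
  FP f -> FP (fun x => elim (f x)).
Proof.
move=> Ff; apply: (FP_comp (g := elim)) Ff.
have FP_P : FP (fun L => [seq v <- L | head 0 v != 0]).
  apply: (FP_filter (p := fun _ v => head 0 v != 0)); last by fp.
  by apply: FP_neq0; fp.
rewrite /elim; apply: FP_if; first by fp.
  by apply: (FP_map (f := fun _ v => behead v)); fp.
apply: (FP_map (f := fun L v => elim_vec (head [::] [seq v <- L | head 0 v != 0]) v));
  last by fp.
pose u (t : seq 'F_p * seq (seq 'F_p)) :=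
  head [::] [seq v <- t.2 | head 0 v != 0].
have Fu : FP u by rewrite /u; fp; apply: (FP_comp FP_P); fp.
rewrite /elim_vec; apply: FP_behead.
apply: (FP_map (f := fun t (ab : 'F_p * 'F_p) =>
  ab.1 - head 0 t.1 / head 0 (u t) * ab.2)); last first.
  by apply: (FP_zip 0); fp.
apply: (FP_Fp_fun2 (fun a b => a - b)); first by fp.
apply: (FP_Fp_fun2 (fun a b => a * b)); last by fp.
apply: (FP_Fp_fun2 (fun a b => a / b)); first by fp.
by apply: FP_head; [fp | apply: (FP_comp Fu); fp].
Qed.

Local Close Scope ring_scope.

Lemma sz_vec (v : seq 'F_p) :
  sz v <= (2 * (Zp_trunc (pdiv p)).+2 + 1) * size v + 1.
Proof.
elim: v => [|a v IH]; first by rewrite muln0.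
rewrite sz_cons /= mulnS.
by have := sz_Fp a; lia.
Qed.

Lemma sz_vecs L n : all (fun v => size v <= n) L ->
  sz L <= ((2 * (Zp_trunc (pdiv p)).+2 + 1) * n + 2) * size L + 1.
Proof.
elim: L => [|v L IH] /=; first by rewrite muln0.
move=> /andP[len /IH {}IH]; rewrite sz_cons mulnS.
have := leq_mul (leqnn (2 * (Zp_trunc (pdiv p)).+2 + 1)) len.
by have := sz_vec v; lia.
Qed.

(** Elimination never adds a generator; this keeps the intermediate systems of polynomial size. *)
Lemma size_elim L n : all (fun v => size v <= n.+1) L ->
  size (elim L) = size L /\ all (fun v => size v <= n) (elim L).
Proof.
move=> /allP HL; rewrite /elim; case: ifP => _; rewrite size_map; split=> //;
  rewrite all_map; apply/allP => v /HL le /=; rewrite size_behead.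
  by lia.
by rewrite size_map size_zip; move: le; size_lia.
Qed.

Lemma size_elims (A : Type) (s : seq A) L n :
  all (fun v => size v <= size s + n) L ->
  size (foldl (fun L _ => elim L) L s) = size L /\
  all (fun v => size v <= n) (foldl (fun L _ => elim L) L s).
Proof.
elim: s L => [|a s IH] L HL //=.
by have [<- /IH] := size_elim HL.
Qed.

Lemma FP_lookup_var A {eA : encodable A} (k : A -> seq bool)
    (l : A -> seq (seq bool * 'F_p)) :
  FP k -> FP l -> FP (fun x => lookup (k x) (l x)).
Proof.
move=> Fk Fl.
apply: (FP_foldl_add (z := fun _ => 0%R) (h := fun x acc kv => if kv.1 == k x then kv.2 else acc)
  (q := fun n => n)) => //.
- exact: polyb_id.
- by move=> x acc [a b] /=; rewrite sz_pair /=; case: ifP => _; lia.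
- exact: FP_const.
- apply: FP_if; [|by fp|by fp].
  by apply: FP_eq_bits; fp.
Qed.

Lemma FP_extend A {eA : encodable A} (vars : A -> seq (seq bool))
    (c : A -> constr) (f : A -> seq (seq 'F_p)) :
  FP vars -> FP c -> FP f -> FP (fun x => extend (vars x) (c x) (f x)).
Proof.
move=> Fv Fc Ff; rewrite /extend; apply: FP_cat.
  apply: (FP_map (f := fun x w =>
    (head 0%R w :: [seq lookup k (zip (vars x) (behead w)) | k <- (c x).2]) ++ w));
    last by fp.
  fp.
  apply: (FP_map (f := fun t k => lookup k (zip (vars t.2) (behead t.1))));
    last by fp.
  by apply: FP_lookup_var; first fp; apply: (FP_zip 0%R); fp.
apply: (FP_map (f := fun x t => (1%R :: t) ++ 0%R :: [seq 0%R | _ <- vars x])); last by fp.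
by fp; apply: (FP_map (f := fun _ _ => 0%R)); fp.
Qed.

Lemma size_extend vars c L n :
  all (fun v => size v <= n) L -> 2 + sz c.1 + size vars <= n ->
  size (extend vars c L) = size L + size c.1 /\
  all (fun v => size v <= size c.2 + n.+1) (extend vars c L).
Proof.
move=> /allP HL len; rewrite size_cat !size_map; split=> //.
rewrite all_cat !all_map; apply/andP; split; apply/allP => v.
  by move=> /HL le; rewrite /= size_cat size_map; lia.
move=> vc; rewrite /= size_cat /= size_map.
by have := mem_le_sz (eA := enc_seq (enc_Fp (p := p))) vc;
  have := @size_le_sz _ (enc_Fp (p := p)) v; move: len; size_lia.
Qed.

(** The measure is the number of generators, which a constraint increases by the number of its
    tuples; the invariant bounds their lengths by [M]. Both must hold on arbitrary, possibly
    ill-formed arguments, since [FP] bounds the program everywhere. *)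
Lemma FP_gens A {eA : encodable A} (vars : A -> seq (seq bool))
    (cs : A -> seq constr) :
  FP vars -> FP cs -> FP (fun x => gens (vars x) (cs x)).
Proof.
move=> Fv Fc.
have [qv pv Hv] := FP_size_bound Fv; have [qc pc Hc] := FP_size_bound Fc.
pose (M := fun x => 5 + sz (vars x) + sz (cs x)).
pose K := 2 * (Zp_trunc (pdiv p)).+2 + 1.
have FZ : FP (fun x => all_gens (vars x)).
  have Fz B (eB : encodable B) (g : B -> A) : FP g ->
      FP (fun x => [seq (0%R : 'F_p) | _ <- vars (g x)]).
    by move=> Fg; apply: (FP_map (f := fun _ _ => 0%R)); fp.
  rewrite /all_gens; fp; first exact: (Fz _ _ _ FP_id).
  apply: (FP_map (f := fun x k => 0%R :: [seq if k == k' then 1%R else 0%R | k' <- vars x]));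
    last by fp.
  fp; apply: (FP_map (f := fun t k' => if t.1 == k' then 1%R else 0%R : 'F_p));
    last by fp.
  by apply: FP_if; [apply: FP_eq_bits; fp | fp | fp].
rewrite /gens; apply: (FP_foldl (inv := fun x L => all (fun v => size v <= M x) L)
  (mu := fun _ L => size L) (h := fun x => add_constr (vars x))
  (q1 := fun n => 1 + qv n) (q2 := fun n => n)
  (q3 := fun n => (K * (5 + qv n + qc n) + 2) * n + 1)) => //.
- by auto with polyb.
- exact: polyb_id.
- by auto 10 with polyb.
- move=> x; have szv := @size_le_sz _ (enc_seq enc_bool) (vars x); split.
    rewrite /= size_map all_map /M; apply/andP; split; first by lia.
    by apply/allP => k _ /=; rewrite size_map; lia.
  by rewrite /= size_map; have := Hv x; lia.
- move=> x L c HL lec; rewrite /add_constr.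
  have lec1 : sz c.1 < sz c by rewrite [sz c]sz_pair; lia.
  have szv := @size_le_sz _ (enc_seq enc_bool) (vars x).
  have szc := @size_le_sz _ (enc_seq (enc_Fp (p := p))) c.1.
  have [|E1 H1] := @size_extend (vars x) c L (M x) HL; first by rewrite /M; lia.
  have [E2 H2] := size_elims H1; have [E3 H3] := size_elim H2.
  by rewrite E3 E2 E1; split=> //; lia.
- move=> x L HL.
  have leM : M x <= 5 + qv (size L + sz x) + qc (size L + sz x).
    rewrite /M; have := Hv x; have := Hc x.
    have := polyb_mono pv (leq_addl (size L) (@sz _ eA x)).
    by have := polyb_mono pc (leq_addl (size L) (@sz _ eA x)); lia.
  apply: (leq_trans (sz_vecs HL)); rewrite leq_add2r.
  by rewrite leq_mul ?leq_addr // leq_add2r leq_mul.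
- rewrite /add_constr; apply: FP_elim.
  pose l0 (t : constr * (seq (seq 'F_p) * A)) := extend (vars t.2.2) t.1 t.2.1.
  have Fl0 : FP l0 by apply: FP_extend; fp.
  have [q0 p0 H0] := FP_size_bound Fl0.
  apply: (FP_foldl (inv := fun t L => size L = size (l0 t) /\
      all (fun v => size v <= sz (l0 t)) L)
    (mu := fun t _ => 0) (h := fun _ L _ => elim L) (z := l0)
    (q1 := fun=> 0) (q2 := fun=> 0)
    (q3 := fun n => (K * q0 n + 2) * q0 n + 1)) => //.
  + exact: polyb_const.
  + exact: polyb_const.
  + by auto 10 with polyb.
  + move=> t; split=> //; split=> //; apply/allP => v vl.
    have := mem_le_sz (eA := enc_seq (enc_Fp (p := p))) vl.
    by have := @size_le_sz _ (enc_Fp (p := p)) v; size_lia.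
  + move=> t L _ [E H] _; split=> //.
    have [|-> H'] := @size_elim L (sz (l0 t)).
      by apply: sub_all H => v /leqW.
    by split.
  + move=> t L [E H]; rewrite add0n.
    have leq0 : size (l0 t) <= q0 (sz t).
      by have := H0 t; have := @size_le_sz _ (enc_seq (enc_Fp (p := p))) (l0 t); size_lia.
    apply: (leq_trans (sz_vecs H)); rewrite leq_add2r E.
    by rewrite leq_mul // leq_add2r leq_mul.
  + by fp.
  + by apply: FP_elim; fp.
Qed.

Lemma FP_feas A {eA : encodable A} (vars : A -> seq (seq bool))
    (cs : A -> seq constr) :
  FP vars -> FP cs -> FP (fun x => feas (vars x) (cs x)).
Proof.
move=> Fv Fc; apply: (FP_has (p := fun _ w => head 0%R w != 0%R)).
  by apply: FP_neq0; fp.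
exact: FP_gens.
Qed.

Lemma FP_sumn_const A B {eA : encodable A} (s : seq B) (f : A -> B -> nat) :
  (forall b, FP (fun x => f x b)) -> FP (fun x => sumn [seq f x b | b <- s]).
Proof.
move=> Ff; elim: s => [|b s IH] /=; first exact: FP_const.
exact: FP_addn.
Qed.

(** The induction is on the constant [e], and the sum runs over the constant list of field elements,
    so closure of [FP] under composition and unary arithmetic suffices. *)
Lemma FP_weight d e A {eA : encodable A} (vars : A -> seq (seq bool))
    (cs : A -> seq constr) (T : A -> seq (seq bool * seq bool)) :
  FP vars -> FP cs -> FP T ->
  FP (fun x => weight d e (vars x) (cs x) (T x)).
Proof.
elim: e cs T => [|e IH] cs T Fv Fc FT /=; first exact: FP_const.
pose km x := head ([::], [::]) (T x).
have Fkm : FP km by rewrite /km; fp.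
have Ffix a : FP (fun x => fix_var (km x).1 a) by rewrite /fix_var; fp.
have Ffeas a : FP (fun x => feas (vars x) (fix_var (km x).1 a :: cs x)).
  by apply: FP_feas; fp.
apply: FP_if; first by fp.
  by apply: FP_muln; [fp | apply: IH; fp].
apply: FP_muln.
  apply: (FP_comp (g := fact_div)); first exact: FP_lookup unary_enc_inj.
  apply: FP_ext (fun x => esym (size_filter _ _)) _ => /=.
  apply: FP_ext (fun x => sumn_count _ _) _.
  apply: FP_sumn_const => a.
  apply: (FP_comp (g := nat_of_bool)) (Ffeas a).
  exact: FP_finite bool_enc_inj.
apply: FP_sumn_const => a; apply: FP_if => //; last by fp.
apply: FP_muln; last by apply: IH; fp.
apply: (FP_comp (g := pow_digit d a)); last by fp.
exact: FP_lookup bits_enc_inj.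
Qed.

End LinearAlgebra.

(* The state [(P, (N, B))] stands for the rational number [(P - N) / B]; the  *)
(* element [(w, (a, b))] adds [w * a / b] to it.                              *)
Definition zero_step (st : seq bool * (seq bool * seq bool))
    (e : nat * (seq bool * seq bool)) : seq bool * (seq bool * seq bool) :=
  let t := bmul (bscale e.1 (behead e.2.1)) st.2.2 in
  (badd (bmul e.2.2 st.1) (if head false e.2.1 then [::] else t),
   (badd (bmul e.2.2 st.2.1) (if head false e.2.1 then t else [::]),
    bmul e.2.2 st.2.2)).

Definition zero_sum (l : seq (nat * (seq bool * seq bool))) : bool :=
  let st := foldl zero_step ([::], ([::], [:: true])) l in beqv st.1 st.2.1.

Lemma FP_zero_sum A {eA : encodable A}
    (l : A -> seq (nat * (seq bool * seq bool))) :
  FP l -> FP (fun x => zero_sum (l x)).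
Proof.
move=> Fl; rewrite /zero_sum.
pose st x := foldl zero_step ([::], ([::], [:: true])) (l x).
have F1 : FP st; last by apply: FP_beqv; fp.
apply: (FP_foldl (inv := fun _ _ => True)
  (mu := fun _ s => maxn (size s.1) (maxn (size s.2.1) (size s.2.2)))
  (z := fun _ => ([::], ([::], [:: true]))) (h := fun _ => zero_step)
  (q1 := fun=> 1) (q2 := fun n => 2 * n + 2) (q3 := fun n => 12 * n + 5)) => //.
- exact: polyb_const.
- by auto with polyb.
- by auto with polyb.
- move=> x [P [Q B]] [w [a b]] _ _; split=> //=.
  rewrite !size_badd !sz_pair /=.
  have := size_bmul b P; have := size_bmul b Q; have := size_bmul b B.
  have := size_bmul (bscale w (behead a)) B.
  have := size_bscale w (behead a); rewrite size_behead.
  have := @size_le_sz _ enc_bool a; have := @size_le_sz _ enc_bool b.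
  have := sz_unary w.
  by case: (head _ _) => /=; lia.
- move=> x [P [Q B]] _; rewrite !sz_pair /=.
  by have := sz_bits P; have := sz_bits Q; have := sz_bits B; lia.
- by fp.
- have Ft : FP (fun t : nat * (seq bool * seq bool) *
      (seq bool * (seq bool * seq bool) * A) =>
      bmul (bscale t.1.1 (behead t.1.2.1)) t.2.1.2.2).
    by apply: FP_bmul; [apply: FP_bscale; fp | fp].
  rewrite /zero_step; fp.
  + by apply: FP_badd; [apply: FP_bmul; fp | apply: FP_if; fp].
  + by apply: FP_badd; [apply: FP_bmul; fp | apply: FP_if; fp].
  + by apply: FP_bmul; fp.
Qed.

(** * The decision procedure *)

(* Coefficients by numerator and denominator, and exponents. *)
Definition term := ((seq bool * (seq bool * unit)) * (seq (seq bool) * unit))%type.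

(** A bracketed node is a list of its children; ending nested pairs with [unit] gives the same tree
    as such a list. *)
Definition raw_constr := (seq (seq (seq bool)) * (seq (seq bool) * unit))%type.

Definition raw_inst :=
  (seq (seq bool) * (seq raw_constr * (seq (seq term) * unit)))%type.

(** [[:: false]] is the code of the exponent 0; without these entries the length is at most the
    degree. *)
Definition powers (vars es : seq (seq bool)) : seq (seq bool * seq bool) :=
  [seq km <- zip vars es | km.2 != [:: false]].

Section Decide.
Variables p d : nat.

Definition digit (m : seq bool) : 'F_p :=
  if m \in [seq nat_bits i | i <- iota 0 p] then ((bval m)%:R)%R else 0%R.

Definition constr_of (c : raw_constr) : constr p :=
  ([seq [seq digit m | m <- t] | t <- c.1], c.2.1).

(** The inner product of [f] with the monomial of [b] over the solutions, up to a positive factor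
    when they exist. The depth [d + d] allows for two monomials of degree at most [d]; [behead]
    drops the sign bit of the denominator. *)
Definition orthogonal_to (vars : seq (seq bool)) (cs : seq (constr p))
    (f : seq term) (b : term) : bool :=
  zero_sum
    [seq (weight d (d + d) vars cs (powers vars a.2.1 ++ powers vars b.2.1),
          (a.1.1, behead a.1.2.1)) | a <- f].

Definition decide (x : raw_inst) : bool :=
  let cs := [seq constr_of c | c <- x.2.1] in
  ~~ feas x.1 cs ||
  all (fun f => all (fun b => orthogonal_to x.1 cs f b) f) x.2.2.1.

Lemma FP_powers A {eA : encodable A} (vars es : A -> seq (seq bool)) :
  FP vars -> FP es -> FP (fun x => powers (vars x) (es x)).
Proof.
move=> Fv Fe; apply: (FP_filter (p := fun _ km => km.2 != [:: false]));
  last by apply: (FP_zip [::]); fp.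
apply: FP_neg; apply: (FP_eq_const (f := fun t => t.1.2)); last by fp.
exact: bits_enc_inj.
Qed.

Lemma FP_decide : FP decide.
Proof.
pose csof (x : raw_inst) := [seq constr_of c | c <- x.2.1].
have Fcs : FP csof.
  apply: (FP_map (f := fun _ c => constr_of c)); last by fp.
  rewrite /constr_of; apply: FP_pair; last by fp.
  apply: (FP_map (f := fun _ t => [seq digit m | m <- t])); last by fp.
  apply: (FP_map (f := fun _ m => digit m)); last by fp.
  apply: (FP_comp (g := digit)); last by fp.
  exact: FP_lookup bits_enc_inj.
rewrite /decide -/(csof _); apply: FP_or.
  by apply: FP_neg; apply: FP_feas; fp.
apply: (FP_all (p := fun x f =>
  all (fun b => orthogonal_to x.1 (csof x) f b) f)); last by fp.
apply: (FP_all (p := fun (t : seq term * raw_inst) b =>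
  orthogonal_to t.2.1 (csof t.2) t.1 b)); last by fp.
apply: FP_zero_sum.
apply: (FP_map (f := fun (t : term * (seq term * raw_inst)) (a : term) =>
  (weight d (d + d) t.2.2.1 (csof t.2.2)
     (powers t.2.2.1 a.2.1 ++ powers t.2.2.1 t.1.2.1), (a.1.1, behead a.1.2.1))));
  last by fp.
apply: FP_pair; last by fp.
apply: FP_weight; [by fp | by fp |].
by fp; apply: FP_powers; fp.
Qed.

End Decide.

(** * Reading the input word *)

(* Every letter is replaced by symbols so that the word of a nested list      *)
(* becomes the code of the list that has it as its only element.              *)
Definition letter_code (a : letter) : seq sym :=
  match a with
  | inl b => node_sym :: code (enc b)
  | inr b => if b then [:: node_sym] else [:: leaf_sym]
  end.

Definition word_code (w : seq letter) : seq sym := flatten (map letter_code w).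

Definition represents (w : seq letter) (t : tree) : Prop :=
  word_code w = node_sym :: code t.

Lemma represents_node us ts :
  List.Forall2 represents us ts ->
  represents (enc_node us) (foldr N L ts).
Proof.
move=> H; rewrite /represents /word_code /= map_rcons flatten_rcons /=.
congr cons; elim: H => //= u t us' ts' Hu _ IH.
by rewrite map_cat flatten_cat -/(word_code u) Hu /= -!catA -IH.
Qed.

Lemma represents_list A B {eB : encodable B} (e : A -> seq letter)
    (g : A -> B) (s : seq A) :
  (forall x, represents (e x) (enc (g x))) ->
  represents (enc_list e s) (enc [seq g x | x <- s]).
Proof.
move=> H; have -> : enc [seq g x | x <- s] = foldr N L [seq enc (g x) | x <- s].
  by elim: s => // x s IH; rewrite /= -IH.
apply: represents_node; elim: s => //= x s IH; constructor=> //; exact: H.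
Qed.

Lemma represents_bits s : represents (enc_bits s) (enc s).
Proof.
rewrite -[in enc s](map_id s); apply: represents_list => b.
by rewrite /represents /word_code /= cats0.
Qed.

Lemma represents_pair A B {eA : encodable A} {eB : encodable B} u v
    (a : A) (b : B) :
  represents u (enc a) -> represents v (enc b) ->
  represents (enc_node [:: u; v]) (enc (a, (b, tt))).
Proof.
move=> Hu Hv; apply: (represents_node (ts := [:: enc a; enc b])).
by do !constructor.
Qed.

Lemma represents_triple A B C {eA : encodable A} {eB : encodable B}
    {eC : encodable C} u v w (a : A) (b : B) (c : C) :
  represents u (enc a) -> represents v (enc b) -> represents w (enc c) ->
  represents (enc_node [:: u; v; w]) (enc (a, (b, (c, tt)))).
Proof.
move=> Hu Hv Hw; apply: (represents_node (ts := [:: enc a; enc b; enc c])).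
by do !constructor.
Qed.

Definition not_blank (o : option sym) : bool := o != None.
Definition is_letter (a : letter) (o : option sym) : bool := o == Some (inl a).

Definition push_letter_code : cmd :=
  If RB (is_letter (inr true)) (pushc RA node_sym)
  (If RB (is_letter (inr false)) (pushc RA leaf_sym)
  (If RB (is_letter (inl true))
     (Seq (pushc RA leaf_sym) (Seq (pushc RA leaf_sym)
        (Seq (pushc RA node_sym) (pushc RA node_sym))))
     (Seq (pushc RA leaf_sym) (pushc RA node_sym)))).

Definition parse : cmd :=
  Seq (While RA not_blank (Seq (Push RB RA copy_top) (Pop RA)))
  (Seq (pushc RA leaf_sym)
  (Seq (While RB not_blank (Seq push_letter_code (Pop RB))) (Pop RA))).

Lemma exec_push_letter_code a r w c d :
  exec push_letter_code (St r (inl a :: w) c d) 20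
    (St (letter_code a ++ r) (inl a :: w) c d).
Proof.
case: a => [[]|[]].
- apply: exec_eq (EIfF _ _ (EIfF _ _ (EIfT _ _ (ESeq (exec_pushA _ _ _ _ _)
    (ESeq (exec_pushA _ _ _ _ _) (ESeq (exec_pushA _ _ _ _ _)
      (exec_pushA _ _ _ _ _))))))) _ _ => //.
- by apply: exec_eq (EIfF _ _ (EIfF _ _ (EIfF _ _ (ESeq (exec_pushA _ _ _ _ _)
    (exec_pushA _ _ _ _ _))))) _ _.
- by apply: exec_eq (EIfT _ _ (exec_pushA _ _ _ _ _)) _ _.
- by apply: exec_eq (EIfF _ _ (EIfT _ _ (exec_pushA _ _ _ _ _))) _ _.
Qed.

(** The first loop reverses the word onto [RB], so the second restores the order while expanding
    letters. Popping the leading [node_sym] exposes the code of the tree; the [leaf_sym] pushed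
    beforehand remains below it. *)
Lemma exec_parse w t : represents w t ->
  exec parse (St [seq inl a | a <- w] [::] [::] [::]) (40 * size w + 40)
    (St (code t ++ [:: leaf_sym]) [::] [::] [::]).
Proof.
move=> Hw.
have H1 u s : exec (While RA not_blank (Seq (Push RB RA copy_top) (Pop RA)))
    (St [seq inl a | a <- u] s [::] [::]) (5 * size u + 1)
    (St [::] (rev [seq inl a | a <- u] ++ s) [::] [::]).
  elim: u s => [|a u IH] s; first exact: EWhileF.
  rewrite rev_cons cat_rcons; apply: exec_eq (EWhileT _ _ (IH _)) _ _ => //.
    by apply: ESeq (exec_popA _ _ _ _ _); apply: EPush.
  by rewrite /=; lia.
have H2 u r : exec (While RB not_blank (Seq push_letter_code (Pop RB)))
    (St r (rev [seq inl a | a <- u]) [::] [::]) (25 * size u + 1)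
    (St (word_code u ++ r) [::] [::] [::]).
  elim/last_ind: u r => [|u a IH] r; first exact: EWhileF.
  rewrite map_rcons rev_rcons /word_code map_rcons flatten_rcons -catA.
  apply: exec_eq (EWhileT _ _ (IH _)) _ _ => //.
    apply: ESeq (exec_push_letter_code _ _ _ _ _) _.
    exact: exec_popB.
  by rewrite size_rcons; lia.
have H3 := H2 w [:: leaf_sym]; rewrite Hw in H3.
have {}H1 := H1 w [::]; rewrite cats0 in H1.
apply: exec_eq (ESeq H1 (ESeq (exec_pushA _ _ _ _ _) (ESeq H3
  (exec_popA _ _ _ _ _)))) _ _ => //.
by lia.
Qed.

Lemma size_represents w t : represents w t -> size (code t) <= 4 * size w.
Proof.
move=> /(congr1 size) /= E; apply: leq_trans (leqnSn _) _; rewrite -E {E}.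
elim: w => //= a w IH; rewrite /word_code /= size_cat mulnS.
by apply: leq_add => //; case: a => [[]|[]].
Qed.

Lemma FP_poly_time I A {eA : encodable A} (enc_word : I -> seq letter)
    (data : I -> A) (f : A -> bool) (yes : I -> Prop) :
  FP f -> (forall x, represents (enc_word x) (enc (data x))) ->
  (forall x, f (data x) = true <-> yes x) ->
  poly_time_solvable enc_word yes.
Proof.
move=> [c [q [pq Hf]]] Hrep Hyes.
pose T n := (40 * n + 40 + q (4 * n)).+1.
have [Q EQ] : polyb T.
  by have := polyb_add (polyb_add (polyb_add (polyb_mul (polyb_const 40) polyb_id)
    (polyb_const 40)) (polyb_comp pq (polyb_mul (polyb_const 4) polyb_id)))
    (polyb_const 1); case=> P HP; exists P => n; rewrite -HP /T addn1.
exists (machine (compile (Seq parse c) 0)), Q => x; exists (f (data x)).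
split=> //; rewrite -EQ /T.
have [_ /(_ [:: leaf_sym] [::] [::] [::]) e2] := Hf (data x).
have e12 : exec (Seq parse c) (St [seq inl a | a <- enc_word x] [::] [::] [::])
    (40 * size (enc_word x) + 40 + q (4 * size (enc_word x)))
    (St (code (enc (f (data x))) ++ [:: leaf_sym]) [::] [::] [::]).
  apply: exec_eq (ESeq (exec_parse (Hrep x)) e2) _ _ => //.
  by rewrite leq_add2l; apply: polyb_mono => //; apply: size_represents.
have := exec_answers e12.
by case: (f (data x)).
Qed.

(** * Correctness of the feasibility test *)

Section Correctness.
Variable p : nat.
Local Open Scope ring_scope.
Notation F := ('F_p).
Implicit Types (L : seq (seq F)) (v : seq F) (w z : nat -> F).

(* Vectors are extended by zeros to functions on [nat]. *)
Inductive lspan L : (nat -> F) -> Prop :=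
| lspan0 : lspan L (fun _ => 0)
| lspan_add c v w : v \in L -> lspan L w -> lspan L (fun j => c * v`_j + w j).

Lemma lspan_lin L c w z : lspan L w -> lspan L z ->
  lspan L (fun j => c * w j + z j).
Proof.
move=> Hw Hz; elim: Hw => [|c' v w' vL _ IH].
  by move: Hz; congr lspan; apply: boolp.funext => j; rewrite mulr0 add0r.
have -> : (fun j => c * (c' * v`_j + w' j) + z j) =
    fun j => (c * c') * v`_j + (c * w' j + z j).
  by apply: boolp.funext => j; ring.
exact: lspan_add.
Qed.

Lemma lspan_scale L c w : lspan L w -> lspan L (fun j => c * w j).
Proof.
move=> Hw; have := lspan_lin c Hw (lspan0 L).
by congr lspan; apply: boolp.funext => j; rewrite addr0.
Qed.

Lemma lspan_mem L v : v \in L -> lspan L (nth 0 v).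
Proof.
move=> vL; have := lspan_add 1 vL (lspan0 L).
by congr lspan; apply: boolp.funext => j; rewrite mul1r addr0.
Qed.

Lemma lspan_ind_lin L (P : (nat -> F) -> Prop) :
  P (fun _ => 0) -> (forall c w z, P w -> P z -> P (fun j => c * w j + z j)) ->
  (forall v, v \in L -> P (nth 0 v)) -> forall w, lspan L w -> P w.
Proof. by move=> P0 PD PL w; elim=> // c v w' vL _; apply: PD; apply: PL. Qed.

Lemma lspan_cat L1 L2 w : lspan (L1 ++ L2) w <->
  exists w1 w2, [/\ lspan L1 w1, lspan L2 w2 & w = fun j => w1 j + w2 j].
Proof.
split=> [|[w1 [w2 [H1 H2 ->]]]].
  move: w; apply: lspan_ind_lin => [|c w z [w1 [w2 [H1 H2 ->]]] [z1 [z2 [H3 H4 ->]]]|v].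
  - exists (fun=> 0), (fun=> 0); split; try exact: lspan0.
    by apply: boolp.funext => j; rewrite addr0.
  - exists (fun j => c * w1 j + z1 j), (fun j => c * w2 j + z2 j).
    split; try exact: lspan_lin.
    by apply: boolp.funext => j; ring.
  - rewrite mem_cat => /orP[] vL.
      exists (nth 0 v), (fun=> 0); split; [exact: lspan_mem | exact: lspan0 |].
      by apply: boolp.funext => j; rewrite addr0.
    exists (fun=> 0), (nth 0 v); split; [exact: lspan0 | exact: lspan_mem |].
    by apply: boolp.funext => j; rewrite add0r.
have sub L L' z : {subset L <= L'} -> lspan L z -> lspan L' z.
  move=> sLL'; move: z; apply: lspan_ind_lin => [|c w3 z Hw Hz|v /sLL'].
  - exact: lspan0.
  - exact: lspan_lin.
  - exact: lspan_mem.
have -> : (fun j => w1 j + w2 j) = fun j => 1 * w1 j + w2 j.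
  by apply: boolp.funext => j; rewrite mul1r.
by apply: lspan_lin; [apply: sub H1 | apply: sub H2] => v vL;
  rewrite mem_cat vL ?orbT.
Qed.

Lemma lspan_map (g : seq F -> seq F) (f : (nat -> F) -> nat -> F) L w :
  (forall j, f (fun=> 0) j = 0) ->
  (forall c w z j, f (fun i => c * w i + z i) j = c * f w j + f z j) ->
  (forall v, v \in L -> nth 0 (g v) = f (nth 0 v)) ->
  lspan (map g L) w <-> exists2 z, lspan L z & w = f z.
Proof.
move=> f0 fD fL; split.
  move: w; apply: lspan_ind_lin => [|c w z [w' Hw ->] [z' Hz ->]|v /mapP[u uL ->]].
  - exists (fun=> 0); first exact: lspan0.
    by apply: boolp.funext => j; rewrite f0.
  - exists (fun j => c * w' j + z' j); first exact: lspan_lin.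
    by apply: boolp.funext => j; rewrite fD.
  - by exists (nth 0 u); [exact: lspan_mem | rewrite fL].
case=> z Hz ->; move: z Hz; apply: lspan_ind_lin => [|c w' z Hw Hz|v vL].
- have -> : f (fun=> 0) = fun=> 0 by apply: boolp.funext.
  exact: lspan0.
- have -> : f (fun j => c * w' j + z j) = fun j => c * f w' j + f z j.
    by apply: boolp.funext.
  exact: lspan_lin.
- by rewrite -fL //; apply: lspan_mem; apply: map_f.
Qed.

Definition wf (n : nat) L := all (fun v => size v == n) L.

Lemma lspan_default m L z j : wf m L -> lspan L z -> (m <= j)%N -> z j = 0.
Proof.
move=> /allP HL Hz le; move: z Hz.
apply: lspan_ind_lin => [|c w z -> ->|v /HL /eqP sv] //; first by ring.
by rewrite nth_default // sv.
Qed.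

Definition shift (m : nat) w (j : nat) : F := if (j < m)%N then 0 else w (j - m)%N.

Lemma head_nth0 v : head 0 v = v`_0. Proof. by case: v. Qed.

Lemma nth_elim_vec (u v : seq F) j : size u = size v ->
  (elim_vec u v)`_j = v`_j.+1 - v`_0 / u`_0 * u`_j.+1.
Proof.
move=> Es; rewrite /elim_vec nth_behead !head_nth0.
have [lt|le] := ltnP j.+1 (size v).
  by rewrite (nth_map (0, 0)) ?size_zip ?Es ?minnn // nth_zip.
have le' : (size u <= j.+1)%N by rewrite Es.
rewrite (nth_default 0 le) (nth_default 0 le') mulr0 subr0.
by rewrite nth_default // size_map size_zip Es minnn.
Qed.

(** [elim_vec u] is induced by a linear map that subtracts a multiple of the pivot, hence stays in
    the span, and that only drops the first coordinate when this coordinate is already 0. *)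
Lemma elim_span n L w : wf n.+1 L ->
  wf n (elim L) /\ (lspan (elim L) w <-> lspan L (shift 1 w)).
Proof.
move=> /allP HL; rewrite /elim; set P := [seq v <- L | _].
have [nP|nP] := boolP (nilp P).
  have L0 v : v \in L -> v`_0 = 0.
    move=> vL; apply/eqP; apply: contraT => v0.
    have : v \in P by rewrite mem_filter head_nth0 v0.
    by case: (P) nP.
  split.
    by rewrite /wf all_map; apply/allP => v /HL /= /eqP; rewrite size_behead => ->.
  have Hm := lspan_map (g := behead) (f := fun w j => w j.+1) (L := L) w.
  rewrite Hm // => {Hm}; last first.
    by move=> v _; apply: boolp.funext => j; rewrite nth_behead.
  split=> [[z Hz ->]|Hw]; last first.
    by exists (shift 1 w) => //; apply: boolp.funext => j; rewrite /shift /= subn1.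
  suff -> : shift 1 (fun j => z j.+1) = z by [].
  have z0 : z 0%N = 0.
    move: z Hz; apply: lspan_ind_lin => // c w' z -> ->; ring.
  by apply: boolp.funext => -[|j]; rewrite /shift //= subn1.
have [u [uL u0 ->]] : exists u, [/\ u \in L, u`_0 != 0 & head [::] P = u].
  case EP: P nP => [|u P'] // _; exists u; have : u \in P by rewrite EP mem_head.
  by rewrite mem_filter head_nth0 => /andP[].
have su := HL u uL.
split.
  rewrite /wf all_map; apply/allP => v /HL /= sv.
  by rewrite size_behead size_map size_zip (eqP sv) (eqP su) minnn.
have Hm := lspan_map (g := elim_vec u)
  (f := fun w j => w j.+1 - w 0%N / u`_0 * u`_j.+1) (L := L) w.
rewrite Hm => {Hm}; last first.
- move=> v vL; apply: boolp.funext => j; rewrite nth_elim_vec //.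
  by rewrite (eqP su) (eqP (HL v vL)).
- by move=> c w' z j; ring.
- by move=> j; ring.
split=> [[z Hz ->]|Hw].
  have := lspan_lin (- (z 0%N / u`_0)) (lspan_mem uL) Hz.
  congr lspan; apply: boolp.funext => -[|j]; rewrite /shift /=.
    by rewrite mulNr divfK // addNr.
  by rewrite subn1 /=; ring.
exists (shift 1 w) => //; apply: boolp.funext => j.
by rewrite /shift /= subn1 mul0r mul0r subr0.
Qed.

Lemma elims_span (A : Type) (s : seq A) n L w : wf (size s + n) L ->
  wf n (foldl (fun L _ => elim L) L s) /\
  (lspan (foldl (fun L _ => elim L) L s) w <-> lspan L (shift (size s) w)).
Proof.
elim: s L => [|a s IH] L HL /=.
  by split=> //; have -> : shift 0 w = w by
    apply: boolp.funext => j; rewrite /shift /= subn0.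
have [H1 _] := elim_span w HL; have [H2 E2] := IH _ H1; split=> //.
rewrite E2; have [_ ->] := elim_span (shift (size s) w) HL.
have -> // : shift 1 (shift (size s) w) = shift (size s).+1 w.
apply: boolp.funext => -[|j]; rewrite /shift //= ltnS subn1 subSS.
by case: ltnP.
Qed.

Lemma nth_lookup (vars : seq (seq bool)) v k :
  uniq vars -> size v = size vars -> k \in vars ->
  lookup k (zip vars v) = v`_(index k vars).
Proof.
move=> Uv; rewrite /lookup; move: 0 {2}0 => x y.
elim: vars v x Uv => // k' vars IH [|a v] x //= /andP[nk Uv] [Es].
rewrite inE [k == k']eq_sym.
have [Ek _|ne] /= := eqVneq k' k; last exact: IH.
rewrite {}Ek in nk.
have : k \notin [seq kv.1 | kv <- zip vars v].
  by rewrite -/(unzip1 _) unzip1_zip ?Es.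
elim: (zip vars v) a => [|kv l IHl] a //=; rewrite inE negb_or eq_sym.
by move=> /andP[/negPf -> /IHl]; apply.
Qed.

Section Feasible.
Variable vars : seq (seq bool).
Hypothesis vars_uniq : uniq vars.
Let n := size vars.

Definition hom_tuples (c : constr p) : seq (seq F) := [seq 1 :: t | t <- c.1].

Definition scope_val w (c : constr p) : seq F :=
  w 0%N :: [seq w (index k vars).+1 | k <- c.2].

(* The last condition says that the relation is an affine subspace. *)
Definition ok_constr (c : constr p) : Prop :=
  [/\ all (fun t => size t == size c.2) c.1, {subset c.2 <= vars} &
    forall t, size t = size c.2 -> lspan (hom_tuples c) (nth 0 (1 :: t)) ->
      t \in c.1].

(** By [elims_span], the new span consists of the [w] that become members of the span of [extend]
    when preceded by zeros. Splitting such a vector along the two kinds of generators, the tail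
    identifies the first part as [w] itself, and the vanishing front says that its scope values are
    in the span of the tuples. *)
Lemma add_constr_span L c w : wf n.+1 L -> ok_constr c ->
  wf n.+1 (add_constr vars L c) /\
  (lspan (add_constr vars L c) w <->
   lspan L w /\ lspan (hom_tuples c) (nth 0 (scope_val w c))).
Proof.
move=> HL [Hsz Hsub _]; set k := size c.2.
have Hext : wf (k + n.+2) (extend vars c L).
  rewrite /wf /extend all_cat !all_map; apply/andP; split; apply/allP => v.
    by move=> /(allP HL) /eqP Ev; rewrite /= size_cat size_map Ev -/k !addnS.
  by move=> /(allP Hsz) /eqP Ev; rewrite /= size_cat /= size_map Ev !addnS.
have [H1 E1] := elims_span (shift 1 w) Hext.
have [H2 E2] := elim_span w H1; split=> //.
rewrite E2 E1 -/k {E1 E2 H1 H2 Hext}.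
have -> : shift k (shift 1 w) = shift k.+1 w.
  apply: boolp.funext => j; rewrite /shift.
  case: (ltnP j k) => [lt|le]; first by rewrite ltnS ltnW.
  by rewrite !ltnS leqn0 subn_eq0 subn1 -subnS.
pose f1 z j := if (j < k.+1)%N then (scope_val z c)`_j else z (j - k.+1)%N.
pose f2 z j := if (j < k.+1)%N then z j else 0 : F.
rewrite lspan_cat.
have M1 w1 := @lspan_map
  (fun v => (head 0 v :: [seq lookup k (zip vars (behead v)) | k <- c.2]) ++ v)
  f1 L w1.
have M2 w2 := @lspan_map (fun t => t ++ 0 :: [seq 0 | _ <- vars])
  f2 (hom_tuples c) w2.
have szk z : size (scope_val z c) = k.+1 by rewrite /= size_map.
have sv_lin a z z' j : (scope_val (fun i => a * z i + z' i) c)`_j =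
    a * (scope_val z c)`_j + (scope_val z' c)`_j.
  case: j => [|j] //=; have [lt|le] := ltnP j k.
    by rewrite !(nth_map [::]).
  by rewrite !nth_default ?size_map ?mulr0 ?addr0.
have whom : wf k.+1 (hom_tuples c).
  by rewrite /wf all_map; apply: sub_all Hsz => t /eqP /= ->.
rewrite /extend; set L1 := map _ L; set L2 := map _ c.1.
have EL2 : L2 = [seq t ++ 0 :: [seq 0 | _ <- vars] | t <- hom_tuples c].
  by rewrite /hom_tuples -map_comp.
rewrite EL2.
have N1 w1 : lspan L1 w1 <-> exists2 z, lspan L z & w1 = f1 z.
  apply: M1 => [j|a z z' j|v vL].
  - rewrite /f1; case: ifP => // _; case: j => [|j] //=.
    have [lt|le] := ltnP j k; first by rewrite (nth_map [::]).
    by rewrite nth_default ?size_map.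
  - by rewrite /f1; case: ifP => // _; apply: sv_lin.
  apply: boolp.funext => j; rewrite nth_cat /f1 /= size_map -/k.
  case: ifP => // _; rewrite head_nth0; congr (nth 0 _ j); congr cons.
  apply/eq_in_map => k' /Hsub k'v.
  rewrite nth_lookup // ?nth_behead // size_behead.
  by rewrite (eqP (allP HL _ vL)).
have N2 w2 : lspan [seq t ++ 0 :: [seq 0 | _ <- vars] | t <- hom_tuples c] w2
    <-> exists2 z, lspan (hom_tuples c) z & w2 = f2 z.
  apply: M2 => [j|a z z' j|v vL].
  - by rewrite /f2; case: ifP.
  - by rewrite /f2; case: ifP; rewrite // mulr0 addr0.
  apply: boolp.funext => j; rewrite nth_cat /f2.
  have -> : size v = k.+1.
    by case/mapP: vL => t /(allP Hsz) /eqP Et ->; rewrite /= Et.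
  case: ifP => // _; case: (j - k.+1)%N => //= i.
  have [lt|le] := ltnP i (size vars); first by rewrite (nth_map [::]).
  by rewrite nth_default ?size_map.
split=> [[w1 [w2 [/N1[z Hz ->] /N2[z' Hz' ->] E0]]]|].
  have E j : shift k.+1 w j = f1 z j + f2 z' j by rewrite E0.
  have Ew : w = z.
    apply: boolp.funext => j; have := E (k.+1 + j)%N.
    by rewrite /shift /f1 /f2 !ltnNge !leq_addr /= addKn addr0.
  split; first by rewrite Ew.
  have := lspan_scale (-1) Hz'; congr lspan; apply: boolp.funext => j.
  have [lt|le] := ltnP j k.+1; last first.
    rewrite nth_default ?szk // (lspan_default whom Hz' le); ring.
  have := E j; rewrite /shift /f1 /f2 lt Ew => /eqP.
  by rewrite eq_sym addr_eq0 => /eqP ->; rewrite mulN1r.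
case=> Hw Hc.
exists (f1 w), (f2 (fun j => -1 * (scope_val w c)`_j)); split.
- by apply/N1; exists w.
- by apply/N2; exists (fun j => -1 * (scope_val w c)`_j) => //; apply: lspan_scale.
apply: boolp.funext => j; rewrite /shift /f1 /f2.
by case: ifP => _; rewrite ?mulN1r ?subrr ?addr0.
Qed.

Lemma all_gens_span w : (forall j, (n < j)%N -> w j = 0) ->
  lspan (all_gens p vars) w.
Proof.
move=> w0.
pose g0 : seq F := 1 :: [seq 0 | _ <- vars].
pose gk (k : seq bool) : seq F := 0 :: [seq if k == k' then 1 else 0 | k' <- vars].
have Eg : all_gens p vars = g0 :: map gk vars by [].
have g0j j : g0`_j = (j == 0%N)%:R.
  case: j => //= j; have [lt|le] := ltnP j n; first by rewrite (nth_map [::]).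
  by rewrite nth_default ?size_map.
(* The unit vectors are added one variable at a time: [s] lists the variables whose coordinate is
   already in place. *)
have H s : uniq s -> {subset s <= vars} -> lspan (all_gens p vars) (fun j =>
    if j is j'.+1 then if (j' < n)%N && (nth [::] vars j' \in s) then w j else 0
    else w 0%N).
  elim: s => [_ _|k s IH /= /andP[nk Us] sub].
    have := lspan_scale (w 0%N) (lspan_mem (mem_head g0 (map gk vars))).
    rewrite -Eg; congr lspan; apply: boolp.funext => -[|j]; rewrite g0j.
      by rewrite mulr1.
    by rewrite andbF mulr0.
  have kv : k \in vars by apply: sub; rewrite mem_head.
  have gin : gk k \in all_gens p vars by rewrite Eg inE map_f ?orbT.
  have := lspan_add (w (index k vars).+1) gin (IH Us _).
  move=> /(_ (fun x xs => sub x (mem_behead (s := k :: s) xs))).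
  congr lspan; apply: boolp.funext => -[|j] /=; first by rewrite mulr0 add0r.
  have [lt|le] := ltnP j n; last first.
    by rewrite nth_default ?size_map // mulr0 addr0.
  rewrite (nth_map [::]) //= inE [in RHS]eq_sym; have [Ek|ne] /= := eqVneq.
    by rewrite Ek index_uniq // -Ek (negPf nk) mulr1 addr0.
  by rewrite mulr0 add0r.
have := H vars vars_uniq (fun x => id).
congr lspan; apply: boolp.funext => -[|j] //.
by have [lt|le] := ltnP j n; [rewrite mem_nth | rewrite w0].
Qed.

Lemma gens_span cs w : (forall c, c \in cs -> ok_constr c) ->
  (forall j, (n < j)%N -> w j = 0) ->
  wf n.+1 (gens vars cs) /\
  (lspan (gens vars cs) w <->
   forall c, c \in cs -> lspan (hom_tuples c) (nth 0 (scope_val w c))).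
Proof.
move=> ok w0; rewrite /gens.
elim/last_ind: cs ok => [|cs c IH] ok.
  split; last by split=> // _; apply: all_gens_span.
  by apply/allP => v; rewrite inE => /predU1P[->|/mapP[k _ ->]];
    by rewrite /= size_map.
rewrite foldl_rcons; have [|H1 E1] := IH.
  by move=> c' c's; apply: ok; rewrite mem_rcons inE c's orbT.
have okc : ok_constr c by apply: ok; rewrite mem_rcons mem_head.
have [H2 E2] := add_constr_span w H1 okc; split=> //; rewrite E2 E1.
split=> [[Hs Hc] c'|Hs].
  by rewrite mem_rcons inE => /predU1P[->|/Hs].
split=> [c' c's|]; apply: Hs; rewrite mem_rcons ?mem_head //.
by rewrite inE c's orbT.
Qed.

(** A generator with nonzero first coordinate can be scaled to first coordinate 1 and is then a
    solution. Conversely a solution gives a vector of the span with first coordinate 1, so not all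
    generators have first coordinate 0. *)
Lemma feasP cs : (forall c, c \in cs -> ok_constr c) ->
  reflect (exists x : seq bool -> F,
             forall c, c \in cs -> [seq x k | k <- c.2] \in c.1)
          (feas vars cs).
Proof.
move=> ok; apply: (iffP hasP) => [[v vG v0]|[x Hx]].
  rewrite head_nth0 in v0.
  pose w j := (v`_0)^-1 * v`_j.
  have Hw : lspan (gens vars cs) w by apply: lspan_scale; apply: lspan_mem.
  have w0 j : (n < j)%N -> w j = 0.
    move=> lt; apply: lspan_default Hw lt.
    by have [] := gens_span (w := fun=> 0) ok (fun _ _ => erefl).
  exists (fun k => w (index k vars).+1) => c cc.
  have [_ /iffLR /(_ Hw) /(_ c cc)] := gens_span ok w0.
  rewrite /scope_val {1}/w mulVf // => Hc.
  by have [_ _] := ok c cc; apply; rewrite ?size_map.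
pose w := nth 0 (1 :: [seq x k | k <- vars]).
have w0 j : (n < j)%N -> w j = 0.
  by move=> lt; rewrite /w nth_default //= size_map.
have [_ E] := gens_span ok w0.
have : lspan (gens vars cs) w.
  apply/E => c cc; have [_ sub _] := ok c cc.
  apply: lspan_mem; apply/mapP; exists [seq x k | k <- c.2]; first exact: Hx.
  congr cons; apply/eq_in_map => k /sub kv.
  by rewrite /w /= (nth_map [::]) ?index_mem // nth_index.
move=> Hw; have : w 0%N != 0 by rewrite oner_eq0.
have [/hasP[v vG v0] _|/hasPn no] := boolP (has (fun v => head 0 v != 0) (gens vars cs)).
  by exists v.
suff -> : w 0%N = 0 by rewrite eqxx.
move: (w) Hw; apply: lspan_ind_lin => [|c z z' -> ->|v /no] //; first by ring.
by rewrite head_nth0 negbK => /eqP.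
Qed.

End Feasible.
End Correctness.

(** * Averages over the solutions *)

Section Weight.
Variables (p d : nat) (vars : seq (seq bool)).
Hypotheses (p_prime : prime p) (vars_uniq : uniq vars).
Notation F := ('F_p).
Notation point := ((size vars).-tuple F).
Implicit Types (x y z : point) (c : constr p) (cs : seq (constr p)).

Definition var_val x (k : seq bool) : F := nth 0%R x (index k vars).

Definition sat cs : {set point} :=
  [set x | all (fun c => [seq var_val x k | k <- c.2] \in c.1) cs].

Definition all_ok cs := forall c, c \in cs -> ok_constr vars c.

Lemma all_ok_cons c cs : all_ok (c :: cs) <-> ok_constr vars c /\ all_ok cs.
Proof.
split=> [H|[Hc H] c']; last by rewrite inE => /predU1P[->|/H].
by split=> [|c' c's]; apply: H; rewrite inE ?eqxx ?c's ?orbT.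
Qed.

Lemma feas_sat cs : all_ok cs -> feas vars cs = (sat cs != set0).
Proof.
move=> ok; apply/(feasP vars_uniq ok)/set0Pn => [[x Hx]|[x]]; last first.
  by rewrite inE => /allP Hx; exists (var_val x) => c /Hx.
exists (map_tuple x (in_tuple vars)); rewrite inE; apply/allP => c cc.
have [_ sub _] := ok c cc.
suff -> : [seq var_val (map_tuple x (in_tuple vars)) k | k <- c.2] =
    [seq x k | k <- c.2] by apply: Hx.
apply/eq_in_map => k /sub kv.
by rewrite /var_val (nth_map [::]) ?index_mem // nth_index.
Qed.

Lemma ok_fix_var k (a : F) : k \in vars -> ok_constr vars (fix_var k a).
Proof.
move=> kv; split=> [|k'|[|b []] // _ Hs] //=; first by rewrite inE => /eqP ->.
have H w : lspan (hom_tuples (fix_var k a)) w -> w 1 = (a * w 0)%R.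
  move: w; apply: lspan_ind_lin => [|c w z -> ->|v]; try by rewrite /=; ring.
  by rewrite inE => /eqP -> /=; rewrite mulr1.
by have /= -> := H _ Hs; rewrite mulr1 mem_head.
Qed.

Lemma sat_cons c cs x :
  (x \in sat (c :: cs)) = ([seq var_val x k | k <- c.2] \in c.1) && (x \in sat cs).
Proof. by rewrite !inE. Qed.

Lemma sat_fix_var k a cs x :
  (x \in sat (fix_var k a :: cs)) = (var_val x k == a) && (x \in sat cs).
Proof. by rewrite sat_cons /= inE eqseq_cons andbT. Qed.

Definition affine_comb x y z : point :=
  [tuple (tnth x i - tnth y i + tnth z i)%R | i < size vars].

Lemma var_val_affine x y z k : k \in vars ->
  var_val (affine_comb x y z) k = (var_val x k - var_val y k + var_val z k)%R.
Proof.
rewrite -index_mem => lt; rewrite /var_val.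
by rewrite -!(tnth_nth _ _ (Ordinal lt)) tnth_mktuple.
Qed.

(** The homogenizing coordinate of the combination is 1 - 1 + 1 = 1, so the affine closure in
    [ok_constr] applies. *)
Lemma sat_affine cs x y z : all_ok cs ->
  x \in sat cs -> y \in sat cs -> z \in sat cs -> affine_comb x y z \in sat cs.
Proof.
move=> ok; rewrite !inE => /allP Hx /allP Hy /allP Hz; apply/allP => c cc.
have [Hs sub aff] := ok c cc.
have Et u : [seq var_val u k | k <- c.2] \in c.1 ->
    lspan (hom_tuples c) (nth 0%R (1%R :: [seq var_val u k | k <- c.2])).
  by move=> uc; apply: lspan_mem; apply: map_f.
apply: aff; first by rewrite size_map.
have := lspan_lin 1 (lspan_lin (-1) (Et _ (Hy c cc)) (Et _ (Hx c cc)))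
  (Et _ (Hz c cc)).
congr lspan; apply: boolp.funext => -[|j] /=; first by ring.
have [lt|le] := ltnP j (size c.2); last first.
  by rewrite !nth_default ?size_map //; ring.
rewrite !(nth_map [::]) // var_val_affine; first by ring.
by apply: sub; apply: mem_nth.
Qed.

(* If [y] and [z] lie in two fibres, then [x |-> x - y + z] maps the fibre of *)
(* [y] to the fibre of [z].                                                   *)
Lemma card_fibres cs k a b : all_ok cs -> k \in vars ->
  sat (fix_var k a :: cs) != set0 -> sat (fix_var k b :: cs) != set0 ->
  #|sat (fix_var k a :: cs)| = #|sat (fix_var k b :: cs)|.
Proof.
move=> ok kv.
have le a' b' : sat (fix_var k a' :: cs) != set0 ->
    sat (fix_var k b' :: cs) != set0 ->
    #|sat (fix_var k a' :: cs)| <= #|sat (fix_var k b' :: cs)|.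
  case/set0Pn => y; rewrite sat_fix_var => /andP[/eqP ya yc].
  case/set0Pn => z; rewrite sat_fix_var => /andP[/eqP zb zc].
  have inj : injective (fun x => affine_comb x y z).
    move=> x x' /(congr1 (fun t => fun i => tnth t i)) E.
    apply: eq_from_tnth => i; have := congr1 (fun g => g i) E.
    by rewrite /= !tnth_mktuple => /addIr/addIr.
  rewrite -(card_imset _ inj); apply: subset_leq_card; apply/subsetP.
  move=> _ /imsetP[x + ->]; rewrite sat_fix_var => /andP[/eqP xa xc].
  rewrite sat_fix_var var_val_affine // xa ya zb subrr add0r eqxx.
  exact: sat_affine.
by move=> Ha Hb; apply/eqP; rewrite eqn_leq !le.
Qed.

Definition power_val x (km : seq bool * seq bool) : nat :=
  nat_of_ord (var_val x km.1) ^ bval km.2.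

Lemma sum_fibres cs k (f : point -> nat) :
  \sum_(x in sat cs) f x =
  \sum_(a <- enum F) \sum_(x in sat (fix_var k a :: cs)) f x.
Proof.
rewrite big_enum /= (partition_big (fun x => var_val x k) predT) //=.
by apply: eq_bigr => a _; apply: eq_bigl => x; rewrite sat_fix_var andbC.
Qed.

(** Split the sum along the fibres of the first variable. If [K] fibres are inhabited, each has the
    same number [r] of points and there are [r * K] solutions in all; [K] is at most [p], so it
    divides the factorial and [fact_div] is an exact quotient. *)
Lemma weightP e cs T : all_ok cs -> size T <= e ->
  (forall km, km \in T ->
     km.1 \in vars /\ km.2 \in [seq nat_bits i | i <- iota 0 d.+1]) ->
  p`! ^ e * \sum_(x in sat cs) \prod_(km <- T) power_val x km =
  #|sat cs| * weight d e vars cs T.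
Proof.
elim: e cs T => [|e IH] cs T ok.
  by case: T => // _ _; under eq_bigr do rewrite big_nil; rewrite sum1_card mul1n muln1.
case: T => [_ _|[k m] T leT HT].
  rewrite expnS -mulnA IH //=.
  by rewrite mulnCA.
have [kv mt] := HT _ (mem_head _ _).
have {}HT km : km \in T ->
    km.1 \in vars /\ km.2 \in [seq nat_bits i | i <- iota 0 d.+1].
  by move=> kmT; apply: HT; rewrite inE kmT orbT.
have okf a : all_ok (fix_var k a :: cs).
  by apply/all_ok_cons; split=> //; apply: ok_fix_var.
pose Nf a := #|sat (fix_var k a :: cs)|.
have feasE a : feas vars (fix_var k a :: cs) = (0 < Nf a).
  by rewrite feas_sat // card_gt0.
rewrite [weight _ _ _ _ _]/=; set K := size [seq a <- enum F | _].
have EK : K = \sum_(a <- enum F | 0 < Nf a) 1.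
  by rewrite /K size_filter -sum1_count; apply: eq_bigl => a; rewrite feasE.
have EN : #|sat cs| = \sum_(a <- enum F | 0 < Nf a) Nf a.
  rewrite -sum1_card (sum_fibres _ k) [RHS]big_mkcond /=.
  by apply: eq_bigr => a _; rewrite sum1_card -/(Nf a); case: posnP.
have Esum : p`! ^ e.+1 * \sum_(x in sat cs)
      \prod_(km <- (k, m) :: T) power_val x km =
    p`! * \sum_(a <- enum F | 0 < Nf a)
      nat_of_ord a ^ bval m * (Nf a * weight d e vars (fix_var k a :: cs) T).
  rewrite (sum_fibres _ k) expnS -mulnA big_distrr /=; congr (_ * _).
  rewrite [RHS]big_mkcond /=; apply: eq_bigr => a _.
  have -> : \sum_(x in sat (fix_var k a :: cs))
        \prod_(km <- (k, m) :: T) power_val x km =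
      nat_of_ord a ^ bval m *
        \sum_(x in sat (fix_var k a :: cs)) \prod_(km <- T) power_val x km.
    rewrite big_distrr /=; apply: eq_bigr => x.
    by rewrite sat_fix_var big_cons => /andP[/eqP <- _].
  rewrite -(IH (fix_var k a :: cs) T (okf a) leT HT) mulnCA.
  case: posnP => // N0.
  by rewrite /Nf in N0; rewrite (cards0_eq N0) big_set0 !muln0.
rewrite Esum.
have EW : sumn [seq if feas vars (fix_var k a :: cs)
      then pow_digit d a m * weight d e vars (fix_var k a :: cs) T else 0
      | a <- enum F] =
    \sum_(a <- enum F | 0 < Nf a)
      nat_of_ord a ^ bval m * weight d e vars (fix_var k a :: cs) T.
  rewrite sumnE big_map [RHS]big_mkcond /=; apply: eq_bigr => a _.
  by rewrite feasE /pow_digit mt.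
rewrite EW.
have [r Hr] : exists r, forall a, 0 < Nf a -> Nf a = r.
  case: (pickP (fun a : F => 0 < Nf a)) => [a Na|no]; last first.
    by exists 0 => a; rewrite no.
  by exists (Nf a) => b Nb; apply: card_fibres => //; rewrite -card_gt0.
have EN' : #|sat cs| = r * K.
  by rewrite EN EK big_distrr /=; apply: eq_bigr => a /Hr ->; rewrite muln1.
have -> : \sum_(a <- enum F | 0 < Nf a)
      nat_of_ord a ^ bval m * (Nf a * weight d e vars (fix_var k a :: cs) T) =
    r * \sum_(a <- enum F | 0 < Nf a)
      nat_of_ord a ^ bval m * weight d e vars (fix_var k a :: cs) T.
  by rewrite big_distrr /=; apply: eq_bigr => a /Hr ->; rewrite mulnCA.
set S := \sum_(a <- _ | _) _ * weight _ _ _ _ _.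
have leK : K <= p.
  rewrite /K size_filter; apply: (leq_trans (count_size _ _)).
  by rewrite -cardE card_Fp.
have [K0|Kpos] := posnP K.
  have -> : S = 0.
    rewrite /S; apply: big1_seq => a /andP[Na _]; move: K0.
    by rewrite EK big_mkcond (bigD1_seq a) ?mem_enum ?enum_uniq //= Na.
  by rewrite !muln0.
have -> : fact_div p K = p`! %/ K by rewrite /fact_div mem_iota /= add0n ltnS leK.
have dvK : K %| p`! by apply: dvdn_fact; rewrite Kpos.
by rewrite EN' -mulnA [K * _]mulnA [K * _]mulnC divnK // mulnCA.
Qed.

End Weight.

(** * Correctness of the binary arithmetic *)

Lemma bval_rcons s b : bval (rcons s b) = bval s + 2 ^ size s * b.
Proof.
elim: s => [|a s IH] /=; first by rewrite muln0 addn0 add0n mul1n.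
by rewrite IH expnS; lia.
Qed.

(** Invariant of the adder: digits already written, plus the carry and unread digits at the current
    power of 2, account for the digits consumed. *)
Lemma add_stepP e st :
  bval (rev (add_step st e).2.2) + 2 ^ size (add_step st e).2.2 *
    ((add_step st e).2.1 + bval (add_step st e).1) =
  bval (rev st.2.2) + 2 ^ size st.2.2 * (e + st.2.1 + bval st.1).
Proof.
case: st => [[|b r] [c acc]]; rewrite /add_step /= rev_cons bval_rcons size_rev
  expnS; by case: e; case: c; try case: b => /=; lia.
Qed.

Lemma bval_badd s t : bval (badd s t) = bval s + bval t.
Proof.
have H1 st : let st' := foldl add_step st s in
    bval (rev st'.2.2) + 2 ^ size st'.2.2 * (st'.2.1 + bval st'.1) =
    bval (rev st.2.2) + 2 ^ size st.2.2 * (st.2.1 + bval st.1 + bval s).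
  elim: s st => [|e s IH] st /=; first by rewrite addn0.
  rewrite IH mulnDr addnA add_stepP /= expnS -mulnA mulnCA -addnA -mulnDr.
  by congr (_ + _ * _); lia.
have H2 (l : seq bool) st : size st.1 = size l ->
    let st' := foldl (fun st _ => add_step st false) st l in
    bval (rev st'.2.2) + 2 ^ size st'.2.2 * st'.2.1 =
    bval (rev st.2.2) + 2 ^ size st.2.2 * (st.2.1 + bval st.1).
  elim: l st => [|e l IH] [r [c acc]] /= Es.
    by case: r Es => // _; rewrite addn0.
  rewrite IH /=; last by rewrite size_behead Es.
  by have /= -> := add_stepP false (r, (c, acc)); rewrite add0n.
rewrite /badd rev_cons bval_rcons size_rev H2 // H1 /=.
by rewrite expn0; lia.
Qed.

Lemma bval_bmul s t : bval (bmul s t) = bval s * bval t.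
Proof.
rewrite /bmul -{2}(revK s); elim/last_ind: (rev s) => [|u e IH] //.
rewrite foldl_rcons rev_rcons /= bval_badd /= IH.
by case: e => /=; lia.
Qed.

Lemma bval_bscale w s : bval (bscale w s) = w * bval s.
Proof.
rewrite /bscale; elim: w => // w IH.
by rewrite -addn1 nseqD foldl_cat /= bval_badd IH; lia.
Qed.

Lemma bval_eq0 s : (bval s == 0) = all negb s.
Proof. by elim: s => //= b s <-; case: b => /=; lia. Qed.

Lemma beqvE s t : beqv s t = (bval s == bval t).
Proof.
have H t' ok : (foldl beqv_step (t', ok) s).2 &&
    all negb (foldl beqv_step (t', ok) s).1 = ok && (bval s == bval t').
  elim: s t' ok => [|e s IH] t' ok /=; first by rewrite eq_sym bval_eq0.
  rewrite IH -andbA; congr (_ && _).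
  by case: t' => [|b t'] /=; case: e; try case: b => //=; lia.
exact: H.
Qed.

Lemma bval_nat_bits n : bval (nat_bits n) = n.
Proof.
have H k : bval [seq odd (n %/ 2 ^ i) | i <- iota 0 k] = n %% 2 ^ k.
  elim: k => [|k IH]; first by rewrite modn1.
  rewrite -[k.+1]addn1 iotaD map_cat /= cats1 bval_rcons IH size_map size_iota add0n.
  rewrite addn1 expnS [2 * _]mulnC.
  have En : n = n %/ 2 ^ k %/ 2 * (2 ^ k * 2) +
      (n %% 2 ^ k + 2 ^ k * odd (n %/ 2 ^ k)).
    rewrite {1}(divn_eq n (2 ^ k)) {1}(divn_eq (n %/ 2 ^ k) 2) modn2.
    by rewrite mulnDl addnAC -addnA -mulnA [2 * _]mulnC [odd _ * _]mulnC.
  rewrite [in RHS]En modnMDl [RHS]modn_small //.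
  have : n %% 2 ^ k < 2 ^ k by rewrite ltn_mod expn_gt0.
  move: (n %% 2 ^ k) (2 ^ k) (odd _) => r q [] /=; rewrite ?muln1 ?muln0 muln2 -addnn; lia.
rewrite H modn_small //; exact: trunc_log_ltn.
Qed.

Lemma nat_bits_inj : injective nat_bits.
Proof. exact: can_inj bval_nat_bits. Qed.

Lemma nat_bits0 n : (nat_bits n == [:: false]) = (n == 0).
Proof. by rewrite -[RHS](inj_eq nat_bits_inj). Qed.

Section ZeroSum.
Local Open Scope ring_scope.

Definition signed (a : seq bool) : rat :=
  (-1) ^+ head false a * (bval (behead a))%:R.

Definition entry_val (e : nat * (seq bool * seq bool)) : rat :=
  e.1%:R * (signed e.2.1 / (bval e.2.2)%:R).

(** After each step the fraction held by the state is the partial sum, with a nonzero denominator;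
    so only its two numerators have to be compared. *)
Lemma zero_sumE l :
  all (fun e => bval e.2.2 != 0)%N l ->
  zero_sum l = (\sum_(e <- l) entry_val e == 0).
Proof.
pose den (st : seq bool * (seq bool * seq bool)) := (bval st.2.2)%:R : rat.
pose num (st : seq bool * (seq bool * seq bool)) :=
  (bval st.1)%:R - (bval st.2.1)%:R : rat.
have H st : all (fun e => bval e.2.2 != 0)%N l -> den st != 0 ->
    let st' := foldl zero_step st l in
    den st' != 0 /\ num st' / den st' = num st / den st + \sum_(e <- l) entry_val e.
  elim: l st => [|[w [a b]] l IH] st /=; first by rewrite big_nil addr0.
  move=> /andP[b0 Hl] d0.
  have b0' : (bval b)%:R != 0 :> rat by rewrite pnatr_eq0.
  have d0' : den (zero_step st (w, (a, b))) != 0.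
    by rewrite /den /zero_step /= bval_bmul natrM mulf_neq0.
  have [d1 ->] := IH _ Hl d0'; split=> //; rewrite big_cons addrA; congr (_ + _).
  move: d0; rewrite /num /den /zero_step /= !bval_badd !bval_bmul /entry_val /=.
  rewrite /signed; case: (head _ _) => d0 /=;
    rewrite ?bval_bmul bval_bscale !(natrD, natrM) /=; field; apply/andP; split=> //.
move=> Hl; rewrite /zero_sum beqvE.
have [|/= d1] := H ([::], ([::], [:: true])) Hl; first by rewrite oner_eq0.
rewrite /num /= subrr mul0r add0r => <-.
by rewrite mulf_eq0 invr_eq0 (negPf d1) orbF subr_eq0 eqr_nat.
Qed.

End ZeroSum.

(** * Ideal membership and vanishing on the solutions *)

Section Ideal.
Local Open Scope ring_scope.

Lemma ideal_gen (A : comNzRingType) (gen : A -> Prop) (g : A) :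
  gen g -> generated_ideal gen g.
Proof.
by move=> Hg; exists 1%N, (fun=> 1), (fun=> g); rewrite big_ord1 mul1r.
Qed.

Lemma ideal0 (A : comNzRingType) (gen : A -> Prop) : generated_ideal gen 0.
Proof.
by exists 0%N, (fun=> 0), (fun=> 0); split; [case | rewrite big_ord0].
Qed.

Lemma ideal_mul (A : comNzRingType) (gen : A -> Prop) (h f : A) :
  generated_ideal gen f -> generated_ideal gen (h * f).
Proof.
move=> [r [k [g [Hg ->]]]]; exists r, (fun i => h * k i), g; split=> //.
by rewrite big_distrr /=; apply: eq_bigr => i _; rewrite mulrA.
Qed.

Lemma ideal_add (A : comNzRingType) (gen : A -> Prop) (f1 f2 : A) :
  generated_ideal gen f1 -> generated_ideal gen f2 ->
  generated_ideal gen (f1 + f2).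
Proof.
move=> [r1 [h1 [g1 [H1 ->]]]] [r2 [h2 [g2 [H2 ->]]]].
exists (r1 + r2)%N, (fun i => match split i with inl a => h1 a | inr b => h2 b end),
  (fun i => match split i with inl a => g1 a | inr b => g2 b end).
split; first by move=> i; case: (split i).
rewrite big_split_ord /=; congr (_ + _); apply: eq_bigr => i _.
  by have -> : split (lshift r2 i) = inl i by exact: (unsplitK (inl i)).
by have -> : split (rshift r1 i) = inr i by exact: (unsplitK (inr i)).
Qed.

Lemma ideal_sum (A : comNzRingType) (gen : A -> Prop) (I : finType)
    (P : pred I) (f : I -> A) :
  (forall i, P i -> generated_ideal gen (f i)) ->
  generated_ideal gen (\sum_(i | P i) f i).
Proof.
by move=> Hf; apply: big_ind => //; [apply: ideal0 | apply: ideal_add].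
Qed.

Section Csp.
Variables (R : realType) (p n : nat).
Notation F := ('F_p).
Notation dv := (@domain_val R p).
Implicit Types (x : {ffun 'I_n -> F}) (c : csp_constraint p n).

Lemma domain_val_inj : injective dv.
Proof. by move=> a b /eqP; rewrite /domain_val eqr_nat => /eqP /val_inj. Qed.

Definition lagrange_coef (b a : F) : R := (dv b - dv a)^-1.

Lemma lagrange_val (b y : F) :
  \prod_(a : F | a != b) (lagrange_coef b a * (dv y - dv a)) = (b == y)%:R.
Proof.
have [<-|ne] := eqVneq b y.
  rewrite big1 // => a ne; rewrite mulVf // subr_eq0.
  by apply: contraNneq ne => /domain_val_inj ->.
by rewrite (bigD1 y) 1?eq_sym //= subrr mulr0 mul0r.
Qed.

Definition satisfies x c : bool :=
  [tuple x (tnth (c_scope c) j) | j < c_arity c] \in c_rel c.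

Definition point_val x (i : 'I_n) : R := dv (x i).

Lemma constraint_poly_val x c :
  (constraint_poly R c).@[point_val x] = (~~ satisfies x c)%:R.
Proof.
pose u := [tuple x (tnth (c_scope c) j) | j < c_arity c].
have E t : (\prod_(j < c_arity c) \prod_(a : F | a != tnth t j)
      ((dv (tnth t j) - dv a)^-1 *:
         ('X_(tnth (c_scope c) j) - (dv a)%:MP))).@[point_val x] = (t == u)%:R.
  rewrite rmorph_prod /=.
  transitivity (\prod_(j < c_arity c) (tnth t j == tnth u j)%:R : R).
    apply: eq_bigr => j _; rewrite rmorph_prod /= -lagrange_val.
    apply: eq_bigr => a _.
    by rewrite mevalZ mevalB mevalXU mevalC tnth_mktuple.
  have [->|ne] := eqVneq t u; first by rewrite big1 // => j _; rewrite eqxx.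
  have [j nej] : exists j, tnth t j != tnth u j.
    apply/existsP; apply: contraR ne; rewrite negb_exists => /forallP H.
    by apply/eqP/eq_from_tnth => j; apply/eqP; move: (H j); rewrite negbK.
  by rewrite (bigD1 j) //= (negPf nej) mul0r.
rewrite /constraint_poly raddf_sum /=.
under eq_bigr => t _ do rewrite E.
rewrite /satisfies -/u; have [uR|nR] /= := boolP (u \in c_rel c).
  rewrite big1 // => t; rewrite inE => ntR.
  by case: eqP => // Et; rewrite Et uR in ntR.
rewrite (bigD1 u) ?inE //= eqxx big1 ?addr0 // => t /andP[_ /negPf ->] //.
Qed.

Lemma domain_poly_val x i : (domain_poly R p i).@[point_val x] = 0.
Proof.
rewrite /domain_poly rmorph_prod /= (bigD1 (x i)) //=.
by rewrite mevalB mevalXU mevalC subrr mul0r.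
Qed.

Definition lagrange_factor (b : F) (i : 'I_n) : {mpoly R[n]} :=
  \prod_(a : F | a != b) (lagrange_coef b a *: ('X_i - (dv a)%:MP)).

Definition lagrange x : {mpoly R[n]} := \prod_(i < n) lagrange_factor (x i) i.

(** In one variable, the sum minus 1 has degree less than the number of field elements and vanishes
    at all their values, hence is zero. The identity is then transported by substituting ['X_i]. *)
Lemma sum_lagrange_factor i : \sum_(b : F) lagrange_factor b i = 1.
Proof.
pose q : {poly R} := \sum_(b : F) \prod_(a : F | a != b)
  ((lagrange_coef b a)%:P * ('X - (dv a)%:P)) - 1.
have q0 : q = 0.
  apply: (roots_geq_poly_eq0 (rs := [seq dv a | a <- enum F])).
  - apply/allP => _ /mapP[y _ ->]; rewrite /root /q hornerD hornerN hornerC.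
    rewrite horner_sum (bigD1 y) //= horner_prod.
    under eq_bigr => a _ do rewrite hornerM hornerC hornerXsubC.
    rewrite lagrange_val eqxx big1 ?addr0 ?subrr // => b ne.
    rewrite horner_prod.
    under eq_bigr => a _ do rewrite hornerM hornerC hornerXsubC.
    by rewrite lagrange_val (negPf ne).
  - by rewrite map_inj_uniq ?enum_uniq //; apply: domain_val_inj.
  rewrite size_map -cardE.
  apply: (leq_trans (size_polyD _ _)); rewrite size_polyN size_poly1.
  rewrite geq_max; apply/andP; split; last by apply/card_gt0P; exists 0.
  apply: (leq_trans (size_sum _ _ _)); apply/bigmax_leqP => b _.
  apply: (leq_trans (size_poly_prod_leq _ _)).
  rewrite leq_subLR.
  have le2 : (\sum_(a : F | a != b) size ((lagrange_coef b a)%:P * ('X - (dv a)%:P))%R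
      <= \sum_(a : F | a != b) 2)%N.
    apply: leq_sum => a _; rewrite mul_polyC.
    by apply: (leq_trans (size_scale_leq _ _)); rewrite size_XsubC.
  have Ecard : #|F| = #|(fun a : F => a != b)|.+1.
    by rewrite (cardD1 b) inE add1n; congr _.+1; apply: eq_card => a; rewrite !inE andbT.
  rewrite sum_nat_const in le2.
  by rewrite Ecard addnS ltnS addnn -muln2.
have cu : commr_rmorph (@mpolyC n R) 'X_i by move=> a; apply: mulrC.
have := congr1 (horner_morph cu) q0.
rewrite /q rmorph0 rmorphB rmorph1 rmorph_sum /= => /eqP; rewrite subr_eq0 => /eqP <-.
apply: eq_bigr => b _; rewrite rmorph_prod /=; apply: eq_bigr => a _.
by rewrite rmorphM rmorphB /= !horner_morphC horner_morphX mul_mpolyC.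
Qed.

Lemma sum_lagrange : \sum_x lagrange x = 1.
Proof.
have := bigA_distr_bigA (fun (i : 'I_n) (b : F) => lagrange_factor b i).
rewrite /= => <-; rewrite big1 // => i _; exact: sum_lagrange_factor.
Qed.

Section Membership.
Variable gen : {mpoly R[n]} -> Prop.
Hypothesis gen_domain : forall i, gen (domain_poly R p i).
Notation ideal := (generated_ideal gen).

(** The factor ['X_i - x_i] is the one missing from the Lagrange product in the variable [i], so it
    completes the domain polynomial. *)
Lemma lagrange_root x i : ideal (('X_i - (point_val x i)%:MP) * lagrange x).
Proof.
rewrite /lagrange (bigD1 i) //=; set S := \prod_(j < n | _) _.
rewrite /lagrange_factor.
under eq_bigr => a _ do rewrite -mul_mpolyC.
rewrite big_split /=; set C := \prod_(a | _) _; set Q := \prod_(a | _) (_ - _).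
have -> : ('X_i - (point_val x i)%:MP) * (C * Q * S) =
    (C * S) * domain_poly R p i.
  by rewrite /domain_poly (bigD1 (x i)) //= -/Q /point_val; ring.
exact/ideal_mul/ideal_gen.
Qed.

(** The polynomials with this property contain the constants and, by [lagrange_root], the variables,
    and are closed under sums and products. *)
Lemma lagrange_eval x f :
  ideal ((f - (f.@[point_val x])%:MP) * lagrange x).
Proof.
pose P g := ideal ((g - (g.@[point_val x])%:MP) * lagrange x).
have PC a : P a%:MP by rewrite /P mevalC subrr mul0r; apply: ideal0.
have PX i : P 'X_i by rewrite /P mevalXU; apply: lagrange_root.
have PD g h : P g -> P h -> P (g + h).
  move=> Hg Hh; rewrite /P mevalD mpolyCD.
  have -> : g + h - (g.@[point_val x]%:MP + h.@[point_val x]%:MP) =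
    (g - g.@[point_val x]%:MP) + (h - h.@[point_val x]%:MP) by ring.
  by rewrite mulrDl; apply: ideal_add.
have PM g h : P g -> P h -> P (g * h).
  move=> Hg Hh; rewrite /P mevalM mpolyCM.
  set a := g.@[_]%:MP; set b := h.@[_]%:MP.
  have -> : (g * h - a * b) * lagrange x =
    h * ((g - a) * lagrange x) + a * ((h - b) * lagrange x) by ring.
  by apply: ideal_add; apply: ideal_mul.
rewrite -/(P f); elim/mpolyind: f => [|a m g _ _ Pg].
  by have := PC 0; rewrite mpolyC0.
apply: (PD) => //; rewrite -mul_mpolyC; apply: (PM) => //.
rewrite mpolyXE_id; apply: big_ind => [||i _].
- by have := PC 1; rewrite mpolyC1.
- exact: PM.
elim: (m i) => [|k IH]; first by have := PC 1; rewrite mpolyC1.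
by rewrite exprS; apply: PM.
Qed.

End Membership.
End Csp.

(** Write [f] as the sum of the [f * lagrange x] over the grid. At a solution, [f * lagrange x] is
    congruent to a multiple by the value 0; at any other point, [lagrange x] is itself in the
    ideal. *)
Lemma csp_idealP (R : realType) (p : nat) (G : constraint_language p)
    (P : csp_instance G) (f : {mpoly R[csp_nvars P]}) :
  csp_ideal f <->
  forall x : {ffun 'I_(csp_nvars P) -> 'F_p},
    (forall i, satisfies x (tnth (in_tuple (csp_constraints P)) i)) ->
    f.@[point_val R x] = 0.
Proof.
split=> [[r [h [g [Hg ->]]]] x Hx|Hf].
  rewrite raddf_sum /= big1 // => i _; rewrite mevalM.
  have [[j ->]|[j ->]] := Hg i; first by rewrite domain_poly_val mulr0.
  by rewrite constraint_poly_val Hx mulr0.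
have dom i : @csp_generator R p G P (domain_poly R p i).
  by left; exists i.
rewrite -[f]mulr1 -(sum_lagrange R p) big_distrr /=.
apply: ideal_sum => x _.
have He := lagrange_eval dom x.
have [/forallP Hx|] := boolP [forall i, satisfies x (tnth (in_tuple (csp_constraints P)) i)].
  by have := He f; rewrite Hf // mpolyC0 subr0.
rewrite negb_forall => /existsP[i Hi].
apply: ideal_mul.
set c := tnth _ i in Hi.
(* The polynomial of a violated constraint has value 1 at [x], so multiplying [lagrange x] by this
   generator does not change it modulo the ideal. *)
have -> : lagrange R x = constraint_poly R c * lagrange R x +
    (- 1) * ((constraint_poly R c - 1) * lagrange R x) by ring.
apply: ideal_add.
  rewrite mulrC; apply/ideal_mul/ideal_gen; right; by exists i.
by apply: ideal_mul; have := He (constraint_poly R c);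
  rewrite constraint_poly_val Hi mpolyC1.
Qed.

End Ideal.

(** * The decision procedure on encoded instances *)

Section Data.
Variables (p n : nat).

Definition constr_data (c : csp_constraint p n) : raw_constr :=
  ([seq [seq nat_bits (nat_of_ord a) | a <- tval t] | t <- enum (c_rel c)],
   ([seq nat_bits (nat_of_ord i) | i <- tval (c_scope c)], tt)).

Definition int_bits (z : int) : seq bool := ((z < 0)%R) :: nat_bits `|z|%N.

Definition term_data (f : {mpoly rat[n]}) (m : 'X_{1..n}) : term :=
  ((int_bits (numq (mcoeff m f)), (int_bits (denq (mcoeff m f)), tt)),
   ([seq nat_bits k | k <- tval m], tt)).

Definition poly_data (f : {mpoly rat[n]}) : seq term :=
  [seq term_data f m | m <- msupp f].

Definition var_names : seq (seq bool) :=
  [seq nat_bits (nat_of_ord i) | i <- enum 'I_n].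

End Data.

Definition imp_data (R : realType) (p d : nat) (G : constraint_language p)
    (x : imp_instance R d G) : raw_inst :=
  (var_names (csp_nvars (imp_csp x)),
   ([seq constr_data c | c <- csp_constraints (imp_csp x)],
    ([seq poly_data f | f <- tval (imp_coords x)], tt))).

Lemma represents_imp (R : realType) (p d : nat) (G : constraint_language p)
    (x : imp_instance R d G) : represents (enc_imp x) (enc (imp_data x)).
Proof.
have repr_nat k : represents (enc_nat k) (enc (nat_bits k)).
  exact: represents_bits.
apply: represents_triple.
- by apply: represents_list => i; apply: repr_nat.
- apply: represents_list => c; apply: represents_pair.
    apply: represents_list => t; apply: represents_list => a; exact: repr_nat.
  by apply: represents_list => i; apply: repr_nat.
- apply: represents_list => f; apply: represents_list => m.
  apply: represents_pair; last first.
    by apply: represents_list => k; apply: repr_nat.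
  by apply: represents_pair; apply: represents_bits.
Qed.

Section Instance.
Variables (p n : nat).
Hypothesis p_prime : prime p.
Notation F := ('F_p).
Notation vars := (var_names n).
Notation point := ((size vars).-tuple F).

Lemma var_names_uniq : uniq vars.
Proof.
rewrite map_inj_uniq ?enum_uniq // => i j /nat_bits_inj; exact: val_inj.
Qed.

Lemma mem_var_names (i : 'I_n) : nat_bits i \in vars.
Proof. by apply: (map_f (fun i : 'I_n => nat_bits i)); rewrite mem_enum. Qed.

Definition to_fun (x : point) : {ffun 'I_n -> F} :=
  [ffun i : 'I_n => var_val x (nat_bits i)].

Lemma to_fun_surj (y : {ffun 'I_n -> F}) : exists x, to_fun x = y.
Proof.
pose g (k : seq bool) : F := oapp y 0%R (insub (bval k) : option 'I_n).
exists (map_tuple g (in_tuple vars)); apply/ffunP => i; rewrite ffunE /var_val.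
rewrite (nth_map [::]) ?index_mem ?mem_var_names //.
by rewrite nth_index ?mem_var_names // /g bval_nat_bits valK.
Qed.

Lemma constr_dataE (c : csp_constraint p n) :
  constr_of p (constr_data c) =
  ([seq tval t | t <- enum (c_rel c)],
   [seq nat_bits (nat_of_ord i) | i <- tval (c_scope c)]).
Proof.
rewrite /constr_of /constr_data /=; congr pair; rewrite -map_comp.
apply: eq_map => t /=; rewrite -map_comp map_id_in // => a _ /=.
have lt : nat_of_ord a < p by have := ltn_ord a; rewrite {2}Fp_cast.
rewrite /digit map_f; last by rewrite mem_iota.
by rewrite bval_nat_bits; apply: val_inj; rewrite /= val_Fp_nat // modn_small.
Qed.

Lemma sat_constr_of (c : csp_constraint p n) (x : point) :
  ([seq var_val x k | k <- (constr_of p (constr_data c)).2]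
     \in (constr_of p (constr_data c)).1) = satisfies (to_fun x) c.
Proof.
rewrite constr_dataE /satisfies /=.
have -> : [seq var_val x k | k <- [seq nat_bits (nat_of_ord i)
      | i <- tval (c_scope c)]] =
    tval [tuple to_fun x (tnth (c_scope c) j) | j < c_arity c].
  rewrite -map_comp -[in LHS](map_tnth_enum (c_scope c)) -map_comp.
  by apply: eq_map => j; rewrite /= ffunE.
by rewrite mem_map ?mem_enum //; apply: val_inj.
Qed.

(** The homogenized system [A w = w_0 b] holds on the tuples, hence on their span; at [w_0 = 1] it
    is the defining system of the relation. *)
Lemma ok_constr_of (c : csp_constraint p n) : linear_relation (c_rel c) ->
  ok_constr vars (constr_of p (constr_data c)).
Proof.
move=> [m [A [b HA]]]; rewrite constr_dataE; split=> /=.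
- by rewrite all_map; apply/allP => t _ /=; rewrite size_map !size_tuple.
- by move=> _ /mapP[i _ ->]; apply: mem_var_names.
move=> t; rewrite size_map size_tuple => Et.
pose L := hom_tuples (constr_of p (constr_data c)).
have H w : lspan L w ->
    (A *m (\col_(j < c_arity c) w j.+1) = w 0%N *: b)%R.
  move: w; apply: lspan_ind_lin => [|a w z Hw Hz|v].
  - by rewrite scale0r -[RHS](mulmx0 _ A); congr mulmx; apply/colP => j; rewrite !mxE.
  - rewrite scalerDl -scalerA -Hw -Hz scalemxAr -mulmxDr; congr mulmx.
    by apply/colP => j; rewrite !mxE.
  rewrite /L constr_dataE => /mapP[_ /mapP[u uR ->] ->] /=.
  rewrite scale1r; have /HA <- : u \in c_rel c by rewrite -mem_enum.
  by congr mulmx; apply/colP => j; rewrite !mxE (tnth_nth 0%R).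
move=> Ht; have := H _ (_ : lspan L _).
rewrite /L constr_dataE => /(_ _ Ht) /=; rewrite scale1r => E.
have tP : size t == c_arity c by rewrite Et.
have -> : t = tval (Tuple tP) by [].
rewrite mem_map; last exact: val_inj.
rewrite mem_enum; apply/HA; rewrite -E; congr mulmx.
by apply/colP => j; rewrite !mxE (tnth_nth 0%R).
Qed.

Local Open Scope ring_scope.

Definition rat_point (y : {ffun 'I_n -> F}) (i : 'I_n) : rat := (nat_of_ord (y i))%:R.

Lemma signed_int_bits (z : int) : signed (int_bits z) = z%:~R.
Proof.
rewrite /signed -[head _ _]/(z < 0) -[behead _]/(nat_bits `|z|%N) bval_nat_bits.
by rewrite [z in RHS]intEsign rmorphM /= rmorph_sign.
Qed.

Lemma entry_val_coef (w : nat) (a : rat) :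
  entry_val (w, (int_bits (numq a), behead (int_bits (denq a)))) = w%:R * a.
Proof.
rewrite /entry_val -[(_, _).2.1]/(int_bits (numq a)) signed_int_bits.
rewrite -[(_, _).2.2]/(nat_bits `|denq a|%N) bval_nat_bits -[a in RHS]divq_num_den.
congr (_ * (_ / _)); exact: (congr1 (fun z : int => z%:~R : rat) (absz_denq a)).
Qed.

Lemma powers_data (m : 'X_{1..n}) :
  powers vars [seq nat_bits k | k <- tval m] =
  [seq (nat_bits i, nat_bits (m i)) | i : 'I_n <- enum 'I_n & m i != 0%N].
Proof.
rewrite /powers; have -> : tval m = [seq m i | i <- enum 'I_n].
  by rewrite -[LHS]map_tnth_enum; apply: eq_map => i; rewrite mnm_tnth.
rewrite -map_comp /var_names zip_map filter_map; congr map.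
by apply: eq_filter => i /=; rewrite nat_bits0.
Qed.

Lemma prod_powers (m : 'X_{1..n}) (x : point) :
  (\prod_(km <- powers vars [seq nat_bits k | k <- tval m])
     power_val x km)%N = (\prod_(i < n) nat_of_ord (to_fun x i) ^ m i)%N.
Proof.
rewrite powers_data big_map big_filter big_enum_cond /= big_mkcond /=.
apply: eq_bigr => i _; rewrite /power_val -[(_, _).2]/(nat_bits (m i)).
rewrite bval_nat_bits ffunE.
by have [->|] := eqVneq (m i) 0%N.
Qed.

Lemma size_powers (m : 'X_{1..n}) :
  (size (powers vars [seq nat_bits k | k <- tval m]) <= mdeg m)%N.
Proof.
rewrite powers_data size_map mdegE -sum1_size big_filter big_enum_cond /= big_mkcond /=.
by apply: leq_sum => i _; case: (m i).
Qed.

Lemma mem_powers (m : 'X_{1..n}) d km : (mdeg m <= d)%N ->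
  km \in powers vars [seq nat_bits k | k <- tval m] ->
  km.1 \in vars /\ km.2 \in [seq nat_bits i | i <- iota 0 d.+1].
Proof.
move=> le; rewrite powers_data => /mapP[i _ ->]; split; first exact: mem_var_names.
apply: (map_f nat_bits); rewrite mem_iota add0n ltnS; apply: leq_trans le.
by rewrite mdegE (bigD1 i) //= leq_addr.
Qed.

Section Orthogonal.
Variables (d : nat) (cs : seq (constr p)).
Hypothesis cs_ok : all_ok vars cs.
Hypothesis cs_sat : sat vars cs != set0.
Implicit Types f : {mpoly rat[n]}.

(** By [weightP], multiplying the tested sum by the number of solutions gives [p!^(2d)] times the
    inner product; both factors are nonzero. *)
Lemma orthogonal_toE f (m' : 'X_{1..n}) :
  (forall m, m \in msupp f -> (mdeg m <= d)%N) -> (mdeg m' <= d)%N ->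
  orthogonal_to d vars cs (poly_data f) (term_data f m') =
  (\sum_(x in sat vars cs) f.@[rat_point (to_fun x)] *
     \prod_i rat_point (to_fun x) i ^+ m' i == 0).
Proof.
move=> degf degm'; rewrite /orthogonal_to zero_sumE; last first.
  rewrite all_map all_map; apply/allP => m _.
  change (bval (nat_bits `|denq f@_m|%N) != 0%N).
  by rewrite bval_nat_bits absz_eq0 denq_eq0.
rewrite big_map big_map.
pose W (m : 'X_{1..n}) := weight d (d + d) vars cs
  (powers vars [seq nat_bits k | k <- tval m] ++
   powers vars [seq nat_bits k | k <- tval m']).
rewrite (eq_bigr (fun m => (W m)%:R * f@_m)); last first.
  by move=> m _; apply: entry_val_coef.
have EW m : m \in msupp f -> #|sat vars cs|%:R * (W m)%:R =
    (p`! ^ (d + d))%:R * \sum_(x in sat vars cs)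
      (\prod_i rat_point (to_fun x) i ^+ m i) *
      (\prod_i rat_point (to_fun x) i ^+ m' i) :> rat.
  move=> mf; rewrite -natrM /W /= -weightP //.
  - rewrite natrM natr_sum; congr (_ * _); apply: eq_bigr => x _.
    rewrite big_cat /= !prod_powers natrM !natr_prod.
    by congr (_ * _); apply: eq_bigr => i _; rewrite natrX.
  - exact: var_names_uniq.
  - rewrite size_cat leq_add //; apply: leq_trans (size_powers _) _ => //.
    exact: degf.
  - move=> km; rewrite mem_cat => /orP[]; apply: mem_powers => //; exact: degf.
have N0 : #|sat vars cs|%:R != 0 :> rat by rewrite pnatr_eq0 cards_eq0.
have P0 : (p`! ^ (d + d))%:R != 0 :> rat.
  by rewrite pnatr_eq0 expn_eq0 negb_and -lt0n fact_gt0.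
rewrite -(inj_eq (mulfI N0)) mulr0.
have -> : #|sat vars cs|%:R * (\sum_(m <- msupp f) (W m)%:R * f@_m) =
    (p`! ^ (d + d))%:R * \sum_(x in sat vars cs) f.@[rat_point (to_fun x)] *
      \prod_i rat_point (to_fun x) i ^+ m' i.
  rewrite big_distrr /=.
  transitivity (\sum_(m <- msupp f) (p`! ^ (d + d))%:R *
      (\sum_(x in sat vars cs) (f@_m * \prod_i rat_point (to_fun x) i ^+ m i) *
      (\prod_i rat_point (to_fun x) i ^+ m' i)) : rat).
    rewrite !big_seq; apply: eq_bigr => m mf; rewrite mulrA EW // -mulrA.
    congr (_ * _); rewrite mulrC big_distrr /=; apply: eq_bigr => x _.
    by rewrite mulrA.
  rewrite -big_distrr /=; congr (_ * _); rewrite exchange_big /=.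
  by apply: eq_bigr => x _; rewrite -big_distrl /= mevalE.
by rewrite mulf_eq0 (negPf P0).
Qed.

(* If [f] is orthogonal on the solutions to its own monomials, then it is     *)
(* orthogonal to itself.                                                      *)
Lemma orthogonal_vanish f :
  (forall m, m \in msupp f -> (mdeg m <= d)%N) ->
  all (fun b => orthogonal_to d vars cs (poly_data f) b) (poly_data f) <->
  forall x, x \in sat vars cs -> f.@[rat_point (to_fun x)] = 0.
Proof.
move=> degf; rewrite all_map; split=> [/allP H|H]; last first.
  apply/allP => m mf; rewrite /= orthogonal_toE ?degf //.
  by rewrite big1 // => x /H ->; rewrite mul0r.
have S0 : \sum_(x in sat vars cs) f.@[rat_point (to_fun x)] ^+ 2 = 0.
  transitivity (\sum_(m <- msupp f) f@_m * \sum_(x in sat vars cs)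
      f.@[rat_point (to_fun x)] * \prod_i rat_point (to_fun x) i ^+ m i).
    under [RHS]eq_bigr => m _ do rewrite big_distrr.
    rewrite exchange_big /=; apply: eq_bigr => x _.
    rewrite expr2 {2}mevalE big_distrr /=; apply: eq_bigr => m _; ring.
  rewrite big_seq big1 // => m mf.
  by have := H m mf; rewrite /= orthogonal_toE ?degf // => /eqP ->; rewrite mulr0.
move=> x xs; have := psumr_eq0P (fun x _ => sqr_ge0 f.@[rat_point (to_fun x)]) S0 xs.
by move=> /eqP; rewrite sqrf_eq0 => /eqP.
Qed.

End Orthogonal.
End Instance.

(** * Rational coordinates of the real polynomial *)

Section Presentation.
Local Open Scope ring_scope.
Variables (R : realType) (p d : nat) (G : constraint_language p).
Variable x : imp_instance R d G.
Notation n := (csp_nvars (imp_csp x)).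

Lemma ratr_eval (f : {mpoly rat[n]}) (y : {ffun 'I_n -> 'F_p}) :
  (map_mpoly (ratr : rat -> R) f).@[point_val R y] = ratr f.@[rat_point y].
Proof.
rewrite !mevalE rmorph_sum /=.
rewrite (perm_big _ (msupp_map_mpoly _ (fmorph_inj _))) /=.
apply: eq_bigr => m _; rewrite mcoeff_map_mpoly rmorphM rmorph_prod /=.
congr (_ * _); apply: eq_bigr => i _.
by rewrite rmorphXn /= ratr_nat.
Qed.

(** Solutions have integer coordinates, so the coordinate polynomials take rational values there,
    and [rat_free] applies to the resulting relation. *)
Lemma imp_poly_eq0 (y : {ffun 'I_n -> 'F_p}) :
  (imp_poly x).@[point_val R y] = 0 <->
  forall f, f \in tval (imp_coords x) -> f.@[rat_point y] = 0.
Proof.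
rewrite /imp_poly /poly_of_coords raddf_sum /=.
have -> : \sum_j (tnth (imp_basis x) j *:
      map_mpoly (ratr : rat -> R) (tnth (imp_coords x) j)).@[point_val R y] =
    \sum_j ratr (tnth (imp_coords x) j).@[rat_point y] * tnth (imp_basis x) j.
  by apply: eq_bigr => j _; rewrite mevalZ ratr_eval mulrC.
split=> [/imp_basis_free H f /tnthP[j ->]|H]; first exact: H.
by rewrite big1 // => j _; rewrite H ?mem_tnth // rmorph0 mul0r.
Qed.

(** A coefficient of the real polynomial is the combination of those of its coordinates along the
    basis, so above degree [d] all of them vanish by [rat_free]. *)
Lemma imp_coords_degree f m :
  f \in tval (imp_coords x) -> m \in msupp f -> (mdeg m <= d)%N.
Proof.
move=> /tnthP[j ->]; rewrite mcoeff_msupp; apply: contraNT; rewrite -ltnNge => lt.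
apply/eqP; apply: (imp_basis_free (i := x) (a := fun j => (tnth (imp_coords x) j)@_m)).
have : m \notin msupp (imp_poly x).
  apply/negP => /msize_mdeg_lt; have := imp_degree x; rewrite -/(imp_poly x); lia.
rewrite mcoeff_msupp negbK => /eqP E; rewrite -[RHS]E.
rewrite /imp_poly /poly_of_coords raddf_sum /=; apply: eq_bigr => i _.
by rewrite mcoeffZ mcoeff_map_mpoly mulrC.
Qed.

End Presentation.

Lemma decide_imp (R : realType) (p d : nat) (hp : prime p)
    (G : constraint_language p)
    (hG : forall (k : nat) (S : {set k.-tuple 'F_p}), G k S -> linear_relation S)
    (x : imp_instance R d G) :
  decide p d (imp_data x) = true <-> imp_yes x.
Proof.
rewrite /imp_yes csp_idealP /decide /=.
set n := csp_nvars _; set P := imp_csp x; set vars := var_names n.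
rewrite -map_comp; set cs := map _ _.
have ok : all_ok vars cs.
  move=> c' /(nthP (constr_of p ([::], ([::], tt)))) [i].
  rewrite size_map => lt <- {c'}.
  pose c := tnth (in_tuple (csp_constraints P)) (Ordinal lt).
  rewrite (nth_map c) //=.
  have <- : c = nth c (csp_constraints P) i := tnth_nth c _ _.
  by apply: ok_constr_of => //; apply: hG; apply: (csp_in_language (Ordinal lt)).
have satE z : (z \in sat vars cs) <->
    forall i, satisfies (to_fun z) (tnth (in_tuple (csp_constraints P)) i).
  rewrite inE all_map -[csp_constraints P]/(tval (in_tuple _)).
  split=> [/all_tnthP H i|H].
    by have := H i; rewrite /= sat_constr_of.
  by apply/all_tnthP => i; rewrite /= sat_constr_of.
rewrite feas_sat //; last exact: var_names_uniq.
rewrite negbK.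
have Hy : (forall z, z \in sat vars cs -> forall f, f \in tval (imp_coords x) ->
      f.@[rat_point (to_fun z)]%R = 0%R) <->
    (forall y : {ffun 'I_n -> 'F_p},
      (forall i, satisfies y (tnth (in_tuple (csp_constraints P)) i)) ->
      (imp_poly x).@[point_val R y]%R = 0%R).
  split=> H y Hy.
    have [z Ez] := to_fun_surj y; rewrite -Ez in Hy *.
    by apply/imp_poly_eq0; apply: H; apply/satE.
  by apply/imp_poly_eq0; apply: H; apply/satE.
(* Without solutions every polynomial is in the ideal, and the test accepts at once; averages are
   only used when there is a solution. *)
rewrite -Hy; have [S0|SN] /= := eqVneq (sat vars cs) set0.
  by split=> // _ z; rewrite S0 inE.
rewrite all_map; split=> [/allP H z zs f fx|H].
  by have /orthogonal_vanish := H f fx; apply=> // m; apply: imp_coords_degree.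
apply/allP => f fx; apply/orthogonal_vanish => // [m|z zs].
  exact: imp_coords_degree.
exact: H.
Qed.

Theorem theorem5p30 (R : realType) (p d : nat) (hp : prime p)
    (Gamma : constraint_language p)
    (hGamma : forall (k : nat) (S : {set k.-tuple 'F_p}),
        Gamma k S -> linear_relation S) :
  imp_poly_time R d Gamma.
Proof.
apply: (FP_poly_time (FP_decide p d)) => x; first exact: represents_imp.
exact: decide_imp.
Qed.
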